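(* Every vertex-transitive Ramanujan graph of degree at least $5$ is globally rigid in $\mathbb{R}^2$, with the single exception of the graph $G_0$ defined below, which is rigid but not globally rigid in $\mathbb{R}^2$. Every vertex-transitive Ramanujan graph of degree $4$ that either has at least $53$ vertices or is bipartite is globally rigid in $\mathbb{R}^2$. Here $G_0$ is the $5$-regular graph with vertex set $\{(i,j): i,j\in\{1,\dots,6\},\ i\neq j\}$ in which $(i,j)$ is adjacent to $(i,j')$ for every $j'\neq j$ (with $j'\ne i$) and to $(j,i)$; i.e. $G_0$ is obtained from $K_6$ by replacing each vertex by a copy of $K_5$ so that each pair of copies is joined by exactly one edge and each vertex has exactly one neighbour outside its copy.
   Context: All graphs are finite and simple. For $k\geq 3$, a connected $k$-regular graph is a Ramanujan graph if every adjacency eigenvalue $\lambda\neq\pm k$ satisfies $|\lambda|\leq 2\sqrt{k-1}$. A graph is vertex-transitive if its automorphism group acts transitively on its vertices. A $d$-dimensional framework is a pair $(G,p)$ with $p:V(G)\to\mathbb{R}^d$; it is generic if the coordinates of all $p(v)$ are algebraically independent over $\mathbb{Q}$. Frameworks $(G,p),(G,q)$ are equivalent if $\|p(u)-p(v)\|=\|q(u)-q(v)\|$ for every edge $uv$, and congruent if this holds for all pairs $u,v$. A framework $(G,p)$ is rigid if there is $\varepsilon>0$ such that every equivalent $(G,q)$ with $\|p(v)-q(v)\|<\varepsilon$ for all $v$ is congruent to $(G,p)$; it is globally rigid if every equivalent framework is congruent to it. A graph is rigid (resp. globally rigid) in $\mathbb{R}^d$ if some (equivalently every) generic framework of it in $\mathbb{R}^d$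 is rigid (resp. globally rigid). *)

(* Defs.v *)
(* mpoly comes first: it has its own [symmetric]. *)
From HB Require Import structures.
From mathcomp Require Import mpoly.
From mathcomp Require Import all_boot all_order all_algebra all_fingroup.
From mathcomp Require Import reals.

Set Implicit Arguments.
Unset Strict Implicit.
Unset Printing Implicit Defensive.

Import Order.TTheory GRing.Theory Num.Theory.
Local Open Scope ring_scope.

Record sgraph := SGraph {
  vertex :> finType;
  adj : rel vertex;
  adj_sym : symmetric adj;
  adj_irr : irreflexive adj }.

Definition connected (G : sgraph) : Prop :=
  (0 < #|G|)%N /\ forall x y : G, connect (@adj G) x y.

Definition regular (G : sgraph) (k : nat) : Prop :=
  forall x : G, #|[set y | adj x y]| = k.

Definition bipartite (G : sgraph) : Prop :=
  exists c : G -> bool, forall x y, adj x y -> c x != c y.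

Definition graph_iso (G H : sgraph) : Prop :=
  exists f : G -> H, bijective f /\ forall x y, adj (f x) (f y) = adj x y.

Definition graph_aut (G : sgraph) : {set {perm G}} :=
  [set s : {perm G} | [forall x, forall y, adj (s x) (s y) == adj x y]].

Lemma graph_autP (G : sgraph) (s : {perm G}) :
  reflect (forall x y, adj (s x) (s y) = adj x y) (s \in graph_aut G).
Proof.
rewrite inE; apply: (iffP forallP) => h x.
  by move=> y; apply/eqP; have /forallP := h x; apply.
by apply/forallP => y; rewrite h.
Qed.

Lemma graph_aut_group_set (G : sgraph) : group_set (graph_aut G).
Proof.
apply/group_setP; split; first by apply/graph_autP => x y; rewrite !perm1.
move=> s t /graph_autP hs /graph_autP ht.
by apply/graph_autP => x y; rewrite !permM ht hs.
Qed.

Canonical graph_aut_group (G : sgraph) : {group {perm G}} :=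
  Group (graph_aut_group_set G).

Definition vertex_transitive (G : sgraph) : Prop :=
  [transitive graph_aut G, on [set: G] | 'P].

Definition adjmx (R : realType) (G : sgraph) : 'M[R]_#|G| :=
  \matrix_(i, j) (adj (enum_val i) (enum_val j))%:R.

Definition ramanujan (R : realType) (G : sgraph) (k : nat) : Prop :=
  [/\ (3 <= k)%N, connected G, regular G k &
      forall lam : R, eigenvalue (adjmx R G) lam ->
        lam != k%:R -> lam != - k%:R ->
        `|lam| <= 2 * Num.sqrt (k%:R - 1)].

(* The library norm on 'rV[R]_d is the sup norm. *)
Definition enorm (R : realType) (d : nat) (v : 'rV[R]_d) : R :=
  Num.sqrt (\sum_(i < d) v 0 i ^+ 2).

Definition placement (R : realType) (d : nat) (G : sgraph) := G -> 'rV[R]_d.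

Definition alg_independent (R : realType) (I : finType) (x : I -> R) : Prop :=
  forall P : {mpoly rat[#|I|]},
    (map_mpoly (@ratr R) P).@[fun i => x (enum_val i)] = 0 -> P = 0.

Section Frameworks.
Variables (R : realType) (d : nat) (G : sgraph).
Implicit Types p q : placement R d G.

Definition generic p : Prop :=
  alg_independent (fun vi : G * 'I_d => p vi.1 0 vi.2).

Definition equivalent p q : Prop :=
  forall u v, adj u v -> enorm (p u - p v) = enorm (q u - q v).

Definition congruent p q : Prop :=
  forall u v, enorm (p u - p v) = enorm (q u - q v).

Definition framework_rigid p : Prop :=
  exists2 eps : R, 0 < eps &
    forall q, equivalent p q -> (forall v, enorm (p v - q v) < eps) ->
      congruent p q.

Definition framework_globally_rigid p : Prop :=
  forall q, equivalent p q -> congruent p q.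

End Frameworks.

Definition rigid_in (R : realType) (d : nat) (G : sgraph) : Prop :=
  exists2 p : placement R d G, generic p & framework_rigid p.

Definition globally_rigid_in (R : realType) (d : nat) (G : sgraph) : Prop :=
  exists2 p : placement R d G, generic p & framework_globally_rigid p.

Definition G0_vertex := {ij : 'I_6 * 'I_6 | ij.1 != ij.2}.

Definition G0_adj : rel G0_vertex := fun u v =>
  let: (i, j) := val u in let: (i', j') := val v in
  ((i' == i) && (j' != j)) || ((i' == j) && (j' == i)).

Lemma G0_adj_sym : symmetric G0_adj.
Proof.
move=> [[i j] ?] [[i' j'] ?]; rewrite /G0_adj /=.
by rewrite (eq_sym i i') (eq_sym j j') (eq_sym i j') (eq_sym j i') [(_ == j) && _]andbC.
Qed.

Lemma G0_adj_irr : irreflexive G0_adj.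
Proof.
by move=> [[i j] /= ij]; rewrite /G0_adj /= !eqxx /= (negbTE ij).
Qed.

Definition G0 : sgraph := SGraph G0_adj_sym G0_adj_irr.

(* Main.v *)
(** Genericity is used through derivations: if the coordinates of [p] are algebraically
    independent, their derivatives can be prescribed arbitrarily by a derivation of the
    reals, and differentiating an identity between squared lengths gives linear relations
    between infinitesimal motions. Along Henneberg moves this shows that Laman graphs are
    infinitesimally rigid, and by induction on the vertices that a framework which stays
    infinitesimally rigid after deletion of any vertex is globally rigid.

    In a vertex-transitive [k]-regular graph, submodularity of cuts leaves two cases.
    Either all nontrivial cuts have at least [3 k / 2] edges, and counting over maximal
    tight sets yields a Laman graph spanning [G - v]. Or the vertices fall into blocks of
    [m] vertices, [k <= m < 3 k / 2], each vertex having one neighbour outside its block.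
    Testing the Ramanujan bound on block-constant functions shows, for [k >= 5], that
    [k <= 6] and that any two blocks are adjacent; the blocks, which are tight, then glue
    to a Laman graph of [G - v] unless they are six copies of [K_5], that is [G = G0].
    For [k = 4] the blocks are copies of [K_4], which excludes bipartite graphs, and there
    are at most 13 of them.

    A Laman graph spanning [G0] has seven edges in each [K_5] and all fifteen cross edges.
    So [G0] minus a cross edge has a flex, and the squared length [l] of that edge is
    transcendental over the ring generated by the other squared lengths. Extend partial
    isomorphisms between subrings of the reals successively to all the coordinates: an
    element of odd degree can always be sent somewhere, one of even degree or
    transcendental can be sent elsewhere than to itself. Hence either some isomorphism
    fixing the squared lengths moves a coordinate, and the moved coordinates are an
    equivalent but not congruent framework, or the isomorphism [l |-> - l] extends to all
    the coordinates, although [l] is a sum of squares of them. *)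
From HB Require Import structures.
From mathcomp Require Import -(notations) mpoly.
Require Import Defs.
From mathcomp Require Import all_boot all_order all_algebra all_fingroup reals.
From mathcomp Require classical_sets complex.
From mathcomp Require Import polyrcf boolp ring lra zify.

Set Implicit Arguments.
Unset Strict Implicit.
Unset Printing Implicit Defensive.

Import Order.TTheory GRing.Theory Num.Theory.

Local Open Scope ring_scope.

(** * Subrings and derivations *)

(** Derivations are built on all of [R], not only on the field generated by the coordinates of [p].
    They therefore also differentiate the coordinates of an arbitrary equivalent framework [q],
    whose dependence on [p] is unknown; this replaces varying [p] and following [q], and is why they
    must be extended across algebraic and transcendental elements alike.

    The threshold [3 k / 2] is Laman's count scaled by [k / 4]: since [2 e(X) = k |X| - cut X], the
    inequality [e(X) <= (k / 4) (2 |X| - 3)] says exactly that [2 cut X >= 3 k].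

    The obstacle for [G0] is that [R] is not algebraically closed: a polynomial of even degree
    transported by an isomorphism may have no real root, so an isomorphism need not extend. But a
    polynomial of even degree with one real root has another, since dividing by a linear factor
    leaves odd degree. Which case occurs cannot be controlled, so the argument has to conclude from
    both. *)

Definition derivation (R : pzRingType) (D : R -> R) : Prop :=
  (forall a b, D (a + b) = D a + D b) /\
  (forall a b, D (a * b) = a * D b + b * D a).

Record is_subring (T : nzRingType) (S : T -> Prop) : Prop := IsSubring {
  subring1 : S 1;
  subringB : forall a b, S a -> S b -> S (a - b);
  subringM : forall a b, S a -> S b -> S (a * b) }.

Definition coefs_in (T : nzRingType) (S : T -> Prop) (P : {poly T}) : Prop :=
  forall i, S P`_i.

Definition adjoin (T : nzRingType) (S : T -> Prop) (z : T) (t : T) : Prop :=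
  exists2 P : {poly T}, coefs_in S P & t = P.[z].

Section Subrings.
Variables (T : comNzRingType) (S : T -> Prop).
Hypothesis ringS : is_subring S.

Lemma subring0 : S 0.
Proof. by rewrite -(subrr 1); apply: subringB => //; apply: subring1. Qed.

Lemma subringN a : S a -> S (- a).
Proof. by move=> Sa; rewrite -sub0r; apply: subringB => //; apply: subring0. Qed.

Lemma subringD a b : S a -> S b -> S (a + b).
Proof.
by move=> Sa Sb; rewrite -[b]opprK; apply: subringB => //; apply: subringN.
Qed.

Lemma subring_sum (I : Type) (r : seq I) (P : pred I) (F : I -> T) :
  (forall i, P i -> S (F i)) -> S (\sum_(i <- r | P i) F i).
Proof.
move=> SF; elim/big_ind: _ => //; first exact: subring0.
by move=> x y; apply: subringD.
Qed.

Lemma coefs_inC c : S c -> coefs_in S c%:P.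
Proof. by move=> Sc i; rewrite coefC; case: eqP => // _; apply: subring0. Qed.

Lemma coefs_inX : coefs_in S 'X.
Proof.
by move=> i; rewrite coefX; case: eqP => _; [apply: subring1|apply: subring0].
Qed.

Lemma coefs_inB P Q : coefs_in S P -> coefs_in S Q -> coefs_in S (P - Q).
Proof. by move=> SP SQ i; rewrite coefB; apply: subringB. Qed.

Lemma coefs_inD P Q : coefs_in S P -> coefs_in S Q -> coefs_in S (P + Q).
Proof. by move=> SP SQ i; rewrite coefD; apply: subringD. Qed.

Lemma coefs_inM P Q : coefs_in S P -> coefs_in S Q -> coefs_in S (P * Q).
Proof.
by move=> SP SQ i; rewrite coefM; apply: subring_sum => j _; apply: subringM.
Qed.

Lemma coefs_inXn n : coefs_in S 'X^n.
Proof.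
by move=> i; rewrite coefXn; case: eqP => _; [apply: subring1|apply: subring0].
Qed.

Lemma adjoin_subring z : is_subring (adjoin S z).
Proof.
split.
- by exists 1; rewrite ?hornerC //; apply: coefs_inC; apply: subring1.
- move=> _ _ [P SP ->] [Q SQ ->]; exists (P - Q); rewrite ?hornerE //.
  exact: coefs_inB.
- move=> _ _ [P SP ->] [Q SQ ->]; exists (P * Q); rewrite ?hornerM //.
  exact: coefs_inM.
Qed.

Lemma adjoin_base z t : S t -> adjoin S z t.
Proof. by move=> St; exists t%:P; rewrite ?hornerC //; apply: coefs_inC. Qed.

Lemma adjoin_gen z : adjoin S z z.
Proof. by exists 'X; rewrite ?hornerX //; apply: coefs_inX. Qed.

(* One step of pseudo-division. *)
Lemma size_cancel_lead (P p : {poly T}) : p != 0 -> (size p <= size P)%N ->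
  (size ((lead_coef p)%:P * P - (lead_coef P)%:P * 'X^(size P - size p) * p)%R
     < size P)%N.
Proof.
move=> p0 le; have sp : (0 < size p)%N by rewrite size_poly_gt0.
have sP : (0 < size P)%N by apply: leq_trans le.
rewrite -[ltnRHS](prednK sP) ltnS; apply/leq_sizeP => j.
rewrite leq_eqVlt => /predU1P[<-|lt].
  rewrite coefB coefCM -mulrA coefCM coefXnM.
  case: ltnP => [|_]; first by lia.
  rewrite (_ : ((size P).-1 - (size P - size p) = (size p).-1)%N); last by lia.
  by rewrite -!lead_coefE mulrC subrr.
rewrite coefB coefCM -mulrA coefCM coefXnM.
case: ltnP => [|_]; first by lia.
have le_j : (size P <= j)%N by rewrite -(prednK sP).
rewrite [P`_j]nth_default // [p`__]nth_default ?mulr0 ?subrr //.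
by rewrite leq_subRL ?(leq_trans (leq_subr _ _)) // subnK.
Qed.

End Subrings.

Section Extend.
Variables (T : comNzRingType) (F : fieldType) (f : {rmorphism T -> F}).
Variable S : T -> Prop.
Hypothesis ringS : is_subring S.
Hypothesis kerS : forall t, S t -> f t = 0 -> t = 0.

(** [T] stands for the dual numbers with [f] the first component, or for [R * R] with [f] one of the
    projections; [S] is then the graph of a derivation or of an isomorphism. Injectivity of [f] on
    [S] says that the graph is single-valued over that component. *)
Definition algebraic_over (z : F) : Prop :=
  exists P : {poly T}, [/\ coefs_in S P, P != 0 & (map_poly f P).[z] = 0].

Definition minimal_at (z : F) (p : {poly T}) : Prop :=
  [/\ coefs_in S p, p != 0, (map_poly f p).[z] = 0 &
      forall P, coefs_in S P -> (map_poly f P).[z] = 0 -> (size P < size p)%N -> P = 0].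

Lemma map_poly_inj0 P : coefs_in S P -> map_poly f P = 0 -> P = 0.
Proof.
move=> SP P0; apply/polyP => i; rewrite coef0; apply: kerS => //.
by rewrite -coef_map P0 coef0.
Qed.

Lemma size_map_coefs P : coefs_in S P -> size (map_poly f P) = size P.
Proof.
move=> SP; have [->|P0] := eqVneq P 0; first by rewrite rmorph0 !size_poly0.
rewrite size_map_poly_id0 //; apply: contra P0 => /eqP /(kerS (SP _)) /eqP.
by rewrite lead_coef_eq0.
Qed.

Lemma minimal_exists z : algebraic_over z -> exists p, minimal_at z p.
Proof.
move=> [P [SP P0 Pz]]; move: {2}(size P).+1 (ltnSn (size P)) => n.
elim: n P SP P0 Pz => // n IH P SP P0 Pz ltn.
have [[Q [SQ Q0 Qz lt]]|noQ] := pselect (exists Q : {poly T},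
  [/\ coefs_in S Q, Q != 0, (map_poly f Q).[z] = 0 & (size Q < size P)%N]).
  by apply: (IH Q) => //; lia.
exists P; split=> // Q SQ Qz lt; apply/eqP/negP => /negP Q0.
by apply: noQ; exists Q.
Qed.

(** [S] is only a ring, so dividing by [p] requires multiplying by powers of its leading
    coefficient; these accumulate in [c]. *)
Lemma minimal_dvd z p P : minimal_at z p -> coefs_in S P ->
  (map_poly f P).[z] = 0 ->
  exists c s, [/\ S c, f c != 0, coefs_in S s & c%:P * P = p * s].
Proof.
move=> [Sp p0 pz minp]; move: {2}(size P).+1 (ltnSn (size P)) => n.
elim: n P => // n IH P ltn SP Pz.
have [lt|le] := ltnP (size P) (size p).
  exists 1, 0; rewrite (minp P) //; split=> //; first exact: subring1.
  - by rewrite rmorph1 oner_neq0.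
  - by move=> i; rewrite coef0; apply: subring0.
  - by rewrite !mulr0.
pose Q := (lead_coef p)%:P * P - (lead_coef P)%:P * 'X^(size P - size p) * p.
have lt : (size Q < size P)%N := size_cancel_lead p0 le.
have [lP lp] : S (lead_coef P) /\ S (lead_coef p).
  by split; rewrite lead_coefE.
have SX : coefs_in S ((lead_coef P)%:P * 'X^(size P - size p)).
  by apply: coefs_inM (coefs_inC _ _) (coefs_inXn _ _).
have SQ : coefs_in S Q.
  by apply: coefs_inB (coefs_inM _ (coefs_inC _ _) _) (coefs_inM _ _ _).
have Qz : (map_poly f Q).[z] = 0.
  by rewrite /Q rmorphB !rmorphM /= hornerD hornerN !hornerM Pz pz !mulr0 subrr.
have [c [s [Sc c0 Ss E]]] := IH Q (leq_trans lt ltn) SQ Qz.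
exists (c * lead_coef p), (s + c%:P * ((lead_coef P)%:P * 'X^(size P - size p))).
split.
- by apply: subringM.
- rewrite rmorphM mulf_neq0 //; apply: contra p0 => /eqP /(kerS (Sp _)) /eqP.
  by rewrite lead_coef_eq0.
- by apply: coefs_inD (coefs_inM _ (coefs_inC _ _) _).
- rewrite mulrDr -E /Q rmorphM /=; ring.
Qed.

(** If [f] kills [P.[zeta]], then [z] is a root of [P], so [c P] is a multiple of [p] and [c
    P.[zeta] = 0]. As [T] has zero divisors, cancelling [c] takes the first hypothesis. *)
Lemma kernel_algebraic z p zeta :
  (forall c t, S c -> f c != 0 -> c * t = 0 -> t = 0) ->
  minimal_at z p -> f zeta = z -> p.[zeta] = 0 ->
  forall t, adjoin S zeta t -> f t = 0 -> t = 0.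
Proof.
move=> reg minp fz pz t [P SP ->] fP.
have Pz : (map_poly f P).[z] = 0 by rewrite -fz horner_map.
have [c [s [Sc c0 Ss E]]] := minimal_dvd minp SP Pz.
apply: (reg c) => //; have := congr1 (horner^~ zeta) E.
by rewrite !hornerM hornerC pz mul0r.
Qed.

Lemma kernel_transcendental z zeta : ~ algebraic_over z -> f zeta = z ->
  forall t, adjoin S zeta t -> f t = 0 -> t = 0.
Proof.
move=> trz fz t [P SP ->] fP.
have [->|P0] := eqVneq P 0; first by rewrite horner0.
by case: trz; exists P; split=> //; rewrite -fz horner_map.
Qed.

End Extend.

(** In characteristic 0 the derivative of a nonconstant polynomial is nonzero and of smaller degree,
    so minimality keeps it from vanishing at [z]. *)
Lemma minimal_separable (T : comNzRingType) (R : realType) (f : {rmorphism T -> R})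
    (S : T -> Prop) z p : is_subring S -> (forall t, S t -> f t = 0 -> t = 0) ->
  minimal_at f S z p -> (map_poly f p)^`().[z] != 0.
Proof.
move=> ringS kerS [Sp p0 pz min]; apply/eqP => dz.
have Sp' : coefs_in S p^`().
  move=> i; rewrite coef_deriv; move: (Sp i.+1); move: (p`_i.+1) => c Sc.
  elim: (i.+1) => [|n IH]; first by rewrite mulr0n; apply: subring0.
  by rewrite mulrS; apply: (subringD ringS).
have : p^`() = 0 by apply: min; rewrite ?lt_size_deriv // -deriv_map.
move/(congr1 (map_poly f)); rewrite -deriv_map rmorph0 => dp.
have pC : map_poly f p = ((map_poly f p)`_0)%:P.
  apply/polyP => -[|i]; rewrite coefC //=.
  have := congr1 (fun q : {poly R} => q`_i) dp; rewrite coef_deriv coef0 => /eqP.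
  by rewrite mulrn_eq0 /= => /eqP.
have /eqP[] := p0; apply: (map_poly_inj0 kerS Sp).
by move: pz; rewrite pC hornerC => ->; rewrite polyC0.
Qed.

(* (a, b) stands for a + b eps with eps ^ 2 = 0. *)
Definition dual (R : Type) : Type := (R * R)%type.

Section Dual.
Variable R : comNzRingType.

HB.instance Definition _ := GRing.Zmodule.copy (dual R) (R * R)%type.

Definition dual_one : dual R := (1, 0).
Definition dual_mul (a b : dual R) : dual R := (a.1 * b.1, a.1 * b.2 + b.1 * a.2).

Fact dual_mulA : associative dual_mul.
Proof. by move=> [a a'] [b b'] [c c']; congr (_, _) => /=; ring. Qed.
Fact dual_mulC : commutative dual_mul.
Proof. by move=> [a a'] [b b']; congr (_, _) => /=; ring. Qed.
Fact dual_mul1 : left_id dual_one dual_mul.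
Proof. by move=> [a a']; congr (_, _) => /=; ring. Qed.
Fact dual_mulDl : left_distributive dual_mul +%R.
Proof. by move=> [a a'] [b b'] [c c']; congr (_, _) => /=; ring. Qed.
Fact dual_1neq0 : dual_one != 0.
Proof. by apply/eqP => /(congr1 fst) /= /eqP; rewrite oner_eq0. Qed.

HB.instance Definition _ := GRing.Zmodule_isComNzRing.Build (dual R)
  dual_mulA dual_mulC dual_mul1 dual_mulDl dual_1neq0.

Definition dual_fst (t : dual R) : R := t.1.

Fact dual_fst_zmod : zmod_morphism dual_fst.
Proof. by []. Qed.
Fact dual_fst_monoid : monoid_morphism dual_fst.
Proof. by []. Qed.
HB.instance Definition _ := GRing.isZmodMorphism.Build (dual R) R dual_fst dual_fst_zmod.
HB.instance Definition _ := GRing.isMonoidMorphism.Build (dual R) R dual_fst dual_fst_monoid.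

Definition dual_const (a : R) : dual R := (a, 0).

Fact dual_const_zmod : zmod_morphism dual_const.
Proof. by move=> a b; congr (_, _) => /=; rewrite subr0. Qed.
Fact dual_const_monoid : monoid_morphism dual_const.
Proof. by split=> // a b; congr (_, _) => /=; rewrite !mulr0 addr0. Qed.
HB.instance Definition _ := GRing.isZmodMorphism.Build R (dual R) dual_const dual_const_zmod.
HB.instance Definition _ := GRing.isMonoidMorphism.Build R (dual R) dual_const dual_const_monoid.

(** First-order Taylor expansion in the [eps] direction. *)
Lemma dual_horner (P : {poly dual R}) (z d e : R) :
  P.[(z, d + e) : dual R] =
  P.[(z, d) : dual R] + (0, (map_poly dual_fst P)^`().[z] * e).
Proof.
elim/poly_ind: P => [|P c IH].
  by rewrite !horner0 rmorph0 deriv0 horner0 mul0r addr0.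
rewrite !hornerMXaddC IH rmorphD rmorphM /= map_polyX map_polyC /=.
rewrite derivD derivM derivX derivC addr0 mulr1 !hornerE.
rewrite -[z in (_ + (map_poly _ P).[z]) * e]/(dual_fst ((z, d) : dual R)) horner_map /=.
case: (P.[_]) => a b; congr (_, _) => /=; rewrite /dual_fst /=; ring.
Qed.

End Dual.

(** [S] is the graph of a derivation from a subring of [R] to [R]: being a ring encodes additivity
    and the Leibniz rule, and single-valuedness need only be asked at 0. *)
Definition dual_good (R : realType) (S : dual R -> Prop) : Prop :=
  is_subring S /\ forall t, S t -> t.1 = 0 -> t = 0.

Lemma dual_extend (R : realType) (S : dual R -> Prop) (z : R) : dual_good S ->
  exists d, dual_good (adjoin S (z, d)).
Proof.
move=> [ringS kerS].
suff [d Hd] : exists d, forall t, adjoin S (z, d) t -> dual_fst t = 0 -> t = 0.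
  by exists d; split=> //; apply: adjoin_subring.
have [alg|tr] := pselect (algebraic_over (dual_fst (R := R)) S z); last first.
  (* A transcendental element may receive any derivative. *)
  by exists 0; apply: (kernel_transcendental tr).
have [p minp] := minimal_exists alg; have [Sp p0 pz min] := minp.
pose p' := (map_poly (dual_fst (R := R)) p)^`().
have p'z : p'.[z] != 0 by apply: (@minimal_separable _ _ (@dual_fst R) _ z p ringS kerS minp).
(* The [eps] part of [p.[(z, d)]] is [p.[(z, 0)].2 + p'.[z] * d]; this [d] makes it vanish. *)
exists (- (p.[(z, 0) : dual R]).2 / p'.[z]).
apply: (@kernel_algebraic _ _ (@dual_fst R) _ ringS kerS z p) => //.
- move=> c t Sc c0 E; have := congr1 fst E; have := congr1 snd E => /=.
  case: c c0 {Sc E} => c c'; case: t => a b; rewrite /dual_fst /= => c0 E2 /eqP.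
  rewrite mulf_eq0 (negPf c0) => /eqP a0; move: E2; rewrite a0 mul0r addr0.
  by move=> /eqP; rewrite mulf_eq0 (negPf c0) /= => /eqP ->.
- rewrite -[X in (z, X)]add0r dual_horner -/p' mulrC divfK //.
  have : (p.[(z, 0) : dual R]).1 = 0.
    by rewrite -[_.1]/(dual_fst _) -horner_map.
  by case: (p.[_]) => a b /= ->; congr (_, _) => /=; rewrite ?addr0 ?subrr.
Qed.

Section Maximal.
Import classical_sets.
Local Open Scope classical_set_scope.

Lemma dual_maximal (R : realType) (S : dual R -> Prop) : dual_good S ->
  exists D, derivation D /\ forall t, S t -> D t.1 = t.2.
Proof.
move=> goodS.
pose P (A : set (dual R)) := A = set0 \/ (dual_good A /\ S `<=` A).
have [F FP Ftot|A [PA maxA]] := @Zorn_bigcup (dual R) P.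
  have [F0|/existsNP[X0 /not_implyP[FX0 X0n]]] := pselect (forall X, F X -> X = set0).
    by left; rewrite -subset0 => t [X FX]; rewrite (F0 X FX).
  have [//|[good0 sub0]] := FP _ FX0; right; split; last first.
    by move=> t St; exists X0 => //; apply: sub0.
  have two X Y a b : F X -> F Y -> X a -> Y b -> exists Z, [/\ F Z, Z a & Z b].
    move=> FX FY Xa Yb; have [XY|YX] := Ftot X Y FX FY.
      by exists Y; split=> //; apply: XY.
    by exists X; split=> //; apply: YX.
  have Fgood X a : F X -> X a -> dual_good X.
    by move=> FX Xa; have [X0e|[//]] := FP X FX; rewrite X0e in Xa.
  split; first split.
  - by exists X0 => //; case: good0 => -[].
  - move=> a b [X FX Xa] [Y FY Yb]; have [Z [FZ Za Zb]] := two X Y a b FX FY Xa Yb.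
    by exists Z => //; case: (Fgood Z a FZ Za) => -[_ h _] _; apply: h.
  - move=> a b [X FX Xa] [Y FY Yb]; have [Z [FZ Za Zb]] := two X Y a b FX FY Xa Yb.
    by exists Z => //; case: (Fgood Z a FZ Za) => -[_ _ h] _; apply: h.
  - move=> t [X FX Xt]; case: (Fgood X t FX Xt) => _; exact.
have [A0|[goodA SA]] := PA.
  case: (maxA S); last by right; split.
  rewrite A0; split=> // /(_ 1) h; apply: h.
  by case: goodS => -[].
have [ringA kerA] := goodA.
have total z : exists d, A (z, d).
  have [d good'] := dual_extend z goodA; exists d; apply: contrapT => nA.
  apply: (maxA (adjoin A (z, d))); last first.
    by right; split=> // t St; apply: adjoin_base => //; apply: SA.
  split; first by move=> t At; apply: adjoin_base.
  by move=> /(_ (z, d)) h; apply/nA/h; apply: adjoin_gen.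
have uniq z d d' : A (z, d) -> A (z, d') -> d = d'.
  move=> Ad Ad'; have := kerA _ (subringB ringA Ad Ad') => /=.
  by rewrite subrr => /(_ erefl) /(congr1 snd) /= /eqP; rewrite subr_eq0 => /eqP.
have /choice[D AD] := total; exists D; split; first split.
- by move=> a b; apply: uniq (AD _) _; apply: (subringD ringA (AD a) (AD b)).
- by move=> a b; apply: uniq (AD _) _; apply: (subringM ringA (AD a) (AD b)).
- by move=> [a b] /SA Aab /=; apply: uniq (AD _) Aab.
Qed.

End Maximal.

Lemma rmorph_mmap (n : nat) (K A B : nzRingType) (f : K -> A) (h : 'I_n -> A)
    (g : {rmorphism A -> B}) (P : mpoly n K) :
  g (mmap f h P) = mmap (g \o f) (g \o h) P.
Proof.
rewrite /mmap rmorph_sum; apply: eq_bigr => m _; rewrite rmorphM; congr (_ * _).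
by rewrite /mmap1 rmorph_prod; apply: eq_bigr => i _; rewrite rmorphXn.
Qed.

Lemma eq_mmap (n : nat) (K A : nzRingType) (f f' : K -> A) (h h' : 'I_n -> A)
    (P : mpoly n K) : f =1 f' -> h =1 h' ->
  mmap f h P = mmap f' h' P.
Proof.
move=> ff' hh'; rewrite /mmap; apply: eq_bigr => m _; rewrite ff'; congr (_ * _).
by rewrite /mmap1; apply: eq_bigr => i _; rewrite hh'.
Qed.

Lemma meval_map (n : nat) (K : nzRingType) (A : comNzRingType) (f : {rmorphism K -> A})
    (h : 'I_n -> A) (P : mpoly n K) :
  meval h (map_mpoly f P) = mmap f h P.
Proof.
rewrite /map_mpoly (rmorph_mmap _ _ (meval h)); apply: eq_mmap => [a|i] /=.
  exact: mevalC.
exact: mevalXU.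
Qed.

(** The rational polynomials in the dual numbers [x i + delta i eps] form the graph of a derivation:
    by independence, only the zero polynomial has a value with vanishing first component. *)
Lemma generic_derivation (R : realType) (I : finType) (x : I -> R) :
  alg_independent x -> forall delta : I -> R,
  exists2 D : R -> R, derivation D & forall i, D (x i) = delta i.
Proof.
move=> indx delta.
pose h (i : 'I_#|I|) : dual R := (x (enum_val i), delta (enum_val i)).
pose ev := mmap (@dual_const R \o @ratr R) h.
pose S (t : dual R) := exists P, t = ev P.
have goodS : dual_good S.
  split; first split.
  - by exists 1; rewrite /ev rmorph1.
  - by move=> _ _ [P ->] [Q ->]; exists (P - Q); rewrite /ev rmorphB.
  - by move=> _ _ [P ->] [Q ->]; exists (P * Q); rewrite /ev rmorphM.
  - move=> _ [P ->]; rewrite -[_.1]/(dual_fst _) rmorph_mmap => P0.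
    suff -> : P = 0 by rewrite /ev mmap0.
    by apply: indx; rewrite meval_map -[RHS]P0; apply: eq_mmap.
have [D [derD DS]] := dual_maximal goodS; exists D => // i.
rewrite -[x i]/((x i, delta i) : dual R).1 DS //.
exists (mpolyX _ (mnm1 (enum_rank i))).
by rewrite /ev mmapX mmap1U /h enum_rankK.
Qed.

(** * Existence of algebraically independent reals *)

Lemma mmap_muni (n : nat) (K : nzRingType) (A : comNzRingType) (f : {rmorphism K -> A})
    (h : 'I_n.+1 -> A) (P : mpoly n.+1 K) :
  (map_poly (mmap f (h \o widen_ord (leqnSn n))) (muni P)).[h ord_max] = mmap f h P.
Proof.
rewrite muniE raddf_sum horner_sum /=; apply: eq_bigr => m _.
rewrite -mul_polyC rmorphM /= map_polyC map_polyXn /= hornerM hornerC hornerXn.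
rewrite mmapZ mmapX /mmap1 big_ord_recr /= mulrA; congr (_ * _ * _).
by apply: eq_bigr => i _; rewrite mnmE.
Qed.

Lemma muni_inj0 (n : nat) (K : nzRingType) (P : mpoly n.+1 K) : muni P = 0 -> P = 0.
Proof.
move=> P0; apply/mpolyP => m; rewrite mcoeff0.
have := congr1 (fun q : {poly mpoly n K} =>
  mcoeff (Multinom [tuple m (widen_ord (leqnSn n) i) | i < n]) q`_(m ord_max)) P0.
rewrite coef0 mcoeff0 muniE coef_sum raddf_sum /=.
have [mP|] := boolP (m \in msupp P); last by move=> /memN_msupp_eq0.
rewrite (bigD1_seq m) ?msupp_uniq //= big1_seq => [|m' /andP[ne _]].
  by rewrite addr0 coefZ coefXn eqxx mulr1 mcoeffZ mcoeffX eqxx mulr1.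
rewrite coefZ coefXn; have [e|_] := eqVneq (m ord_max) (m' ord_max); last first.
  by rewrite mulr0 mcoeff0.
rewrite mulr1 mcoeffZ mcoeffX; case: eqP => [E|]; last by rewrite mulr0.
case/eqP: ne; apply/mnmP => i; have [lt|] := ltnP i n.
  have -> : i = widen_ord (leqnSn n) (Ordinal lt) by apply: val_inj.
  have := congr1 (fun m => fun_of_multinom m (Ordinal lt)) E.
  by rewrite !mnmE.
move=> le; have -> : i = ord_max; last by rewrite e.
by apply/val_inj/anti_leq; rewrite /= le -ltnS ltn_ord.
Qed.

Section Uncountable.
Import classical_sets.

(* Nested intervals: each step keeps a third that avoids [u n]. *)
Lemma realType_uncountable (R : realType) (u : nat -> R) :
  exists x, forall n, u n != x.
Proof.
pose step (I : R * R) (c : R) : R * R :=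
  if c <= (I.1 + I.2) / 2 then ((I.1 + 2 * I.2) / 3, I.2)
  else (I.1, (2 * I.1 + I.2) / 3).
pose I := fix I n := if n is m.+1 then step (I m) (u m) else (0, 1).
have I_lt n : (I n).1 < (I n).2.
  by elim: n => [|n IH] /=; rewrite ?ltr01 // /step; case: ifP => _ /=; lra.
have I_S n : (I n).1 <= (I n.+1).1 /\ (I n.+1).2 <= (I n).2.
  by have := I_lt n; rewrite /= /step; case: ifP => _ /=; split; lra.
have I_mono m n : (m <= n)%N -> (I m).1 <= (I n).1 /\ (I n).2 <= (I m).2.
  elim: n => [|n IH]; first by rewrite leqn0 => /eqP ->.
  rewrite leq_eqVlt => /predU1P[->//|]; rewrite ltnS => /IH [h1 h2].
  by have [h3 h4] := I_S n; split; lra.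
have I_cross m n : (I m).1 <= (I n).2.
  have := I_lt (maxn m n); have [h1 _] := I_mono _ _ (leq_maxl m n).
  by have [_ h2] := I_mono _ _ (leq_maxr m n); lra.
pose E : set R := [set r | exists n, r = (I n).1]%classic.
have ubE n : ubound E (I n).2 by move=> _ [m ->]; apply: I_cross.
have supE : has_sup E by split; [exists 0, 0%N|exists (I 0%N).2; apply: ubE].
exists (sup E) => n; apply/eqP => un.
have h1 : (I n.+1).1 <= sup E by apply: sup_upper_bound => //; exists n.+1.
have h2 : sup E <= (I n.+1).2 by apply: ge_sup => //; exists 0, 0%N.
move: h1 h2; have := I_lt n; rewrite /= /step -un; case: ifP => /=; last move=> /negbT; rewrite -?ltNge; lra.
Qed.

End Uncountable.

Lemma poly_roots_seq (F : fieldType) (P : {poly F}) : P != 0 ->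
  exists s : seq F, forall z, root P z -> z \in s.
Proof.
move: {2}(size P) (leqnn (size P)) => n.
elim: n P => [|n IH] P le P0; first by move: P0; rewrite -size_poly_eq0 -leqn0 le.
have [[z Pz]|noroot] := pselect (exists z, root P z); last first.
  by exists [::] => z Pz; case: noroot; exists z.
have /factor_theorem[Q E] := Pz.
have Q0 : Q != 0 by apply: contra P0 => /eqP Q0; rewrite E Q0 mul0r.
have [|s Hs] := IH Q _ Q0.
  by move: le; rewrite E size_Mmonic ?monicXsubC // size_XsubC addn2.
exists (z :: s) => w; rewrite E rootM root_XsubC inE => /orP[/Hs ->|->] //.
by rewrite orbT.
Qed.

Lemma transcendental_extension (R : realType) (n : nat) (x : 'I_n -> R) :
  (forall P : mpoly n rat, mmap (@ratr R) x P = 0 -> P = 0) ->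
  exists y : 'I_n.+1 -> R, forall P : mpoly n.+1 rat, mmap (@ratr R) y P = 0 -> P = 0.
Proof.
move=> indx.
(* Lists of terms index the polynomials by a countable type. *)
pose code := seq (rat * multinom n.+1).
pose decode (c : code) : mpoly n.+1 rat := \sum_(t <- c) t.1 *: mpolyX rat t.2.
pose ev (P : mpoly n.+1 rat) := map_poly (mmap (@ratr R) x) (muni P).
have /choice[s Hs] : forall c : code, exists s : seq R, decode c != 0 ->
    forall z, root (ev (decode c)) z -> z \in s.
  move=> c.
  have [->|c0] := eqVneq (decode c) 0; first by exists [::].
  have [|s Hs] := @poly_roots_seq _ (ev (decode c)); last by exists s.
  apply: contra c0 => /eqP ev0; apply/eqP/muni_inj0/polyP => i; rewrite coef0.
  by apply: indx; rewrite -coef_map -/(ev _) ev0 coef0.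
(* One sequence through all the roots of all the nonzero polynomials; the default 0 only excludes
   one more candidate. *)
pose u (k : nat) : R :=
  if unpickle k is Some (c, i) then nth 0 (s c) i else 0.
have [z Hz] := realType_uncountable u.
pose y (i : 'I_n.+1) : R := if unlift ord_max i is Some j then x j else z.
have yz : y ord_max = z by rewrite /y unlift_none.
have yx : y \o widen_ord (leqnSn n) =1 x.
  move=> i; rewrite /y /= (_ : widen_ord _ i = lift ord_max i) ?liftK //.
  by apply: val_inj; rewrite /= /bump leqNgt ltn_ord.
exists y => P; have [->//|P0] := eqVneq P 0.
rewrite -mmap_muni yz (eq_map_poly (g := mmap (@ratr R) x)); last first.
  by move=> Q; apply: eq_mmap.
have [c Pc] : exists c, P = decode c.
  by exists [seq (mcoeff m P, m) | m <- msupp P]; rewrite /decode big_map -mpolyE.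
move=> /eqP Pz; have := Hs c; rewrite -Pc => /(_ P0 z Pz) zs.
have := Hz (pickle (c, index z (s c))).
by rewrite /u pickleK nth_index // eqxx.
Qed.

Lemma alg_independent_exists (R : realType) (I : finType) :
  exists x : I -> R, alg_independent x.
Proof.
have [y Hy] : exists y : 'I_#|I| -> R,
    forall P : mpoly #|I| rat, mmap (@ratr R) y P = 0 -> P = 0.
  elim: #|I| => [|n [y Hy]]; last exact: transcendental_extension Hy.
  exists (fun _ => 0) => P; rewrite [P]nvar0_mpolyC mmapC => /eqP.
  by rewrite fmorph_eq0 => /eqP ->.
exists (y \o enum_rank) => P; rewrite meval_map => P0; apply: Hy.
by rewrite -[RHS]P0; apply: eq_mmap => // i /=; rewrite enum_valK.
Qed.

(** * Infinitesimal rigidity in the plane *)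

Section Plane.
Variable R : realType.
Implicit Types (a b c : R * R) (D : R -> R).

Definition dot a b : R := a.1 * b.1 + a.2 * b.2.
Definition cross a b : R := a.1 * b.2 - a.2 * b.1.
Definition turn a : R * R := (- a.2, a.1).
Definition scale (k : R) a : R * R := (k * a.1, k * a.2).
Definition derive2 D a : R * R := (D a.1, D a.2).

Lemma pair_ext a b : a.1 = b.1 -> a.2 = b.2 -> a = b.
Proof. by case: a b => [? ?] [? ?] /= -> ->. Qed.

Lemma orthogonal_eq0 a b c : cross a b != 0 -> dot a c = 0 -> dot b c = 0 -> c = 0.
Proof.
rewrite /cross /dot => n0 ha hb; apply: pair_ext => /=; apply: (mulfI n0).
  by rewrite mulr0; transitivity (b.2 * (a.1 * c.1 + a.2 * c.2) -
    a.2 * (b.1 * c.1 + b.2 * c.2)); [ring|rewrite ha hb !mulr0 subr0].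
by rewrite mulr0; transitivity (a.1 * (b.1 * c.1 + b.2 * c.2) -
  b.1 * (a.1 * c.1 + a.2 * c.2)); [ring|rewrite ha hb !mulr0 subr0].
Qed.

(* A Vandermonde system in A, B, C, solved by Cramer's rule. *)
Lemma quadratic_form_eq0 (A B C : R) (a b c : R * R) :
  cross a b != 0 -> cross b c != 0 -> cross a c != 0 ->
  A * a.1 ^+ 2 + B * (a.1 * a.2) + C * a.2 ^+ 2 = 0 ->
  A * b.1 ^+ 2 + B * (b.1 * b.2) + C * b.2 ^+ 2 = 0 ->
  A * c.1 ^+ 2 + B * (c.1 * c.2) + C * c.2 ^+ 2 = 0 ->
  [/\ A = 0, B = 0 & C = 0].
Proof.
case: a b c => [a1 a2] [b1 b2] [c1 c2] /=; rewrite /cross /= => nab nbc nac.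
set qa := _ + _; set qb := _ + _; set qc := _ + _ => ha hb hc.
have n0 : (a1 * b2 - a2 * b1) * (b1 * c2 - b2 * c1) * (a1 * c2 - a2 * c1) != 0.
  by rewrite !mulf_neq0.
split; apply: (mulfI n0); rewrite mulr0.
- transitivity (qa * (b1 * b2 * c2 ^+ 2 - b2 ^+ 2 * (c1 * c2)) -
    qb * (a1 * a2 * c2 ^+ 2 - a2 ^+ 2 * (c1 * c2)) +
    qc * (a1 * a2 * b2 ^+ 2 - a2 ^+ 2 * (b1 * b2))); first by rewrite /qa /qb /qc; ring.
  by rewrite ha hb hc !mul0r subr0 addr0.
- transitivity (- qa * (b1 ^+ 2 * c2 ^+ 2 - b2 ^+ 2 * c1 ^+ 2) +
    qb * (a1 ^+ 2 * c2 ^+ 2 - a2 ^+ 2 * c1 ^+ 2) -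
    qc * (a1 ^+ 2 * b2 ^+ 2 - a2 ^+ 2 * b1 ^+ 2)); first by rewrite /qa /qb /qc; ring.
  by rewrite ha hb hc oppr0 !mul0r subr0 addr0.
- transitivity (qa * (b1 ^+ 2 * (c1 * c2) - b1 * b2 * c1 ^+ 2) -
    qb * (a1 ^+ 2 * (c1 * c2) - a1 * a2 * c1 ^+ 2) +
    qc * (a1 ^+ 2 * (b1 * b2) - a1 * a2 * b1 ^+ 2)); first by rewrite /qa /qb /qc; ring.
  by rewrite ha hb hc !mul0r subr0 addr0.
Qed.

Lemma dot_eq0 a : (dot a a == 0) = (a == 0).
Proof.
rewrite /dot -!expr2 paddr_eq0 ?sqr_ge0 // !sqrf_eq0.
by case: a => a1 a2; rewrite -pair_eqE.
Qed.

Lemma derivation0 D : derivation D -> D 0 = 0.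
Proof. by move=> [DA _]; apply: (addrI (D 0)); rewrite -DA !addr0. Qed.

Lemma derivation1 D : derivation D -> D 1 = 0.
Proof.
move=> [_ DM]; apply: (addrI (D 1)); have := DM 1 1.
by rewrite !mul1r => <-; rewrite addr0.
Qed.

Lemma derivationB D a b : derivation D -> derive2 D (a - b) = derive2 D a - derive2 D b.
Proof.
move=> derD; have [DA _] := derD; have DB x y : D (x - y) = D x - D y.
  by apply: (addIr (D y)); rewrite -DA !subrK.
by apply: pair_ext; rewrite /= DB.
Qed.

Lemma derivation_dot D a b : derivation D ->
  D (dot a b) = dot (derive2 D a) b + dot a (derive2 D b).
Proof. by move=> [DA DM]; rewrite /dot DA !DM /=; ring. Qed.

End Plane.

Section InfinitesimalRigidity.
Variables (R : realType) (V : finType).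
Implicit Types (p q u : V -> R * R) (S : {set V}) (E : rel V).

(* What algebraic independence of the coordinates of [p] provides. *)
Definition diff_generic p : Prop := forall delta : V -> R * R,
  exists2 D : R -> R, derivation D & forall v, derive2 D (p v) = delta v.

Definition flex S E p u : Prop := forall x y, x \in S -> y \in S -> E x y ->
  dot (p x - p y) (u x - u y) = 0.

(** A flex of the edges has to preserve all distances to first order, rather than to be a [motion];
    [flat_motion] shows that the two agree for generic points. *)
Definition inf_rigid S E p : Prop := forall u, flex S E p u -> flex S [rel _ _ | true] p u.

Definition motion (a : R * R) (k : R) (z : R * R) : R * R := a + scale k (turn z).

Lemma motion_flex a k (z w : R * R) : dot (z - w) (motion a k z - motion a k w) = 0.
Proof. by rewrite /dot /motion /=; ring. Qed.

Lemma inf_rigid_mono S E E' p : (forall x y, x \in S -> y \in S -> E x y -> E' x y) ->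
  inf_rigid S E p -> inf_rigid S E' p.
Proof. by move=> EE' rig u fl; apply: rig => x y xS yS /EE' h; apply: fl => //; apply: h. Qed.

Lemma diff_generic_inj p x y : diff_generic p -> x != y -> dot (p x - p y) (p x - p y) != 0.
Proof.
move=> gp xy; rewrite dot_eq0 subr_eq0; apply/eqP => e.
have [D _ HD] := gp (fun v => if v == x then (1, 1) else 0).
have := HD x; rewrite e HD eqxx eq_sym (negPf xy) => /(congr1 fst) /= /eqP.
by rewrite eq_sym oner_eq0.
Qed.

(** Collinearity, differentiated along the motions of [p z] alone, would make every vector
    orthogonal to the normal of the line. *)
Lemma diff_generic_cross p x y z : diff_generic p -> x != y -> y != z -> x != z ->
  cross (p x - p y) (p x - p z) != 0.
Proof.
move=> gp xy yz xz; apply/eqP => c0.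
have zy k : dot k (turn (p x - p y)) = 0.
  have [D derD HD] := gp (fun v => if v == z then k else 0).
  have := congr1 D c0; rewrite derivation0 // /cross.
  have -> : (p x - p y).1 * (p x - p z).2 - (p x - p y).2 * (p x - p z).1 =
     dot (turn (p x - p y)) (p x - p z) by rewrite /dot /=; ring.
  rewrite derivation_dot // derivationB // !HD eqxx (negPf xz).
  have -> : derive2 D (turn (p x - p y)) = turn (derive2 D (p x - p y)).
    have [DA _] := derD; apply: pair_ext => //=.
    by apply: (addIr (D (p x - p y).2)); rewrite -DA !addNr derivation0.
  rewrite derivationB // !HD (negPf xz) (negPf yz) /dot /= => h.
  by rewrite -[RHS]oppr0 -h; ring.
have /eqP := diff_generic_inj gp xy; apply.
have := zy (- (p x - p y).2, (p x - p y).1); rewrite /dot /= => h.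
by rewrite -[RHS]h; ring.
Qed.

Lemma flat_motion S p u : diff_generic p -> flex S [rel _ _ | true] p u ->
  exists a k, forall x, x \in S -> u x = motion a k (p x).
Proof.
move=> gp fl; have [->|[x xS]] := set_0Vmem S; first by exists 0, 0 => y; rewrite inE.
have [Sx|[y /setD1P[yx yS]]] := set_0Vmem (S :\ x).
  exists (u x), 0 => y yS; have : y \notin S :\ x by rewrite Sx inE.
  rewrite !inE yS andbT negbK => /eqP ->.
  by apply: pair_ext; rewrite /= mul0r addr0.
(* The translation is read off at [x] and the angular speed [k] on the segment [x y]. At any other
   vertex, the difference between [u] and this motion is orthogonal to two independent
   directions. *)
pose d := p y - p x; pose e := u y - u x.
have dd := diff_generic_inj gp yx; rewrite -/d in dd.
pose k := dot (turn d) e / dot d d; pose a := u x - scale k (turn (p x)).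
have ex : u x = motion a k (p x) by rewrite /a /motion subrK.
have ey : u y = motion a k (p y).
  have de : dot d e = 0 by apply: fl.
  have uy : u y = u x + e by rewrite /e addrC subrK.
  have py : p y = p x + d by rewrite /d addrC subrK.
  have hk : dot d d * k = dot (turn d) e by rewrite /k mulrC divfK.
  rewrite uy {1}ex py; clearbody a k d e; suff -> : e = scale k (turn d) by apply: pair_ext => /=; ring.
  apply: pair_ext; apply: (mulfI dd) => /=.
    transitivity (d.1 * dot d e - d.2 * dot (turn d) e); first by rewrite /dot /=; ring.
    by rewrite de -hk; ring.
  transitivity (d.2 * dot d e + d.1 * dot (turn d) e); first by rewrite /dot /=; ring.
  by rewrite de -hk; ring.
exists a, k => z zS; have [->//|zx] := eqVneq z x; have [->//|zy] := eqVneq z y.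
apply/eqP; rewrite -subr_eq0; apply/eqP.
have ort w : w \in S -> u w = motion a k (p w) ->
    dot (p z - p w) (u z - motion a k (p z)) = 0.
  move=> wS ew; have := fl z w zS wS isT; rewrite ew => h.
  rewrite -[RHS]h -[LHS]addr0 -(motion_flex a k (p z) (p w)) /dot /=; ring.
apply: (orthogonal_eq0 _ (ort x xS ex) (ort y yS ey)).
by apply: diff_generic_cross => //; rewrite eq_sym.
Qed.

Lemma motion_flat S p u a k : (forall x, x \in S -> u x = motion a k (p x)) ->
  flex S [rel _ _ | true] p u.
Proof. by move=> h x y /h -> /h -> _; apply: motion_flex. Qed.

Lemma motion_extend p (v a b : V) u t k : diff_generic p ->
  v != a -> v != b -> a != b -> u a = motion t k (p a) -> u b = motion t k (p b) ->
  dot (p v - p a) (u v - u a) = 0 -> dot (p v - p b) (u v - u b) = 0 ->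
  u v = motion t k (p v).
Proof.
move=> gp va vb ab ea eb ha hb; apply/eqP; rewrite -subr_eq0; apply/eqP.
apply: (@orthogonal_eq0 _ (p v - p a) (p v - p b)).
- exact: diff_generic_cross.
- rewrite -[RHS]ha ea -[LHS]addr0 -(motion_flex t k (p v) (p a)) /dot /=; ring.
- rewrite -[RHS]hb eb -[LHS]addr0 -(motion_flex t k (p v) (p b)) /dot /=; ring.
Qed.

(** Henneberg's move of degree two: the motion of [S] prescribes the velocity of [v] in two
    independent directions. *)
Lemma zero_extension S E p v a b : diff_generic p -> v \notin S -> a \in S -> b \in S ->
  a != b -> E v a -> E v b -> inf_rigid S E p -> inf_rigid (v |: S) E p.
Proof.
move=> gp vS aS bS ab Eva Evb rig u fl.
have [|t [k tk]] := @flat_motion S p u gp.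
  by apply: rig => x y xS yS; apply: fl; rewrite inE ?xS ?yS orbT.
apply: (@motion_flat _ _ _ t k) => x /setU1P[->|]; last exact: tk.
have nv c : c \in S -> v != c by move=> cS; apply: contraNneq vS => ->.
apply: (@motion_extend p v a b) (tk a aS) (tk b bS) _ _ => //; rewrite ?nv //.
  by apply: fl; rewrite ?inE ?eqxx ?aS ?orbT.
by apply: fl; rewrite ?inE ?eqxx ?bS ?orbT.
Qed.

(* Differentiating along the motions of [p v] alone shows that a flex [u] with
   [dot (p a - p b) (u a - u b) = 1] makes [u v - u i] a linear image of [p v - p i]
   for [i = a, b, c], orthogonal to [p v - p i]; so this linear map is skew. *)
Lemma one_extension S E p v a b c : diff_generic p -> v \notin S ->
  a \in S -> b \in S -> c \in S -> a != b -> b != c -> a != c ->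
  E v a -> E v b -> E v c ->
  inf_rigid S (fun x y => E x y || (x == a) && (y == b)) p -> inf_rigid (v |: S) E p.
Proof.
move=> gp vS aS bS cS ab bc ac Eva Evb Evc rig u fl.
have nv i : i \in S -> v != i by move=> iS; apply: contraNneq vS => ->.
have flS x y : x \in S -> y \in S -> E x y -> dot (p x - p y) (u x - u y) = 0.
  by move=> xS yS; apply: fl; rewrite inE ?xS ?yS orbT.
have flv i : i \in S -> E v i -> dot (p v - p i) (u v - u i) = 0.
  by move=> iS; apply: fl; rewrite ?inE ?eqxx ?iS ?orbT.
have [z0|n0] := eqVneq (dot (p a - p b) (u a - u b)) 0.
  have [|t [k tk]] := @flat_motion S p u gp.
    by apply: rig => x y xS yS /orP[|/andP[/eqP-> /eqP->]//]; apply: flS.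
  apply: (@motion_flat _ _ _ t k) => x /setU1P[->|]; last exact: tk.
  apply: (@motion_extend p v a b) (tk a aS) (tk b bS) _ _ => //; rewrite ?nv //.
    exact: flv.
  exact: flv.
exfalso; pose u' x := scale (dot (p a - p b) (u a - u b))^-1 (u x).
have dotu x y : dot (p x - p y) (u' x - u' y) =
    (dot (p a - p b) (u a - u b))^-1 * dot (p x - p y) (u x - u y).
  by rewrite /u' {1}/dot [X in _ = _ * X]/dot /=; ring.
have flv' i : i \in S -> E v i -> dot (p v - p i) (u' v - u' i) = 0.
  by move=> iS Ei; rewrite dotu flv // mulr0.
have u'1 : dot (p a - p b) (u' a - u' b) = 1 by rewrite dotu mulVf.
have key delta : exists w, forall i, i \in S -> E v i ->
    dot delta (u' v - u' i) + dot (p v - p i) w = 0.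
  have [D derD HD] := gp (fun x => if x == v then delta else 0).
  have HDv : derive2 D (p v) = delta by rewrite HD eqxx.
  have HDS x : x \in S -> derive2 D (p x) = 0.
    by move=> xS; rewrite HD eq_sym (negPf (nv x xS)).
  pose Du x := derive2 D (u' x).
  have [|t [k tk]] := @flat_motion S p Du gp.
    apply: rig => x y xS yS Exy.
    have : D (dot (p x - p y) (u' x - u' y)) = 0.
      move: Exy => /orP[/flS h|/andP[/eqP-> /eqP->]].
        by rewrite dotu h // mulr0 derivation0.
      by rewrite u'1 derivation1.
    rewrite derivation_dot // !derivationB // !HDS // subrr.
    by rewrite {1}/dot /= !mul0r addr0 add0r.
  exists (Du v - motion t k (p v)) => i iS Evi.
  have := congr1 D (flv' i iS Evi); rewrite derivation0 // derivation_dot //.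
  rewrite !derivationB // HDv HDS // subr0 -/(Du v) -/(Du i) (tk i iS) => h.
  by rewrite -[RHS]h -[LHS]addr0 -(motion_flex t k (p v) (p i)) /dot /=; ring.
have [w1 h1] := key (1, 0); have [w2 h2] := key (0, 1).
have uv i : i \in S -> E v i ->
    u' v - u' i = (- dot (p v - p i) w1, - dot (p v - p i) w2).
  move=> iS Ei; apply: pair_ext => /=.
    by apply/eqP; rewrite -subr_eq0 opprK -[X in _ == X](h1 i iS Ei) /dot /=; apply/eqP; ring.
  by apply/eqP; rewrite -subr_eq0 opprK -[X in _ == X](h2 i iS Ei) /dot /=; apply/eqP; ring.
have q i : i \in S -> E v i -> w1.1 * (p v - p i).1 ^+ 2 +
    (w1.2 + w2.1) * ((p v - p i).1 * (p v - p i).2) + w2.2 * (p v - p i).2 ^+ 2 = 0.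
  move=> iS Ei; have := flv' i iS Ei; rewrite (uv i iS Ei) /dot /= => h;
     rewrite -[RHS]oppr0 -[X in _ = - X]h; ring.
have [| | |w11 w12 w22] := quadratic_form_eq0 _ _ _ (q a aS Eva) (q b bS Evb) (q c cS Evc);
  try by apply: diff_generic_cross; rewrite ?nv.
have e1 : p a - p b = (p v - p b) - (p v - p a) by apply: pair_ext => /=; ring.
have e2 : u' a - u' b = (u' v - u' b) - (u' v - u' a) by apply: pair_ext => /=; ring.
have : w2.1 = - w1.2 by apply/eqP; rewrite -subr_eq0 opprK addrC w12.
move=> w21; move: u'1; rewrite e1 e2 !uv // /dot /= w11 w22 w21.
set lhs := (X in X = 1); suff -> : lhs = 0 by move/eqP; rewrite eq_sym oner_eq0.
by rewrite /lhs; ring.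
Qed.

End InfinitesimalRigidity.

Local Close Scope ring_scope.

(** * Sparse edge sets and Laman graphs *)

Section Sparse.
Variable V : finType.
Implicit Types (F E : {set {set V}}) (X Y S : {set V}) (v : V).

Definition edge_set F : Prop := forall f, f \in F -> #|f| = 2.
Definition within F X : {set {set V}} := [set f in F | f \subset X].
Definition ecount F X : nat := #|within F X|.
(** Laman's count, in additive form to avoid truncated subtraction. When [F] is sparse, it induces a
    Laman graph on each [tight] set. *)
Definition sparse F : Prop := forall X, 2 <= #|X| -> ecount F X + 3 <= 2 * #|X|.
Definition tight F X : bool := (2 <= #|X|) && (ecount F X + 3 == 2 * #|X|).
Definition nbrs F X v : {set V} := [set x in X | (x != v) && ([set v; x] \in F)].
Definition edge_rel F : rel V := fun x y => [set x; y] \in F.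

Lemma ecountS F X Y : X \subset Y -> ecount F X <= ecount F Y.
Proof.
move=> XY; apply/subset_leq_card/subsetP => f; rewrite !inE => /andP[-> fX] /=.
exact: subset_trans XY.
Qed.

Lemma ecount_supermodular F X Y :
  ecount F X + ecount F Y <= ecount F (X :|: Y) + ecount F (X :&: Y).
Proof.
rewrite /ecount -cardsUI; have -> : within F X :&: within F Y = within F (X :&: Y).
  by apply/setP => f; rewrite !inE subsetI; case: (f \in F).
rewrite leq_add2r; apply/subset_leq_card/subsetP => f; rewrite !inE.
by case/orP => /andP[-> h] /=; apply: subset_trans h _; rewrite ?subsetUl ?subsetUr.
Qed.

Lemma sparse_sub F F' : F' \subset F -> sparse F -> sparse F'.
Proof.
move=> sub spF X X2; apply: leq_trans (spF X X2); rewrite leq_add2r.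
apply/subset_leq_card/subsetP => f; rewrite !inE => /andP[fF ->].
by rewrite (subsetP sub).
Qed.

(** [ecount] is supermodular, while [2 |X| - 3] is modular on sets that meet in at least two
    vertices, so no slack can appear. *)
Lemma tight_union F X Y : sparse F -> tight F X -> tight F Y -> 2 <= #|X :&: Y| ->
  tight F (X :|: Y).
Proof.
move=> spF /andP[X2 /eqP tX] /andP[Y2 /eqP tY] XY2.
have XU : #|X| <= #|X :|: Y| by rewrite subset_leq_card // subsetUl.
have h1 := ecount_supermodular F X Y; have h2 := spF _ XY2; have h3 := cardsUI X Y.
have U2 : 2 <= #|X :|: Y| by apply: leq_trans XU.
have h4 := spF _ U2; apply/andP; split=> //; apply/eqP; lia.
Qed.

Lemma within_D1 F S v : edge_set F -> v \in S ->
  within F S = within F (S :\ v) :|: [set [set v; x] | x in nbrs F S v].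
Proof.
move=> eF vS; apply/setP => f; rewrite !inE; apply/idP/idP.
  case/andP=> fF fS; rewrite fF /=; have [vf|vf] := boolP (v \in f).
    apply/orP; right; have /eqP/cards2P[a [b [ab E]]] := eF f fF.
    have [c [cv Ec]] : exists c, c != v /\ f = [set v; c].
      move: vf; rewrite E !inE => /orP[/eqP->|/eqP->].
        by exists b; rewrite eq_sym.
      by exists a; rewrite setUC.
    apply/imsetP; exists c => //.
    by rewrite inE (subsetP fS) ?Ec ?inE ?eqxx ?orbT // cv -Ec.
  by apply/orP; left; rewrite subsetD1 fS vf.
case/orP=> [/andP[-> /subsetP fS] /=|/imsetP[x]].
  by apply/subsetP => x /fS; rewrite inE => /andP[].
rewrite inE => /and3P[xS _ vx] ->; rewrite vx /=.
by apply/subsetP => y; rewrite !inE => /orP[/eqP->|/eqP->].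
Qed.

Lemma card_star (N : {set V}) v : v \notin N -> #|[set [set v; x] | x in N]| = #|N|.
Proof.
move=> vN; apply: card_in_imset => x y xN yN /setP /(_ x); rewrite !inE eqxx orbT.
have /negPf -> : x != v by apply: contraNneq vN => <-.
by move=> /esym /eqP.
Qed.

Lemma ecount_D1 F S v : edge_set F -> v \in S ->
  ecount F S = ecount F (S :\ v) + #|nbrs F S v|.
Proof.
move=> eF vS; rewrite /ecount (within_D1 eF vS) cardsU.
have vN : v \notin nbrs F S v by rewrite !inE eqxx /= andbF.
rewrite card_star // [X in _ - X](_ : _ = 0) ?subn0 //.
apply/eqP; rewrite cards_eq0; apply/eqP/setP => f; rewrite !inE.
apply/negP => /andP[/andP[_ /subsetP fS]] /imsetP[x _ E].
by have := fS v; rewrite E !inE eqxx /= => /(_ isT).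
Qed.

Lemma ecount_setU1 F X v (N : {set V}) : edge_set F -> v \notin X -> N \subset X ->
  (forall x, x \in N -> [set v; x] \in F) -> ecount F X + #|N| <= ecount F (v |: X).
Proof.
move=> eF vX NX NF; rewrite (@ecount_D1 _ (v |: X) v eF) ?inE ?eqxx //.
rewrite setU1K // leq_add2l; apply/subset_leq_card/subsetP => x xN.
by rewrite !inE (subsetP NX) ?NF ?orbT // andbT; apply: contraNneq vX => <-; apply: (subsetP NX).
Qed.

Lemma handshake F S : edge_set F -> \sum_(v in S) #|nbrs F S v| = 2 * ecount F S.
Proof.
move=> eF.
transitivity (\sum_(v in S) \sum_(f in within F S) (v \in f)).
  apply: eq_bigr => v vS; rewrite -big_mkcondr /= sum1_card.
  rewrite -(@card_star (nbrs F S v) v); last by rewrite !inE eqxx /= andbF.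
  apply: eq_card => f; rewrite [RHS]inE; apply/imsetP/andP.
    case=> x; rewrite !inE => /and3P[xS _ vx] ->; rewrite !inE eqxx vx; split=> //.
    by apply/subsetP => y; rewrite !inE => /orP[/eqP->|/eqP->].
  move=> [fS vf]; move: fS; rewrite (within_D1 eF vS) inE => /orP[|/imsetP[x ? ->]].
    by rewrite inE => /andP[_ /subsetP /(_ v vf)]; rewrite !inE eqxx.
  by exists x.
rewrite exchange_big /=; transitivity (\sum_(f in within F S) 2); last first.
  by rewrite sum_nat_const mulnC.
apply: eq_bigr => f; rewrite inE => /andP[fF fS].
rewrite -big_mkcondr sum1_card -(eF f fF).
by apply: eq_card => x; rewrite -[LHS]/((x \in S) && (x \in f)) andb_idl // => xf; apply: (subsetP fS).
Qed.

End Sparse.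

(** * Inverse Henneberg moves *)

Section Henneberg.
Variable V : finType.
Implicit Types (F E : {set {set V}}) (X Y S : {set V}) (v : V).

(** The inverse of the move of degree three: [v] goes and two of its neighbours are joined. *)
Definition add_without F v (a b : V) : {set {set V}} :=
  [set a; b] |: [set f in F | v \notin f].

Lemma add_without_edge_set F v a b : a != b -> edge_set F -> edge_set (add_without F v a b).
Proof.
move=> ab eF f /setU1P[->|]; first by rewrite cards2 ab.
by rewrite inE => /andP[/eF].
Qed.

Lemma ecount_add_without F v a b X : ecount (add_without F v a b) X <=
  ecount F (X :\ v) + ([set a; b] \subset X).
Proof.
rewrite addnC /ecount; have sub : within (add_without F v a b) X \subset
    (if [set a; b] \subset X then [set [set a; b]] else set0) :|: within F (X :\ v).
  apply/subsetP => f; rewrite !inE => /andP[/orP[/eqP->|/andP[fF vf]] fX].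
    by rewrite fX inE eqxx.
  by rewrite fF subsetD1 fX vf orbT.
apply: leq_trans (subset_leq_card sub) _; apply: leq_trans (leq_card_setU _ _) _.
by rewrite leq_add2r; case: ifP; rewrite ?cards1 ?cards0.
Qed.

Lemma add_without_sparse F v a b : sparse F -> a != v -> b != v -> a != b ->
  (forall X, a \in X -> b \in X -> v \notin X -> ~~ tight F X) ->
  sparse (add_without F v a b).
Proof.
move=> spF av bv ab ntight X X2; have := ecount_add_without F v a b X.
have [/subsetP abX|_] := boolP ([set a; b] \subset X); last first.
  rewrite addn0 => h; apply: leq_trans (spF X X2); rewrite leq_add2r.
  by apply: leq_trans h (ecountS _ _); apply: subsetDl.
have [aX bX] : a \in X :\ v /\ b \in X :\ v.
  by rewrite !inE av bv !abX ?inE ?eqxx ?orbT.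
have X2' : 2 <= #|X :\ v|.
  have <- : #|[set a; b]| = 2 by rewrite cards2 ab.
  by apply/subset_leq_card/subsetP => y; rewrite !inE => /orP[/eqP->|/eqP->]; [move: aX|move: bX]; rewrite !inE.
have := ntight _ aX bX; rewrite !inE eqxx /= => /(_ isT); rewrite /tight X2' /=.
have := spF _ X2'; have := subset_leq_card (subsetDl X [set v]); lia.
Qed.

(** Adding [v] to such an [X] would bring one vertex and three edges, exceeding the count. *)
Lemma no_tight_three F v a b c X : sparse F -> edge_set F -> a != b -> b != c -> a != c ->
  [set v; a] \in F -> [set v; b] \in F -> [set v; c] \in F ->
  v \notin X -> a \in X -> b \in X -> c \in X -> ~~ tight F X.
Proof.
move=> spF eF ab bc ac va vb vc vX aX bX cX; apply/negP => /andP[X2 /eqP tX].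
have N3 : #|[set a; b; c]| = 3.
  by rewrite setUC cardsU1 !inE cards2 ab eq_sym (negPf ac) eq_sym (negPf bc).
have := @ecount_setU1 V F X v [set a; b; c] eF vX; rewrite N3.
have -> : [set a; b; c] \subset X.
  by apply/subsetP => x; rewrite !inE => /orP[/orP[]|] /eqP ->.
move=> /(_ isT) h; have {}h : ecount F X + 3 <= ecount F (v |: X).
  by apply: h => x; rewrite !inE => /orP[/orP[]|] /eqP ->.
have := spF (v |: X); rewrite cardsU1 vX /=; lia.
Qed.

Definition separated F v (a b : V) : Prop :=
  forall X, a \in X -> b \in X -> v \notin X -> ~~ tight F X.

(** Suppose that each pair lies in a tight set avoiding [v]. Any two of these sets meet in one
    vertex, otherwise their union would be tight and contain [a], [b] and [c]. So their sizes add up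
    to [n + 3], with [n] the size of the union of all three, which then has at least
    [2 (n + 3) - 9 = 2 n - 3] edges: it is tight, contrary to [no_tight_three]. *)
Lemma one_extension_pair F v a b c : sparse F -> edge_set F ->
  a != b -> b != c -> a != c -> a != v -> b != v -> c != v ->
  [set v; a] \in F -> [set v; b] \in F -> [set v; c] \in F ->
  [\/ separated F v a b, separated F v b c | separated F v a c].
Proof.
move=> spF eF ab bc ac av bv cv Fa Fb Fc.
have pick x y : separated F v x y \/
    exists X, [/\ x \in X, y \in X, v \notin X & tight F X].
  have [|nX] := pselect (exists X, [/\ x \in X, y \in X, v \notin X & tight F X]); first by right.
  by left=> X xX yX vX; apply/negP => tX; apply: nX; exists X.
have [|[X [aX bX vX tX]]] := pick a b; first by constructor 1.
have [|[Y [bY cY vY tY]]] := pick b c; first by constructor 2.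
have [|[Z [aZ cZ vZ tZ]]] := pick a c; first by constructor 3.
have no3 (W : {set V}) : v \notin W -> a \in W -> b \in W -> c \in W -> ~~ tight F W.
  exact: (no_tight_three spF eF ab bc ac Fa Fb Fc).
have cap1 (A B : {set V}) x : v \notin A -> v \notin B -> tight F A -> tight F B ->
    x \in A :&: B -> a \in A :|: B -> b \in A :|: B -> c \in A :|: B -> #|A :&: B| = 1.
  move=> vA vB tA tB xAB aU bU cU; apply/eqP; rewrite eqn_leq.
  have -> : 0 < #|A :&: B| by apply/card_gt0P; exists x.
  rewrite andbT leqNgt; apply/negP => c2.
  have := no3 (A :|: B); rewrite inE (negPf vA) (negPf vB) => /(_ isT aU bU cU).
  by rewrite (tight_union spF tA tB c2).
have cXY : #|X :&: Y| = 1 by apply: (cap1 X Y b); rewrite // !inE ?aX ?bX ?bY ?cY ?orbT.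
have cYZ : #|Y :&: Z| = 1 by apply: (cap1 Y Z c); rewrite // !inE ?aZ ?bY ?cZ ?cY ?orbT.
have cXZ : #|X :&: Z| = 1 by apply: (cap1 X Z a); rewrite // !inE ?aX ?aZ ?bX ?cZ ?orbT.
have XYZ : (X :|: Y) :&: Z = (X :&: Z) :|: (Y :&: Z) by rewrite setIUl.
have cXYZ : #|(X :|: Y) :&: Z| = 2.
  rewrite XYZ cardsU cXZ cYZ; suff -> : #|(X :&: Z) :&: (Y :&: Z)| = 0 by [].
  apply/eqP; rewrite cards_eq0 -subset0; apply/subsetP => x; rewrite !inE.
  case/andP=> /andP[xX xZ] /andP[xY _].
  have /cards1P[y Ey] : #|X :&: Y| == 1 by rewrite cXY.
  have /cards1P[z Ez] : #|X :&: Z| == 1 by rewrite cXZ.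
  have : x \in X :&: Y by rewrite inE xX.
  have : b \in X :&: Y by rewrite inE bX.
  have : x \in X :&: Z by rewrite inE xX.
  have : a \in X :&: Z by rewrite inE aX.
  rewrite Ey Ez !inE => /eqP <- /eqP xa /eqP <- /eqP xb.
  by rewrite -xa xb eqxx in ab.
have vW : v \notin X :|: Y :|: Z by rewrite !inE (negPf vX) (negPf vY) (negPf vZ).
have := no3 _ vW; rewrite !inE aX bX cY !orbT /= => /(_ isT isT isT) /negP [].
move: tX tY tZ => /andP[X2 /eqP tX] /andP[Y2 /eqP tY] /andP[Z2 /eqP tZ].
have h3 := cardsUI X Y; have h4 := cardsUI (X :|: Y) Z.
have W2 : 2 <= #|X :|: Y :|: Z|.
  by apply: leq_trans X2 _; rewrite subset_leq_card // -setUA subsetUl.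
have h5 := spF _ W2.
have disj (A B : {set V}) : #|A :&: B| = 1 -> within F A :&: within F B = set0.
  move=> c1; apply/setP => f; rewrite !inE; apply/negP.
  case/andP=> /andP[/eF f2 fA] /andP[_ fB]; have : f \subset A :&: B by rewrite subsetI fA.
  by move/subset_leq_card; rewrite f2 c1.
have h6 : ecount F X + ecount F Y + ecount F Z <= ecount F (X :|: Y :|: Z).
  rewrite /ecount -(cardsUI (within F X)) (disj _ _ cXY) cards0 addn0.
  rewrite -cardsUI setIUl (disj _ _ cXZ) (disj _ _ cYZ) setU0 cards0 addn0.
  apply/subset_leq_card/subsetP => f; rewrite !inE.
  case/orP=> [/orP[]|] /andP[-> h] /=; apply: subset_trans h _.
  - by rewrite -setUA subsetUl.
  - by rewrite setUAC subsetUr.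
  - by rewrite subsetUr.
rewrite /tight W2 /=; rewrite cXY in h3; rewrite cXYZ in h4.
by clear - h3 h4 h5 h6 tX tY tZ; lia.
Qed.

End Henneberg.

Lemma laman_inf_rigid (R : realType) (V : finType) (p : V -> R * R) (F : {set {set V}})
    (S : {set V}) : diff_generic p -> edge_set F -> sparse F -> tight F S ->
  inf_rigid S (edge_rel F) p.
Proof.
move=> gp; move: {2}#|S| (erefl #|S|) => n; elim: n S F => [|n IH] S F Sn eF spF.
  by rewrite /tight Sn.
move=> /andP[S2 /eqP tS].
have [S3|S3] := leqP 3 #|S|; last first.
  have {S3}S2e : #|S| = 2 by lia.
  have /eqP/cards2P[a [b [ab E]]] := S2e.
  have SF : S \in F.
    have : 0 < ecount F S by lia.
    case/card_gt0P => f; rewrite inE => /andP[fF fS].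
    suff <- : f = S by [].
    by apply/eqP; rewrite eqEcard fS S2e (eF f fF).
  move=> u fl x y xS yS _; have [->|xy] := eqVneq x y.
    by rewrite subrr /dot /= !mul0r addr0.
  apply: fl => //; rewrite /edge_rel; suff -> : [set x; y] = S by [].
  apply/eqP; rewrite eqEcard cards2 xy S2e leqnn andbT.
  by apply/subsetP => z; rewrite !inE => /orP[/eqP->|/eqP->].
(* The degrees add up to [2 (2 n - 3) < 4 n]. *)
have [v vS dv] : exists2 v, v \in S & #|nbrs F S v| <= 3.
  apply: contrapT => h; have : \sum_(v in S) 4 <= \sum_(v in S) #|nbrs F S v|.
    apply: leq_sum => v vS; rewrite ltnNge; apply/negP => dv; apply: h; exists v => //.
  rewrite handshake // sum_nat_const; lia.
have SD : S = v |: (S :\ v) by rewrite setD1K.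
have cS : #|S| = (#|S :\ v|).+1 by rewrite (cardsD1 v) vS.
have vSv : v \notin S :\ v by rewrite !inE eqxx.
have eD := ecount_D1 eF vS.
have S2' : 2 <= #|S :\ v| by lia.
have spv := spF _ S2'.
have nbr x : x \in nbrs F S v -> [/\ x \in S :\ v, x != v & [set v; x] \in F].
  by rewrite !inE => /and3P[-> -> ->].
(* Degree at most one is excluded by the sparsity bound on [S :\ v]. *)
have [d2|d2] := leqP #|nbrs F S v| 2.
  have /eqP/cards2P[a [b [ab E]]] : #|nbrs F S v| = 2 by lia.
  have [aS _ va] : [/\ a \in S :\ v, a != v & [set v; a] \in F].
    by apply: nbr; rewrite E !inE eqxx.
  have [bS _ vb] : [/\ b \in S :\ v, b != v & [set v; b] \in F].
    by apply: nbr; rewrite E !inE eqxx orbT.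
  rewrite SD; apply: (@zero_extension _ _ _ _ _ v a b) => //.
  apply: IH => //; first by lia.
  by rewrite /tight S2' /=; lia.
have d3 : #|nbrs F S v| = 3 by lia.
have [a aN] : exists a, a \in nbrs F S v by apply/card_gt0P; lia.
have := cardsD1 a (nbrs F S v); rewrite aN d3 => -[N2].
have /eqP/cards2P[b [c [bc E]]] := esym N2.
have /setD1P[ba bN] : b \in nbrs F S v :\ a by rewrite E !inE eqxx.
have /setD1P[ca cN] : c \in nbrs F S v :\ a by rewrite E !inE eqxx orbT.
have [[aS av va] [bS bv vb] [cS' cv vc]] := And3 (nbr a aN) (nbr b bN) (nbr c cN).
have step x y z : x \in S :\ v -> y \in S :\ v -> z \in S :\ v ->
    x != y -> y != z -> x != z -> [set v; x] \in F -> [set v; y] \in F ->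
    [set v; z] \in F -> separated F v x y -> inf_rigid S (edge_rel F) p.
  move=> xS yS zS xy yz xz vx vy vz sep.
  have [xSv ySv] : (x \in S) && (x != v) /\ (y \in S) && (y != v).
    by move: xS yS; rewrite !inE ![_ && (_ \in S)]andbC.
  have [/andP[_ xv] /andP[_ yv]] := conj xSv ySv.
  have eF' := @add_without_edge_set _ F v x y xy eF.
  have spF' := add_without_sparse spF xv yv xy sep.
  have xyF : [set x; y] \notin F.
    apply/negP => xyF; have := sep [set x; y]; rewrite !inE !eqxx orbT => /(_ isT isT).
    rewrite negb_or ![v == _]eq_sym xv yv => /(_ isT) /negP; apply.
    have : 0 < ecount F [set x; y] by apply/card_gt0P; exists [set x; y]; rewrite inE xyF /=.
    by have := spF [set x; y]; rewrite /tight cards2 xy /= => /(_ isT); clear; lia.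
  rewrite SD; apply: (@one_extension _ _ _ _ _ v x y z) => //.
  have : inf_rigid (S :\ v) (edge_rel (add_without F v x y)) p.
    apply: IH => //; first by clear - cS Sn; lia.
    rewrite /tight S2' /=; have := spF' _ S2'.
    have : ecount F (S :\ v) + 1 <= ecount (add_without F v x y) (S :\ v).
      rewrite addn1 /ecount; apply: proper_card; apply/properP; split.
        apply/subsetP => f; rewrite !inE => /andP[fF fS]; rewrite fS fF /= andbT.
        by apply/orP; right; apply: contra vSv => /(subsetP fS).
      exists [set x; y]; last by rewrite !inE (negPf xyF).
      rewrite !inE eqxx /=; apply/subsetP => w.
      by rewrite in_set2 => /orP[/eqP->|/eqP->].
    by clear - eD d3 tS cS; lia.
  move=> rig u fl; apply: rig => s t sS tS'; rewrite /edge_rel /= /add_without in_setU1 inE.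
  case/orP=> [/eqP E'|/andP[stF _]]; last by apply: fl; rewrite //= /edge_rel stF.
  have st : s != t.
    have := eF' [set s; t]; rewrite {1}E' /add_without setU11 => /(_ isT).
    by rewrite cards2; case: (s != t).
  have : s \in [set x; y] by rewrite -E' !inE eqxx.
  have : t \in [set x; y] by rewrite -E' !inE eqxx orbT.
  rewrite !inE => /orP[/eqP et|/eqP et] /orP[/eqP es|/eqP es]; move: st; rewrite es et ?eqxx // => _.
    rewrite -[RHS](fl x y) ?eqxx ?orbT // /dot /=; ring.
  by apply: fl; rewrite //= !eqxx orbT.
have [ab ac] : a != b /\ a != c by rewrite ![a == _]eq_sym.
have [||] := one_extension_pair spF eF ab bc ac av bv cv va vb vc.
- by apply: (step a b c); rewrite // eq_sym.
- by apply: (step b c a); rewrite // eq_sym.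
- by apply: (step a c b); rewrite // eq_sym.
Qed.

Local Open Scope ring_scope.

(** * Redundant rigidity and global rigidity *)

Section RigidityMatrix.
Variables (R : realType) (V : finType).
Implicit Types (p q u : V -> R * R) (E : rel V).
Local Notation n := #|V|.

Definition vec u : 'rV[R]_(n + n) :=
  row_mx (\row_i (u (enum_val i)).1) (\row_i (u (enum_val i)).2).

Definition unvec (z : 'rV[R]_(n + n)) (x : V) : R * R :=
  (z 0 (lshift n (enum_rank x)), z 0 (rshift n (enum_rank x))).

Lemma vecK u x : unvec (vec u) x = u x.
Proof. by apply: pair_ext; rewrite /= ?row_mxEl ?row_mxEr mxE enum_rankK. Qed.

Lemma unvecK z : vec (unvec z) = z.
Proof.
apply/rowP => i; rewrite -[i]splitK; case: (split i) => j /=.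
  by rewrite row_mxEl mxE /= enum_valK.
by rewrite row_mxEr mxE /= enum_valK.
Qed.

Lemma unvecD y z x : unvec (y + z) x = unvec y x + unvec z x.
Proof. by apply: pair_ext; rewrite /= mxE. Qed.

Lemma unvecZ k z x : unvec (k *: z) x = scale k (unvec z x).
Proof. by apply: pair_ext; rewrite /= mxE. Qed.

Lemma unvec_inj y z : unvec y =1 unvec z -> y = z.
Proof.
move=> h; rewrite -[y]unvecK -[z]unvecK /vec.
by congr row_mx; apply/rowP => i; rewrite !mxE h.
Qed.

Definition rigidity_map p N (e : 'I_N -> V * V) (z : 'rV[R]_(n + n)) : 'rV[R]_N :=
  \row_i dot (p (e i).1 - p (e i).2) (unvec z (e i).1 - unvec z (e i).2).

Fact rigidity_map_linear p N (e : 'I_N -> V * V) : linear (rigidity_map p e).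
Proof. by move=> k a b; apply/rowP => i; rewrite !mxE /dot /unvec /= !mxE; ring. Qed.

HB.instance Definition _ p N (e : 'I_N -> V * V) :=
  GRing.isLinear.Build R 'rV[R]_(n + n) 'rV[R]_N _ (rigidity_map p e)
    (rigidity_map_linear p e).

Definition rigidity_mx p N (e : 'I_N -> V * V) := lin1_mx (rigidity_map p e).

Lemma mul_rigidity_mx p N (e : 'I_N -> V * V) z :
  z *m rigidity_mx p e = rigidity_map p e z.
Proof. by rewrite mul_rV_lin1. Qed.

Definition motion_mx p : 'M[R]_(1 + (1 + 1), n + n) :=
  col_mx (vec (fun _ => (1, 0))) (col_mx (vec (fun _ => (0, 1))) (vec (fun x => turn (p x)))).

Lemma motion_mxP p z : reflect (exists a k, forall x, unvec z x = motion a k (p x))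
  (z <= motion_mx p)%MS.
Proof.
apply: (iffP submxP) => [[d ->]|[a [k zE]]].
  exists (lsubmx d 0 0, lsubmx (rsubmx d) 0 0), (rsubmx (rsubmx d) 0 0) => x.
  rewrite -{1}[d]hsubmxK -{1}[rsubmx d]hsubmxK !mul_row_col.
  rewrite {1}[lsubmx d]mx11_scalar {1}[lsubmx (rsubmx d)]mx11_scalar.
  rewrite {1}[rsubmx (rsubmx d)]mx11_scalar !mul_scalar_mx !unvecD !unvecZ !vecK.
  by apply: pair_ext => /=; ring.
exists (row_mx a.1%:M (row_mx a.2%:M k%:M)).
apply: unvec_inj => x; rewrite !mul_row_col !mul_scalar_mx zE !unvecD !unvecZ !vecK.
by apply: pair_ext => /=; ring.
Qed.

Lemma motion_mx_free p x y : p x != p y -> row_free (motion_mx p).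
Proof.
move=> pxy; rewrite -kermx_eq0 -submx0; apply/row_subP => i; set d := row i _.
have : d *m motion_mx p = 0 by apply/sub_kermxP; apply: row_sub.
have d_eq : d = row_mx (lsubmx d) (row_mx (lsubmx (rsubmx d)) (rsubmx (rsubmx d))).
  by rewrite !hsubmxK.
rewrite {1}d_eq !mul_row_col [lsubmx d]mx11_scalar [lsubmx (rsubmx d)]mx11_scalar.
rewrite [rsubmx (rsubmx d)]mx11_scalar !mul_scalar_mx.
set a := lsubmx d 0 0; set b := lsubmx _ 0 0; set k := rsubmx _ 0 0 => h.
have hx w : a - k * (p w).2 = 0 /\ b + k * (p w).1 = 0.
  have := congr1 (fun z => unvec z w) h; rewrite !unvecD !unvecZ !vecK.
  rewrite (_ : unvec 0 w = 0); last by apply: pair_ext; rewrite /= mxE.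
  move=> e; have := congr1 fst e; have := congr1 snd e; rewrite /= => h1 h2.
  by split; [rewrite -[RHS]h2|rewrite -[RHS]h1]; ring.
have k0 : k = 0.
  apply/eqP; apply: contraNT pxy => k0; apply/eqP.
  have [[x1 x2] [y1 y2]] := (hx x, hx y).
  by apply: pair_ext; apply: (mulfI k0); lra.
have [a0 b0] : a = 0 /\ b = 0.
  by have := hx x; rewrite k0 !mul0r subr0 addr0.
rewrite d_eq [lsubmx d]mx11_scalar [lsubmx (rsubmx d)]mx11_scalar.
rewrite [rsubmx (rsubmx d)]mx11_scalar -/a -/b -/k k0 a0 b0.
by rewrite !raddf0 !row_mx0 sub0mx.
Qed.

Lemma rigid_kernel p N (e : 'I_N -> V * V) E :
  diff_generic p -> inf_rigid [set: V] E p ->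
  (forall x y, E x y -> exists i, e i = (x, y)) ->
  (kermx (rigidity_mx p e) <= motion_mx p)%MS.
Proof.
move=> gp rig He; apply/row_subP => i.
have : row i (kermx (rigidity_mx p e)) *m rigidity_mx p e = 0.
  by apply/sub_kermxP; apply: row_sub.
rewrite mul_rigidity_mx => h; apply/motion_mxP.
have [|a [k ak]] := @flat_motion _ _ [set: V] p (unvec (row i (kermx (rigidity_mx p e)))) gp.
  apply: rig => x y _ _ /He [j ej].
  by have := congr1 (fun z : 'rV_N => z 0 j) h; rewrite !mxE ej.
by exists a, k => x; apply: ak; rewrite inE.
Qed.

Lemma motion_kernel p N (e : 'I_N -> V * V) : (motion_mx p <= kermx (rigidity_mx p e))%MS.
Proof.
apply/row_subP => i; apply/sub_kermxP; rewrite mul_rigidity_mx.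
have /motion_mxP[a [k ak]] : (row i (motion_mx p) <= motion_mx p)%MS by apply: row_sub.
by apply/rowP => j; rewrite !mxE !ak motion_flex.
Qed.

(** The three basic motions are independent as soon as [q] is not constant, so they exhaust a kernel
    of dimension at most 3. *)
Lemma small_kernel q N (e : 'I_N -> V * V) x0 y0 (z : V -> R * R) :
  (\rank (kermx (rigidity_mx q e)) <= 3)%N -> q x0 != q y0 ->
  (forall i, dot (q (e i).1 - q (e i).2) (z (e i).1 - z (e i).2) = 0) ->
  exists a k, forall x, z x = motion a k (q x).
Proof.
move=> ker3 q0 fl; have free := motion_mx_free q0; have sub := motion_kernel q e.
have : (kermx (rigidity_mx q e) <= motion_mx q)%MS.
  by rewrite -(mxrank_leqif_sup sub) (eqP free) eqn_leq ker3 -{1}(eqP free) mxrankS.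
move=> kq; have /motion_mxP[a [k ak]] : (vec z <= motion_mx q)%MS.
  apply: submx_trans kq; apply/sub_kermxP; rewrite mul_rigidity_mx.
  by apply/rowP => j; rewrite !mxE !vecK fl.
by exists a, k => x; rewrite -ak vecK.
Qed.

(* The derivations of R along the coordinates of [p] express the rigidity matrix of
   [p] as a multiple of that of [q], so the latter has maximal rank too. *)
Lemma equivalent_rigid p q E : diff_generic p -> inf_rigid [set: V] E p ->
  (forall x y, E x y -> dot (q x - q y) (q x - q y) = dot (p x - p y) (p x - p y)) ->
  (exists x y, q x != q y) ->
  forall z : V -> R * R, (forall x y, E x y -> dot (q x - q y) (z x - z y) = 0) ->
  exists a k, forall x, z x = motion a k (q x).
Proof.
move=> gp rig eqv [x0 [y0 q0]] z fl.
pose es := enum [pred xy : V * V | E xy.1 xy.2].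
pose e (i : 'I_(size es)) := tnth (in_tuple es) i.
have eE i : E (e i).1 (e i).2.
  by have := mem_tnth i (in_tuple es); rewrite mem_enum.
have Ee x y : E x y -> exists i, e i = (x, y).
  move=> Exy; have : (x, y) \in in_tuple es by rewrite mem_enum.
  by move=> /tnthP[i ->]; exists i.
have /choice[D HD] : forall i : 'I_(n + n), exists D : R -> R,
    derivation D /\ forall v, derive2 D (p v) = unvec (delta_mx 0 i) v.
  by move=> i; have [D derD HD] := gp (unvec (delta_mx 0 i)); exists D.
pose Dq : 'M[R]_(n + n) := \matrix_i vec (fun x => derive2 (D i) (q x)).
have factor : rigidity_mx p e = Dq *m rigidity_mx q e.
  apply/row_matrixP => i; rewrite row_mul rowE !mul_rigidity_mx rowK.
  apply/rowP => j; rewrite !mxE; have [derD HDi] := HD i.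
  rewrite !vecK -!HDi -!derivationB //.
  have := congr1 (D i) (eqv _ _ (eE j)); rewrite !(derivation_dot _ _ derD) => h.
  have two : 2 != 0 :> R by rewrite pnatr_eq0.
  apply: (mulfI two); move: h; rewrite /dot /= => h.
  by apply: etrans (etrans _ (esym h)) _; ring.
have rk : (\rank (rigidity_mx p e) <= \rank (rigidity_mx q e))%N.
  by rewrite factor mxrankM_maxr.
have ker3 : (\rank (kermx (rigidity_mx p e)) <= 3)%N.
  apply: leq_trans (mxrankS (rigid_kernel gp rig Ee)) _; exact: rank_leq_row.
apply: (small_kernel (e := e) _ q0) => [|i]; last exact: fl.
by apply: leq_trans ker3; rewrite !mxrank_ker leq_sub2l.
Qed.

End RigidityMatrix.

Section GlobalRigidity.
Variables (R : realType) (V : finType).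
Implicit Types (p q u : V -> R * R) (E : rel V) (S : {set V}).

Definition same_dist p q (x y : V) : Prop :=
  dot (q x - q y) (q x - q y) = dot (p x - p y) (p x - p y).

Definition glob_rigid S E p : Prop := forall q,
  (forall x y, x \in S -> y \in S -> E x y -> same_dist p q x y) ->
  forall x y, x \in S -> y \in S -> same_dist p q x y.

Lemma dotBB (a b : R * R) : dot (a - b) (a - b) = dot (b - a) (b - a).
Proof. by rewrite /dot /=; ring. Qed.

Lemma same_dist_sym p q x y : same_dist p q x y -> same_dist p q y x.
Proof. by rewrite /same_dist dotBB => ->; rewrite dotBB. Qed.

Lemma same_dist_refl p q x : same_dist p q x x.
Proof. by rewrite /same_dist !subrr /dot /= !mul0r. Qed.

Lemma diff_generic_comp (W : finType) (f : W -> V) p : injective f ->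
  diff_generic p -> diff_generic (p \o f).
Proof.
move=> injf gp delta.
have [D derD HD] := gp (fun v => if [pick w | f w == v] is Some w then delta w else 0).
exists D => // w; rewrite /= HD; case: pickP => [w' /eqP /injf -> //|/(_ w)].
by rewrite eqxx.
Qed.

(** The rigidity matrix is indexed by a whole vertex type, so [S] is made into one; the edge [x0 y0]
    ensures that [q] is not constant on it. *)
Lemma equivalent_rigid_on S E p q x0 y0 : diff_generic p -> inf_rigid S E p ->
  (forall x y, x \in S -> y \in S -> E x y -> same_dist p q x y) ->
  x0 \in S -> y0 \in S -> E x0 y0 -> x0 != y0 ->
  forall z : V -> R * R,
  (forall x y, x \in S -> y \in S -> E x y -> dot (q x - q y) (z x - z y) = 0) ->
  exists a k, forall x, x \in S -> z x = motion a k (q x).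
Proof.
move=> gp rig eqv xS yS E0 ne z fl.
pose T := {x : V | x \in S}; pose i (t : T) : V := val t.
have gp' : diff_generic (p \o i) by apply: diff_generic_comp => //; apply: val_inj.
have [||||a [k ak]] := @equivalent_rigid R T (p \o i) (q \o i) (relpre i E) gp' _ _ _ (z \o i).
- move=> u flu.
  pose u' x := if insub x is Some t then u t else 0.
  have u'E (t : T) : u' (val t) = u t by rewrite /u' valK.
  have flu' : flex S E p u'.
    move=> x y xS' yS' Exy; have := flu (exist _ x xS') (exist _ y yS') (in_setT _) (in_setT _) Exy.
    by rewrite -!u'E.
  by move=> s t _ _ _; have := rig _ flu' _ _ (valP s) (valP t) isT; rewrite /= !u'E.
- by move=> s t /= Est; apply: eqv => //; apply: valP.
- exists (exist _ x0 xS), (exist _ y0 yS) => /=; apply/eqP => e.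
  have := eqv _ _ xS yS E0; rewrite /same_dist /i /= in e *; rewrite e subrr.
  by move=> h; have := diff_generic_inj gp ne; rewrite -h /dot /= !mul0r addr0 eqxx.
- by move=> s t /= Est; apply: fl => //; apply: valP.
by exists a, k => x xS'; apply: (ak (exist _ x xS')).
Qed.

Lemma rigid_edge S E p x y : diff_generic p -> inf_rigid S E p -> x \in S -> y \in S ->
  x != y -> exists a b, [/\ a \in S, b \in S, E a b & a != b].
Proof.
move=> gp rig xS yS xy; apply: contrapT => h.
pose u v := if v == x then p x - p y else 0.
have /(_ x y xS yS isT) : flex S [rel _ _ | true] p u.
  apply: rig => a b aS bS Eab; have [->|ab] := eqVneq a b.
    by rewrite subrr /dot /= !mul0r addr0.
  by case: h; exists a, b.
rewrite /u eqxx eq_sym (negPf xy) subr0 => /eqP.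
by rewrite (negPf (diff_generic_inj gp xy)).
Qed.

(* With [P_i = p v - p i] and [Q_i = q v - q i], differentiating along the motions of
   [p v] alone gives a linear map sending every [Q_i] to [P_i]; preserving the lengths
   of three pairwise independent vectors, it is orthogonal. *)
Lemma global_step S E p q v : diff_generic p -> v \notin S -> inf_rigid S E p ->
  (forall x y, x \in v |: S -> y \in v |: S -> E x y -> same_dist p q x y) ->
  forall a b c, a \in S -> b \in S -> c \in S -> a != b -> b != c -> a != c ->
  E v a -> E v b -> E v c ->
  forall x y, x \in S -> y \in S -> E v x -> E v y -> same_dist p q x y.
Proof.
move=> gp vS rig eqv a b c aS bS cS ab bc ac Eva Evb Evc.
have nv i : i \in S -> v != i by move=> iS; apply: contraNneq vS => ->.
have inV i : i \in S -> i \in v |: S by move=> iS; rewrite !inE iS orbT.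
have [x0 [y0 [x0S y0S E0 ne0]]] := rigid_edge gp rig aS bS ab.
have dv i : i \in S -> E v i -> same_dist p q v i.
  by move=> iS; apply: eqv; rewrite ?setU11 ?inV.
have two : 2 != 0 :> R by rewrite pnatr_eq0.
have key delta : exists w, forall i, i \in S -> E v i ->
    dot (q v - q i) w = dot (p v - p i) delta.
  have [D derD HD] := gp (fun x => if x == v then delta else 0).
  have HDv : derive2 D (p v) = delta by rewrite HD eqxx.
  have HDS x : x \in S -> derive2 D (p x) = 0.
    by move=> xS; rewrite HD eq_sym (negPf (nv x xS)).
  have [|z|t [k tk]] := equivalent_rigid_on gp rig _ x0S y0S E0 ne0 (q := q)
      (z := fun x => derive2 D (q x)).
  - by move=> x y xS yS; apply: eqv; apply: inV.
  - move=> y zS yS Ezy; have := congr1 D (eqv _ _ (inV z zS) (inV y yS) Ezy).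
    rewrite !(derivation_dot _ _ derD) !(derivationB _ _ derD) !HDS // subrr => h.
    apply: (mulfI two); rewrite mulr0.
    by move: h; rewrite /dot /= => h; apply: etrans (etrans _ h) _; ring.
  exists (derive2 D (q v) - motion t k (q v)) => i iS Evi.
  have := congr1 D (dv i iS Evi); rewrite !(derivation_dot _ _ derD) !(derivationB _ _ derD).
  rewrite HDv (HDS i iS) (tk i iS) => h; apply: (mulfI two).
  by move: h; rewrite /dot /motion /= => h; apply: etrans (etrans _ h) _; ring.
have [w1 h1] := key (1, 0); have [w2 h2] := key (0, 1).
have PQ i : i \in S -> E v i -> p v - p i = (dot (q v - q i) w1, dot (q v - q i) w2).
  by move=> iS Ei; apply: pair_ext; rewrite /= ?h1 ?h2 // /dot /=; ring.
pose A := w1.1 ^+ 2 + w2.1 ^+ 2 - 1; pose C := w1.2 ^+ 2 + w2.2 ^+ 2 - 1.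
pose B := 2 * (w1.1 * w1.2 + w2.1 * w2.2).
have quad i : i \in S -> E v i -> A * (q v - q i).1 ^+ 2 +
    B * ((q v - q i).1 * (q v - q i).2) + C * (q v - q i).2 ^+ 2 = 0.
  move=> iS Ei; have := dv i iS Ei; rewrite /same_dist (PQ i iS Ei) => /esym/eqP.
  rewrite -subr_eq0 => /eqP h; rewrite -[RHS]h /A /B /C /dot /=; ring.
have crossQ i j : i \in S -> j \in S -> E v i -> E v j -> i != j ->
    cross (q v - q i) (q v - q j) != 0.
  move=> iS jS Ei Ej ij; have := diff_generic_cross gp (nv i iS) ij (nv j jS).
  rewrite (PQ i iS Ei) (PQ j jS Ej); apply: contraNneq => c0.
  have -> : forall a b : R * R, cross (dot a w1, dot a w2) (dot b w1, dot b w2) =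
      cross a b * cross w1 w2 by move=> x y; rewrite /cross /dot /=; ring.
  by rewrite c0 mul0r.
have [A0 B0 C0] := quadratic_form_eq0 (crossQ a b aS bS Eva Evb ab)
  (crossQ b c bS cS Evb Evc bc) (crossQ a c aS cS Eva Evc ac)
  (quad a aS Eva) (quad b bS Evb) (quad c cS Evc).
move=> x y xS yS Ex Ey; rewrite /same_dist.
have -> : p x - p y = (p v - p y) - (p v - p x) by apply: pair_ext => /=; ring.
have -> : q x - q y = (q v - q y) - (q v - q x) by apply: pair_ext => /=; ring.
rewrite (PQ x xS Ex) (PQ y yS Ey); apply/eqP; rewrite eq_sym -subr_eq0; apply/eqP.
pose d := (q v - q y) - (q v - q x).
transitivity (A * d.1 ^+ 2 + B * (d.1 * d.2) + C * d.2 ^+ 2).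
  by rewrite /A /B /C /d /dot /=; ring.
by rewrite A0 B0 C0 !mul0r !addr0.
Qed.

(** Cramer's rule: [gram] expresses the inner product of two vectors through their inner products
    with the sides [p b - p a] and [p c - p a], with a denominator that is nonzero by genericity.
    All its terms depend only on the preserved distances. *)
Lemma trilaterate p q a b c x y : diff_generic p -> a != b -> b != c -> a != c ->
  same_dist p q a b -> same_dist p q b c -> same_dist p q a c ->
  same_dist p q x a -> same_dist p q x b -> same_dist p q x c ->
  same_dist p q y a -> same_dist p q y b -> same_dist p q y c -> same_dist p q x y.
Proof.
move=> gp ab bc ac hab hbc hac xa xb xc ya yb yc.
have two : 2 != 0 :> R by rewrite pnatr_eq0.
have polar i j : same_dist p q i a -> same_dist p q j a -> same_dist p q i j ->
    dot (q i - q a) (q j - q a) = dot (p i - p a) (p j - p a).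
  move=> hi hj hij; apply: (mulfI two).
  transitivity (dot (q i - q a) (q i - q a) + dot (q j - q a) (q j - q a) -
    dot (q i - q j) (q i - q j)); first by rewrite /dot /=; ring.
  by rewrite hi hj hij /dot /=; ring.
have ba := same_dist_sym hab; have ca := same_dist_sym hac.
have gram (B C X Y : R * R) : cross B C ^+ 2 * dot X Y =
    dot X B * dot Y B * dot C C - dot B C * (dot X B * dot Y C + dot X C * dot Y B) +
    dot X C * dot Y C * dot B B by rewrite /cross /dot; ring.
have cr (B C : R * R) : cross B C ^+ 2 = dot B B * dot C C - dot B C ^+ 2.
  by rewrite /cross /dot; ring.
have crE : cross (q b - q a) (q c - q a) ^+ 2 = cross (p b - p a) (p c - p a) ^+ 2.
  by rewrite !cr !polar //; apply: same_dist_refl.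
have n0 : cross (p b - p a) (p c - p a) ^+ 2 != 0.
  rewrite sqrf_eq0; have := diff_generic_cross gp ab bc ac.
  by rewrite (_ : cross (p a - p b) _ = cross (p b - p a) (p c - p a)) // /cross /=; ring.
have XY : dot (q x - q a) (q y - q a) = dot (p x - p a) (p y - p a).
  apply: (mulfI n0); rewrite -{1}crE !gram !polar //; exact: same_dist_refl.
rewrite /same_dist.
transitivity (dot (q x - q a) (q x - q a) + dot (q y - q a) (q y - q a) -
  2 * dot (q x - q a) (q y - q a)); first by rewrite /dot /=; ring.
by rewrite XY xa ya /dot /=; ring.
Qed.

(** With [a] as its only neighbour, [v] could turn around [p a] while all the rest stays fixed. *)
Lemma rigid_neighbour S E p v a y : diff_generic p -> symmetric E -> inf_rigid S E p ->
  v \in S -> y \in S -> v != a -> v != y -> a != y ->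
  exists x, [/\ x \in S, x != v, x != a & E v x].
Proof.
move=> gp symE rig vS yS va vy ay; apply: contrapT => h.
pose u w := if w == v then turn (p v - p a) else 0.
have uw w : w != v -> u w = 0 by rewrite /u => /negPf ->.
have uv : u v = turn (p v - p a) by rewrite /u eqxx.
have nbr x : x \in S -> x != v -> E v x -> x = a.
  by move=> xS xv Evx; apply/eqP/negPn/negP => xa; apply: h; exists x.
have dturn (w : R * R) : dot w (turn w) = 0 by rewrite /dot /=; ring.
have /(_ v y vS yS isT) : flex S [rel _ _ | true] p u.
  apply: rig => s t sS tS Est; have [->|st] := eqVneq s t.
    by rewrite subrr /dot /= !mul0r addr0.
  have [sv|sv] := eqVneq s v.
    rewrite sv in st Est *; rewrite (nbr t) // 1?eq_sym // uv uw 1?eq_sym //.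
    by rewrite subr0 dturn.
  have [tv|tv] := eqVneq t v; last by rewrite !uw // subrr /dot /= !mulr0 addr0.
  rewrite tv in Est st *; rewrite (nbr s) // 1?symE // uv uw 1?eq_sym //.
  by rewrite -[RHS](dturn (p v - p a)) /dot /=; ring.
rewrite uv uw 1?eq_sym // => e; have := diff_generic_cross gp va ay vy.
have -> : cross (p v - p a) (p v - p y) = dot (p v - p y) (turn (p v - p a) - 0).
  by rewrite /cross /dot /=; ring.
by rewrite e eqxx.
Qed.

(** Delete [v] and join all its neighbours. By [global_step] an equivalent [q] preserves the
    distances between neighbours of [v], so it is equivalent for the new graph too, to which the
    induction applies; [v] is then located from three of its neighbours. Joining the neighbours also
    keeps the new graph redundantly rigid. *)
Theorem vertex_redundant_glob_rigid S E p : diff_generic p -> symmetric E -> (3 <= #|S|)%N ->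
  (forall v, v \in S -> inf_rigid (S :\ v) E p) -> glob_rigid S E p.
Proof.
move=> gp; move: {2}#|S| (erefl #|S|) => n; elim: n S E => [|n IH] S E Sn symE S3 red.
  by rewrite Sn in S3.
have [S4|S4] := leqP 4 #|S|; last first.
  (* On three vertices, deleting the third one leaves the pair [x], [y], which is rigid only if it
     is an edge. *)
  move=> q eqv x y xS yS; have [->|xy] := eqVneq x y; first exact: same_dist_refl.
  have S3e : #|S| = 3 by clear - S3 S4; lia.
  have := cardsD1 x S; rewrite xS S3e => -[]; rewrite add0n.
  rewrite (cardsD1 y) in_setD1 eq_sym xy yS => -[] /=; rewrite add0n.
  move=> /esym/eqP/cards1P[v Ev].
  have /setD1P[vy /setD1P[vx vS]] : v \in S :\ x :\ y by rewrite Ev set11.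
  have [||a [b [aS bS Eab abn]]] := rigid_edge gp (red v vS) _ _ xy.
  - by rewrite !inE xS eq_sym vx.
  - by rewrite !inE yS eq_sym vy.
  have only w : w \in S :\ v -> w = x \/ w = y.
    rewrite !inE => /andP[wv wS]; have [->|wx] := eqVneq w x; first by left.
    have [->|wy] := eqVneq w y; first by right.
    have : w \in S :\ x :\ y by rewrite !inE wy wx.
    by rewrite Ev inE (negPf wv).
  have [aS' bS'] : a \in S /\ b \in S by move: aS bS; rewrite !inE => /andP[_ ->] /andP[_ ->].
  have := eqv a b aS' bS' Eab.
  case: (only a aS) => ea; case: (only b bS) => eb; move: abn; rewrite ea eb ?eqxx // => _.
  exact: same_dist_sym.
have [v vS] : exists v, v \in S by apply/card_gt0P; rewrite Sn.
have cSv : (#|S :\ v| = n)%N by move: Sn; rewrite (cardsD1 v) vS => -[].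
have vSv : v \notin S :\ v by rewrite !inE eqxx.
have third (W : {set V}) a : (3 <= #|W|)%N -> exists y, [/\ y \in W, v != y & a != y].
  move=> W3; have : (0 < #|W :\ v :\ a|)%N.
    by have := cardsD1 v W; have := cardsD1 a (W :\ v);
       move: (leq_b1 (v \in W)) (leq_b1 (a \in W :\ v)); clear - W3; lia.
  by case/card_gt0P => y /setD1P[ya /setD1P[yv yW]]; exists y; rewrite ![_ == y]eq_sym.
have cD w : w \in S -> (3 <= #|S :\ w|)%N.
  by move=> wS; have := cardsD1 w S; rewrite wS; clear - S4; lia.
have nbr w : w \in S -> w != v -> forall a, v != a ->
    exists x, [/\ x \in S, x != w, x != v, x != a & E v x].
  move=> wS wv a va; have [y [yW vy ay]] := third (S :\ w) a (cD w wS).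
  have [|x [xS xv xa Ex]] := rigid_neighbour gp symE (red w wS) _ yW va vy ay.
    by rewrite !inE vS eq_sym wv.
  by exists x; move: xS; rewrite !inE => /andP[].
have [w0 [w0S vw0 _]] := third S v (ltnW S4).
have w0v : w0 != v by rewrite eq_sym.
have [a [aS _ av _ Ea]] := nbr w0 w0S w0v w0 vw0.
have [b [bS ba bv _ Eb]] := nbr a aS av w0 vw0.
have va : v != a by rewrite eq_sym.
have [c [cS cb cv ca Ec]] := nbr b bS bv a va.
have inSv x : x \in S -> x != v -> x \in S :\ v by move=> xS xv; rewrite !inE xv.
have [ab bc ac] : [/\ a != b, b != c & a != c] by split; rewrite eq_sym.
pose E' := [rel x y | E x y || (E v x && E v y)].
have symE' : symmetric E' by move=> x y /=; rewrite symE andbC.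
have grE' : glob_rigid (S :\ v) E' p.
  apply: IH => //; first exact: cD.
  move=> w /setD1P[wv wS] u fl.
  pose N := [set x in S :\ v :\ w | E v x].
  have [|t [k tk]] := @flat_motion _ _ N p u gp.
    move=> x y; rewrite !inE => /andP[/and3P[xw xv xS] Ex] /andP[/and3P[yw yv yS] Ey] _.
    by apply: fl; rewrite ?inE ?xw ?xv ?yw ?yv //= Ex Ey orbT.
  (* The neighbours of [v] other than [w] form a clique of [E'], so the flex moves them rigidly and
     [v] can follow their motion; the result is a flex for [E] on [S :\ w]. *)
  pose u' x := if x == v then motion t k (p v) else u x.
  have u'v : u' v = motion t k (p v) by rewrite /u' eqxx.
  have u'E x : x != v -> u' x = u x by rewrite /u' => /negPf ->.
  have flu' : flex (S :\ w) E p u'.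
    move=> x y /setD1P[xw xS] /setD1P[yw yS] Exy.
    have [xv|xv] := eqVneq x v; have [yv|yv] := eqVneq y v.
    - by rewrite xv yv subrr /dot /= !mul0r addr0.
    - rewrite xv u'v u'E // (tk y) ?motion_flex //.
      by rewrite !inE yw yv yS -xv.
    - rewrite yv u'v u'E // (tk x) ?motion_flex //.
      by rewrite !inE xw xv xS symE -yv.
    - by rewrite !u'E //; apply: fl; rewrite ?inE ?xw ?xv ?yw ?yv //= Exy.
  move=> x y /setD1P[xw /setD1P[xv xS]] /setD1P[yw /setD1P[yv yS]] _.
  have := red w wS u' flu' x y; rewrite !inE xw xS yw yS !u'E //; exact.
move=> q eqv.
have step := @global_step (S :\ v) E p q v gp vSv (red v vS).
have isoS x y : x \in S :\ v -> y \in S :\ v -> same_dist p q x y.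
  apply: grE' => {}x {}y xS yS /orP[|/andP[Ex Ey]].
    by apply: eqv; [case/setD1P: xS|case/setD1P: yS].
  apply: (step _ a b c) => //; try exact: inSv.
  by move=> {}x0 y0; rewrite !setD1K //; apply: eqv.
have isov x : x \in S -> same_dist p q v x.
  move=> xS; have [->|xv] := eqVneq x v; first exact: same_dist_refl.
  have [iS iX] := (fun y => inSv y, inSv x xS xv).
  apply: (trilaterate gp ab bc ac); try (by apply: isoS; apply: inSv);
    try (by apply: eqv).
move=> x y xS yS; have [->|xv] := eqVneq x v; first exact: isov.
have [->|yv] := eqVneq y v; first by apply/same_dist_sym/isov.
by apply: isoS; apply: inSv.
Qed.

End GlobalRigidity.

Local Close Scope ring_scope.

(** * Maximal tight sets *)

Section TightSets.
Variable V : finType.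
Implicit Types (F E P Q : {set {set V}}) (X Y S B f : {set V}) (v : V).

Definition spans E S : Prop := forall f, f \in E -> f \subset S.

Definition maximal_sparse E F : Prop :=
  [/\ F \subset E, sparse F & forall f, f \in E -> f \notin F -> ~ sparse (f |: F)].

Lemma maximal_sparse_exists E F0 : F0 \subset E -> sparse F0 ->
  exists2 F, maximal_sparse E F & F0 \subset F.
Proof.
move=> F0E sp0; pose P := [pred F : {set {set V}} | `[< sparse F >] && (F \subset E)].
have [|F /maxsetP[/andP[/asboolP spF FE] maxF] F0F] := @maxset_exists _ P F0.
  by rewrite /= F0E andbT; apply/asboolP.
exists F => //; split=> // f fE fF sp; case/negP: fF.
rewrite -(maxF (f |: F)) ?setU11 ?subsetUr //=.
by rewrite subUset sub1set fE FE !andbT; apply/asboolP.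
Qed.

Lemma sparse0 : sparse (set0 : {set {set V}}).
Proof.
move=> X X2; have -> : ecount set0 X = 0.
  by apply/eqP; rewrite cards_eq0; apply/eqP/setP => f; rewrite !inE.
by lia.
Qed.

Definition max_tight F S : {set {set V}} :=
  [set X | maxset [pred Y : {set V} | tight F Y && (Y \subset S)] X].

Lemma max_tightP F S X : X \in max_tight F S -> tight F X /\ X \subset S.
Proof. by rewrite inE => /maxsetP[/andP[]]. Qed.

Lemma max_tight_sup F S X Y : X \in max_tight F S -> tight F Y -> Y \subset S ->
  X \subset Y -> Y = X.
Proof. by rewrite inE => /maxsetP[_ h] tY YS XY; apply: h => //=; rewrite tY. Qed.

Lemma max_tight_ex F S Y : tight F Y -> Y \subset S ->
  exists2 X, X \in max_tight F S & Y \subset X.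
Proof.
move=> tY YS; have [|X mX YX] :=
  @maxset_exists _ [pred Y : {set V} | tight F Y && (Y \subset S)] Y; first by rewrite /= tY.
by exists X; rewrite ?inE.
Qed.

Lemma max_tight_cap F S X Y : sparse F -> X \in max_tight F S -> tight F Y -> Y \subset S ->
  2 <= #|X :&: Y| -> Y \subset X.
Proof.
move=> spF mX tY YS XY; have [tX XS] := max_tightP mX.
apply/setUidPl.
apply: (max_tight_sup mX); rewrite ?subsetUl ?subUset ?XS //.
exact: tight_union.
Qed.

Lemma max_tight_edge F S X Y f : sparse F -> #|f| = 2 -> X \in max_tight F S ->
  Y \in max_tight F S -> f \subset X -> f \subset Y -> X = Y.
Proof.
move=> spF f2 mX mY fX fY; have [tX XS] := max_tightP mX; have [tY YS] := max_tightP mY.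
have c2 : 2 <= #|X :&: Y| by rewrite -f2 subset_leq_card // subsetI fX.
apply/eqP; rewrite eqEsubset (max_tight_cap spF mX tY YS c2) andbT.
by apply: (max_tight_cap spF mY tX XS); rewrite setIC.
Qed.

Lemma edge_tight F f : sparse F -> #|f| = 2 -> f \in F -> tight F f.
Proof.
move=> spF f2 fF; have := spF f; rewrite /tight f2 => /(_ isT).
have : 0 < ecount F f by apply/card_gt0P; exists f; rewrite inE fF /=.
by clear; lia.
Qed.

Lemma tight_edge F f : edge_set F -> #|f| = 2 -> tight F f -> f \in F.
Proof.
move=> eF f2 /andP[_]; rewrite f2 => /eqP e.
have : 0 < ecount F f by clear - e; lia.
case/card_gt0P => g; rewrite inE => /andP[gF gf].
suff -> : f = g by [].
by apply/eqP; rewrite eq_sym eqEcard gf f2 (eF g gF).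
Qed.

Lemma ecount_spans F S X : spans F S -> ecount F X = ecount F (X :&: S).
Proof.
move=> FS; apply: eq_card => f; rewrite !inE subsetI.
by case fF : (f \in F); rewrite //= (FS f fF) andbT.
Qed.

Lemma ecount_small F X : edge_set F -> #|X| <= 1 -> ecount F X = 0.
Proof.
move=> eF X1; apply/eqP; rewrite cards_eq0 -subset0; apply/subsetP => f.
by rewrite inE => /andP[/eF f2 /subset_leq_card]; rewrite f2; clear - X1; lia.
Qed.

Lemma tight_spans F S X : edge_set F -> sparse F -> spans F S -> tight F X -> X \subset S.
Proof.
move=> eF spF FS /andP[X2]; rewrite (ecount_spans X FS) => /eqP tX.
apply/setIidPl/eqP; rewrite eqEcard subsetIl /=.
have [c1|c2] := leqP #|X :&: S| 1; last by have := spF _ c2; clear - tX; lia.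
by move: tX; rewrite ecount_small //; clear - X2; lia.
Qed.

(** Adding an edge outside [F] breaks sparsity, so its ends lie in a set that is already tight. *)
Lemma max_tight_cover E F S : edge_set E -> spans E S -> maximal_sparse E F ->
  forall f, f \in E -> exists2 X, X \in max_tight F S & f \subset X.
Proof.
move=> eE ES [FE spF maxF] f fE.
have eF : edge_set F by move=> g /(subsetP FE); apply: eE.
have FS : spans F S by move=> g /(subsetP FE); apply: ES.
have [fF|fF] := boolP (f \in F).
  by apply: max_tight_ex; [apply: edge_tight => //; apply: eE|apply: ES].
suff [X tX fX] : exists2 X, tight F X & f \subset X.
  have [Y mY XY] := max_tight_ex tX (tight_spans eF spF FS tX).
  by exists Y => //; apply: subset_trans XY.
apply: contrapT => noX; apply: (maxF f fE fF) => X X2; rewrite leqNgt; apply/negP => lt.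
have := spF X X2; have le : ecount (f |: F) X <= (f \subset X) + ecount F X.
  have sub : within (f |: F) X \subset (if f \subset X then [set f] else set0) :|: within F X.
    apply/subsetP => g; rewrite !inE => /andP[/orP[/eqP->|->] gX].
      by rewrite gX inE eqxx.
    by rewrite gX orbT.
  apply: leq_trans (subset_leq_card sub) _; apply: leq_trans (leq_card_setU _ _) _.
  by rewrite leq_add2r; case: ifP; rewrite ?cards1 ?cards0.
have [fX|fX] := boolP (f \subset X); last by rewrite (negPf fX) in le; clear - lt le; lia.
rewrite fX in le => spX; apply: noX; exists X => //; rewrite /tight X2 /=.
by clear - lt le spX; lia.
Qed.

Lemma sum_ecount E P : \sum_(X in P) ecount E X =
  \sum_(f in E) #|[set X in P | f \subset X]|.
Proof.
transitivity (\sum_(X in P) \sum_(f in E) (f \subset X)).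
  apply: eq_bigr => X _; rewrite -big_mkcondr sum1dep_card.
  by apply: eq_card => f; rewrite !inE.
rewrite exchange_big; apply: eq_bigr => f _.
by rewrite -big_mkcondr sum1dep_card; apply: eq_card => X; rewrite !inE.
Qed.

Lemma max_tight_sum F S : edge_set F -> sparse F ->
  forall f, f \in F -> #|[set X in max_tight F S | f \subset X]| <= 1.
Proof.
move=> eF spF f fF; apply/card_le1_eqP => X Y; rewrite !inE.
move=> /andP[mX fX] /andP[mY fY].
by apply: (@max_tight_edge F S Y X f) => //; rewrite ?inE //; apply: eF.
Qed.

(* Lovasz-Yemini: the maximal tight sets of a maximal sparse set cover all the edges. *)
Lemma dense_tight E S (k : nat) : edge_set E -> spans E S -> 2 <= #|S| ->
  (forall X, X \proper S -> 2 <= #|X| -> 4 * ecount E X + 3 * k <= 2 * k * #|X|) ->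
  2 * k * #|S| < 4 * #|E| + 4 * k ->
  exists F, [/\ F \subset E, sparse F & tight F S].
Proof.
move=> eE ES S2 small big.
have [F maxF _] := maximal_sparse_exists (sub0set E) sparse0.
have [FE spF _] := maxF; exists F; split=> //; apply/negPn/negP => ntS.
have eF : edge_set F by move=> g /(subsetP FE); apply: eE.
have FS : spans F S by move=> g /(subsetP FE); apply: ES.
have cF : #|F| = ecount F S.
  by apply: eq_card => f; rewrite inE; case fF : (f \in F); rewrite //= FS.
have h1 : \sum_(X in max_tight F S) ecount F X <= #|F|.
  by rewrite sum_ecount -sum1_card; apply: leq_sum => f fF; apply: max_tight_sum.
have h2 : #|E| <= \sum_(X in max_tight F S) ecount E X.
  rewrite sum_ecount -sum1_card; apply: leq_sum => f fE.
  have [X mX fX] := max_tight_cover eE ES maxF fE.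
  by apply/card_gt0P; exists X; rewrite inE mX.
(* A tight [X] has [2 |X| - 3] edges in [F], so [small] reads [4 e_E(X) <= k e_F(X)]. The sets cover
   [E] and share no edge of [F]; hence [4 |E| <= k |F|]. *)
have h3 : 4 * \sum_(X in max_tight F S) ecount E X <=
    k * \sum_(X in max_tight F S) ecount F X.
  rewrite !big_distrr /=; apply: leq_sum => X mX; have [tX XS] := max_tightP mX.
  have XpS : X \proper S.
    by rewrite properEneq XS andbT; apply: contraNneq ntS => <-.
  move: tX => /andP[X2 /eqP tX]; have := small X XpS X2; clear - tX; nia.
have h4 : ecount F S + 4 <= 2 * #|S|.
  by have := spF S S2; move: ntS; rewrite /tight S2 /=; clear; lia.
by rewrite cF in h1; clear - h1 h2 h3 h4 big; nia.
Qed.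

(** A part met by [X] in [c >= 2] vertices contributes at most [2 c - 3] edges, any other part none,
    so spreading [X] over several parts only lowers the count. *)
Lemma union_sparse P (G : {set V} -> {set {set V}}) : trivIset P ->
  (forall B, B \in P -> [/\ edge_set (G B), sparse (G B) & spans (G B) B]) ->
  sparse (\bigcup_(B in P) G B).
Proof.
move=> tP HG X X2.
have le1 : ecount (\bigcup_(B in P) G B) X <= \sum_(B in P) ecount (G B) (X :&: B).
  rewrite /ecount; have -> : within (\bigcup_(B in P) G B) X =
      \bigcup_(B in P) within (G B) (X :&: B).
    apply/setP => f; rewrite inE; apply/andP/bigcupP => [[/bigcupP[B BP fB] fX]|[B BP]].
      exists B => //; rewrite inE fB subsetI fX /=.
      by have [_ _] := HG B BP; apply.
    rewrite inE subsetI => /and3P[fB fX _]; split=> //.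
    by apply/bigcupP; exists B.
  elim/big_rec2: _ => [|B m A BP IH]; first by rewrite cards0.
  by apply: leq_trans (leq_card_setU _ _) _; rewrite leq_add2l.
have le2 : \sum_(B in P) #|X :&: B| <= #|X|.
  have -> : \sum_(B in P) #|X :&: B| = \sum_(x in X) #|[set B in P | x \in B]|.
    transitivity (\sum_(B in P) \sum_(x in X) (x \in B)).
      apply: eq_bigr => B _; rewrite -big_mkcondr sum1dep_card.
      by apply: eq_card => x; rewrite !inE.
    rewrite exchange_big; apply: eq_bigr => x _.
    by rewrite -big_mkcondr sum1dep_card; apply: eq_card => B; rewrite !inE.
  rewrite -sum1_card; apply: leq_sum => x _; apply/card_le1_eqP => B B'.
  rewrite !inE => /andP[BP xB] /andP[B'P xB'].
  by rewrite -(def_pblock tP BP xB) -(def_pblock tP B'P xB').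
have le3 B : B \in P -> ecount (G B) (X :&: B) <= 2 * #|X :&: B| - 3.
  move=> BP; have [eG sG _] := HG B BP; have [c1|c2] := leqP #|X :&: B| 1.
    by rewrite ecount_small.
  by have := sG _ c2; clear; lia.
have [/existsP[B1 /andP[B1P c2]]|] := boolP [exists B, (B \in P) && (2 <= #|X :&: B|)].
  have := le3 _ B1P; move: le1 le2; move: (ecount (\bigcup_(B in P) G B) X) => e.
  rewrite (bigD1 B1) //= [X in _ -> X <= #|_| -> _](bigD1 B1) //=.
  have : \sum_(B in P | B != B1) ecount (G B) (X :&: B) <=
      2 * \sum_(B in P | B != B1) #|X :&: B|.
    rewrite big_distrr /=; apply: leq_sum => B /andP[BP _].
    by apply: leq_trans (le3 B BP) _; apply: leq_subr.
  move: (\sum_(B in P | B != B1) ecount _ _) (\sum_(i in P | i != B1) #|X :&: i|) c2.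
  by move: (ecount (G B1) _) #|X :&: B1| #|X| => a b c s t; clear; lia.
rewrite negb_exists => /forallP none.
have : ecount (\bigcup_(B in P) G B) X = 0.
  apply/eqP; rewrite -leqn0; apply: leq_trans le1 _.
  rewrite big1 // => B BP; have := none B; rewrite BP /= -ltnNge => c1.
  by have [eG _ _] := HG B BP; rewrite ecount_small.
by move=> ->; clear - X2; lia.
Qed.

Definition crossing E Q : {set {set V}} :=
  [set f in E | [forall X in Q, ~~ (f \subset X)]].

(** The last hypothesis is the Nash-Williams-Tutte condition for three edge-disjoint spanning trees
    in the graph obtained by contracting the blocks, three being the degrees of freedom of a body in
    the plane. Extend the Laman graphs of the blocks to a maximal sparse [F]. Its maximal tight sets
    are the parts of a coarser partition [Q] together with single edges, so [F] has at least
    [2 |S| - 3 |Q| + |crossing E Q|] edges. *)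
Lemma glue_tight E S P : edge_set E -> spans E S -> S != set0 -> partition P S ->
  (forall B, B \in P -> 2 <= #|B|) ->
  (forall B, B \in P -> exists F, [/\ F \subset E, sparse F & tight F B]) ->
  (forall B x y z, B \in P -> x \in B -> y \notin B -> z \notin B ->
     [set x; y] \in E -> [set x; z] \in E -> y = z) ->
  (forall Q, partition Q S -> (forall B, B \in P -> exists2 X, X \in Q & B \subset X) ->
     2 <= #|Q| -> 3 * #|Q| <= #|crossing E Q| + 3) ->
  exists F, [/\ F \subset E, sparse F & tight F S].
Proof.
move=> eE ES S0 partP P2 hG out1 cross.
have /boolp.choice[G HG] : forall B, exists F, B \in P -> [/\ F \subset E, sparse F & tight F B].
  move=> B; have [BP|_] := boolP (B \in P); last by exists set0.
  by have [F HF] := hG B BP; exists F.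
have /and3P[/eqP covP tP nP] := partP.
pose G' B := within (G B) B.
have HG' B : B \in P -> [/\ edge_set (G' B), sparse (G' B) & spans (G' B) B].
  move=> BP; have [GE sG tG] := HG B BP; split.
  - by move=> f; rewrite inE => /andP[/(subsetP GE) /eE].
  - by apply: sparse_sub sG; apply/subsetP => f; rewrite inE => /andP[].
  - by move=> f; rewrite inE => /andP[].
pose F0 := \bigcup_(B in P) G' B.
have sp0 : sparse F0 by apply: union_sparse.
have F0E : F0 \subset E.
  apply/bigcupsP => B BP; have [GE _ _] := HG B BP.
  by apply/subsetP => f; rewrite inE => /andP[/(subsetP GE)].
have [F maxF F0F] := maximal_sparse_exists F0E sp0.
have [FE spF _] := maxF; exists F; split=> //; apply/negPn/negP => ntS.
have eF : edge_set F by move=> g /(subsetP FE); apply: eE.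
have FS : spans F S by move=> g /(subsetP FE); apply: ES.
have subS B : B \in P -> B \subset S by move=> BP; rewrite -covP; apply: (bigcup_max B).
have tB B : B \in P -> tight F B.
  move=> BP; have [_ _ /andP[B2 /eqP tG]] := HG B BP; rewrite /tight B2 /=.
  have := spF B B2; have : ecount (G B) B <= ecount F B.
    apply/subset_leq_card/subsetP => f fB.
    have : f \in F0 by apply/bigcupP; exists B.
    by move=> /(subsetP F0F) fF; move: fB; rewrite !inE fF => /andP[_ ->].
  by clear - tG; lia.
have inB x : x \in S -> exists2 B, B \in P & x \in B.
  by rewrite -covP => /bigcupP[B BP xB]; exists B.
(* If [X] does not contain the block of its vertex [w], then [w] is alone of its block in [X] and
   has at most one edge there. In a tight set of three or more vertices all degrees are at least
   two. *)
have single X B w : X \in max_tight F S -> B \in P -> w \in X -> w \in B -> ~~ (B \subset X) ->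
    #|X| = 2.
  move=> mX BP wX wB nBX; have [/andP[X2 /eqP tX] XS] := max_tightP mX.
  have c1 : #|X :&: B| <= 1.
    rewrite leqNgt; apply: contra nBX => c2.
    by apply: (max_tight_cap spF mX (tB B BP) (subS B BP)).
  have onlyw x : x \in X -> x \in B -> x = w.
    by move=> xX xB; apply: (card_le1_eqP c1); rewrite inE ?xX ?wX.
  have d1 : #|nbrs F X w| <= 1.
    apply/card_le1_eqP => y z; rewrite !inE => /and3P[yX yw Fy] /and3P[zX zw Fz].
    apply/esym; apply: (out1 B w y z) => //; try exact: (subsetP FE).
      by apply: contraNN yw => yB; rewrite (onlyw y yX yB).
    by apply: contraNN zw => zB; rewrite (onlyw z zX zB).
  apply/eqP; rewrite eqn_leq X2 andbT leqNgt; apply/negP => X3.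
  have := ecount_D1 eF wX; have := cardsD1 w X; rewrite wX => cX.
  have X2' : 2 <= #|X :\ w| by clear - cX X3; lia.
  by have := spF _ X2'; clear - tX d1 cX; lia.
pose Q := [set X in max_tight F S | [exists B in P, B \subset X]].
have QP X : X \in Q -> X \in max_tight F S /\ exists2 B, B \in P & B \subset X.
  by rewrite inE => /andP[mX /existsP[B /andP[BP BX]]]; split=> //; exists B.
have full X B w : X \in Q -> B \in P -> w \in X -> w \in B -> B \subset X.
  move=> /QP[mX [B' B'P B'X]] BP wX wB; apply/negPn/negP => nBX.
  have X2 := single X B w mX BP wX wB nBX.
  have B'eq : B' = X by apply/eqP; rewrite eqEcard B'X X2 P2.
  case/negP: nBX; rewrite -B'eq in wX *.
  by rewrite -(def_pblock tP BP wB) (def_pblock tP B'P wX).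
have supB B : B \in P -> exists2 X, X \in Q & B \subset X.
  move=> BP; have [X mX BX] := max_tight_ex (tB B BP) (subS B BP).
  by exists X => //; rewrite inE mX; apply/existsP; exists B; rewrite BP.
have partQ : partition Q S.
  apply/and3P; split.
  - rewrite eqEsubset; apply/andP; split.
      by apply/bigcupsP => X /QP[/max_tightP[]].
    apply/subsetP => x /inB[B BP xB]; have [X XQ BX] := supB B BP.
    by apply/bigcupP; exists X => //; apply: (subsetP BX).
  - apply/trivIsetP => X Y XQ YQ XY; rewrite -setI_eq0; apply/set0Pn => -[w].
    rewrite inE => /andP[wX wY].
    have [mX _] := QP X XQ; have [mY _] := QP Y YQ.
    have wS : w \in S by apply: (subsetP (proj2 (max_tightP mX))).
    have [B BP wB] := inB w wS.
    have BX := full X B w XQ BP wX wB; have BY := full Y B w YQ BP wY wB.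
    case/eqP: XY; have [tX XS] := max_tightP mX; have [tY YS] := max_tightP mY.
    have c2 : 2 <= #|X :&: Y| by apply: leq_trans (P2 B BP) _; rewrite subset_leq_card // subsetI BX.
    apply/eqP; rewrite eqEsubset (max_tight_cap spF mX tY YS c2) andbT.
    by apply: (max_tight_cap spF mY tX XS); rewrite setIC.
  - apply/negP => /QP[/max_tightP[]]; by rewrite /tight cards0.
(* A maximal tight set containing a crossing edge contains no whole block, so it is that edge. *)
have crossF : crossing E Q \subset F.
  apply/subsetP => f; rewrite inE => /andP[fE /forallP nQ].
  have [X mX fX] := max_tight_cover eE ES maxF fE.
  have XQ : X \notin Q by apply/negP => XQ; have := nQ X; rewrite XQ fX.
  have [tX XS] := max_tightP mX; have /andP[X2 _] := tX.
  have [w wX] : exists w, w \in X by apply/card_gt0P; apply: leq_trans X2.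
  have [B BP wB] := inB w (subsetP XS w wX).
  have nBX : ~~ (B \subset X).
    by apply: contra XQ => BX; rewrite inE mX; apply/existsP; exists B; rewrite BP.
  have X2e := single X B w mX BP wX wB nBX.
  have -> : f = X by apply/eqP; rewrite eqEcard fX X2e (eE f fE).
  exact: tight_edge.
have count : \sum_(X in Q) ecount F X + #|crossing E Q| <= #|F|.
  rewrite sum_ecount -(setIidPr crossF) -sum1_card.
  rewrite [X in _ + X <= _](eq_bigl (fun f => (f \in F) && (f \in crossing E Q))); last by move=> f; rewrite inE.
  rewrite [X in _ + X <= _]big_mkcondr -big_split /= -sum1_card; apply: leq_sum => f fF.
  have le1 : #|[set X in Q | f \subset X]| <= 1.
    apply: leq_trans (max_tight_sum S eF spF fF); apply/subset_leq_card/subsetP => X.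
    by rewrite !inE => /andP[/andP[-> _] ->].
  case: ifP => [|_]; last by rewrite addn0.
  rewrite inE => /andP[_ /forallP nQ]; rewrite [X in X + _](_ : _ = 0) //.
  apply/eqP; rewrite cards_eq0; apply/eqP/setP => X; rewrite in_set0 in_set.
  by apply/negP => /andP[XQ fX]; have := nQ X; rewrite XQ fX.
have sumQ : \sum_(X in Q) ecount F X + 3 * #|Q| = 2 * #|S|.
  rewrite (card_partition partQ) big_distrr /= mulnC -sum_nat_const -big_split /=.
  by apply: eq_bigr => X /QP[/max_tightP[/andP[_ /eqP]]].
have cF : #|F| = ecount F S.
  by apply: eq_card => f; rewrite inE; case fF : (f \in F); rewrite //= FS.
have [x xS] := set0Pn _ S0; have [B0 B0P xB0] := inB x xS.
have [X0 X0Q B0X0] := supB B0 B0P.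
have S2 : 2 <= #|S| by apply: leq_trans (P2 B0 B0P) _; apply/subset_leq_card/subS.
have h4 : ecount F S + 4 <= 2 * #|S|.
  by have := spF S S2; move: ntS; rewrite /tight S2 /=; clear; lia.
have [Q2|Q1] := leqP 2 #|Q|.
  have := cross Q partQ supB Q2; clear - h4 cF sumQ count; lia.
have /cards1P[X EX] : #|Q| == 1.
  by rewrite eqn_leq -ltnS Q1; apply/card_gt0P; exists X0.
have : S = X by case/and3P: partQ => /eqP <- _ _; rewrite EX /cover big_set1.
have : X \in Q by rewrite EX set11.
by move=> /QP[/max_tightP[tX _] _] ES'; rewrite ES' tX in ntS.
Qed.

End TightSets.

(** * Cuts and blocks of vertex-transitive graphs *)

Section Cuts.
Variable G : sgraph.
Implicit Types (X Y S B : {set G}) (x y v : G).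

Definition edges : {set {set G}} :=
  [set f | [exists x : G, exists y : G, adj x y && (f == [set x; y])]].
Definition outer X x : {set G} := [set y | adj x y] :\: X.
Definition cut X : nat := \sum_(x in X) #|outer X x|.

Lemma adj_neq x y : adj x y -> x != y.
Proof. by apply: contraTneq => ->; rewrite adj_irr. Qed.

Lemma edgesP f : reflect (exists x y, adj x y /\ f = [set x; y]) (f \in edges).
Proof.
rewrite inE; apply: (iffP existsP) => [[x /existsP[y /andP[xy /eqP->]]]|[x [y [xy ->]]]].
  by exists x, y.
by exists x; apply/existsP; exists y; rewrite xy eqxx.
Qed.

Lemma edges_set : edge_set edges.
Proof. by move=> f /edgesP[x [y [/adj_neq xy ->]]]; rewrite cards2 xy. Qed.

Lemma mem_edges x y : ([set x; y] \in edges) = adj x y.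
Proof.
apply/edgesP/idP => [[a [b [ab /setP E]]]|xy]; last by exists x, y.
have [] : (a \in [set x; y]) /\ (b \in [set x; y]) by rewrite !E !inE !eqxx orbT.
have := adj_neq ab; rewrite !inE => nab.
move=> /orP[/eqP ea|/eqP ea] /orP[/eqP eb|/eqP eb]; move: nab ab; rewrite ea eb ?eqxx //.
by rewrite adj_sym.
Qed.

Lemma nbrs_edges X x : nbrs edges X x = [set y in X | adj x y].
Proof.
apply/setP => y; rewrite /nbrs in_set mem_edges [RHS]in_set; case: (y \in X) => //=.
by apply: andb_idl => xy; rewrite eq_sym; apply: adj_neq.
Qed.

Variable k : nat.
Hypothesis regG : regular G k.

Lemma inner_outer X x : #|[set y in X | adj x y]| + #|outer X x| = k.
Proof.
rewrite -(regG x) -(cardsID X [set y | adj x y]); congr (_ + _).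
by apply: eq_card => y; rewrite !inE andbC.
Qed.

Lemma ecount_cut X : 2 * ecount edges X + cut X = k * #|X|.
Proof.
rewrite -(handshake X edges_set) /cut -big_split /= mulnC -sum_nat_const.
by apply: eq_bigr => x _; rewrite nbrs_edges inner_outer.
Qed.

Lemma cut_sum X : cut X = \sum_(x in X) \sum_(y in ~: X) adj x y.
Proof.
apply: eq_bigr => x _; rewrite -big_mkcondr sum1dep_card; apply: eq_card => y.
by rewrite !inE.
Qed.

Lemma cutC X : cut (~: X) = cut X.
Proof.
rewrite !cut_sum setCK exchange_big /=; apply: eq_bigr => x _; apply: eq_bigr => y _.
by rewrite adj_sym.
Qed.

Lemma cut_submodular X Y : cut (X :&: Y) + cut (X :|: Y) <= cut X + cut Y.
Proof.
have := ecount_supermodular edges X Y; have := cardsUI X Y.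
have := ecount_cut X; have := ecount_cut Y; have := ecount_cut (X :&: Y).
have := ecount_cut (X :|: Y).
move: (cut _) (cut _) (cut _) (cut _) (ecount _ _) (ecount _ _) (ecount _ _) (ecount _ _).
by clear; nia.
Qed.

Lemma cut_posimodular X Y : cut (X :\: Y) + cut (Y :\: X) <= cut X + cut Y.
Proof.
rewrite -(cutC (Y :\: X)) -(cutC Y) !setDE setCI setCK [~: Y :|: X]setUC.
exact: cut_submodular.
Qed.

Lemma card_aut (s : {perm G}) X : #|s @: X| = #|X|.
Proof. by rewrite card_imset //; apply: perm_inj. Qed.

Lemma outer_aut (s : {perm G}) X x : s \in graph_aut G ->
  #|outer (s @: X) (s x)| = #|outer X x|.
Proof.
move=> /graph_autP sA; rewrite -(card_aut s (outer X x)); apply: eq_card => y.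
rewrite -[y](permKV s) mem_imset; last exact: perm_inj.
by rewrite !inE mem_imset ?sA //; apply: perm_inj.
Qed.

Lemma cut_aut (s : {perm G}) X : s \in graph_aut G -> cut (s @: X) = cut X.
Proof.
move=> sA; rewrite /cut big_imset /=; last by move=> x y _ _; apply: perm_inj.
by apply: eq_bigr => x _; rewrite outer_aut.
Qed.

Definition nontrivial X : bool := (2 <= #|X|) && (#|X| + 2 <= #|G|).

Definition large_cuts : Prop := forall X, nontrivial X -> 3 * k <= 2 * cut X.

Record is_block B : Prop := IsBlock {
  block_ge : k <= #|B|;
  block_lt : 2 * #|B| < 3 * k;
  block_outer : forall x, x \in B -> #|outer B x| = 1;
  block_aut : forall s : {perm G}, s \in graph_aut G -> s @: B :&: B != set0 -> s @: B = B }.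

Hypothesis transG : vertex_transitive G.
Hypothesis connG : connected G.

Lemma aut_move x y : exists2 s : {perm G}, s \in graph_aut G & s x = y.
Proof.
have : y \in orbit 'P (graph_aut G) x by rewrite (atransP transG x (in_setT _)) inE.
by case/imsetP => s sA ->; exists s.
Qed.

Lemma closed_setT X x : x \in X -> (forall y z, y \in X -> adj y z -> z \in X) -> X = setT.
Proof.
move=> xX clX; apply/setP => y; rewrite inE; have [_ /(_ x y)] := connG.
case/connectP => p + ->; elim: p x xX => //= z p IH x xX /andP[xz].
by apply: IH; apply: clX xz.
Qed.

(** Take a nontrivial set of smallest cut and, among those, of fewest vertices. Submodularity makes
    it a block of imprimitivity of the automorphism group, so all its vertices have the same number
    [j] of outer neighbours, and the size of the cut forces [j = 1]. *)
Lemma cuts_or_block : 4 <= k -> large_cuts \/ exists B, is_block B.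
Proof.
move=> k4; have [|/existsNP[X0 /not_implyP[nX0 /negP]]] := pselect large_cuts; first by left.
rewrite -ltnNge => dX0; right.
have [X1 nX1 minX1] := arg_minnP cut nX0.
pose P X := nontrivial X && (cut X == cut X1).
have PX1 : P X1 by rewrite /P nX1 eqxx.
have [X /andP[nX /eqP cX] minX] := arg_minnP (fun X => #|X|) PX1.
have dX : 2 * cut X < 3 * k.
  by rewrite cX; apply: leq_ltn_trans dX0; rewrite leq_mul2l minX1.
have minc Y : nontrivial Y -> cut X <= cut Y by rewrite cX; apply: minX1.
have mins Y : nontrivial Y -> cut Y <= cut X -> #|X| <= #|Y|.
  by move=> nY le; apply: minX; rewrite /P nY eqn_leq -cX le minc.
have /andP[X2 Xn] := nX.
have half : 2 * #|X| <= #|G|.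
  have := mins (~: X); rewrite cutC /nontrivial.
  by have := cardsC X; move: X2 Xn; clear; lia.
have blockX (s : {perm G}) : s \in graph_aut G -> s @: X :&: X != set0 -> s @: X = X.
  move=> sA meet; apply/eqP/negPn/negP => neq; set Y := s @: X.
  have cY : #|Y| = #|X| by apply: card_aut.
  have dY : cut Y = cut X by apply: cut_aut.
  have c0 : 0 < #|X :&: Y| by rewrite card_gt0 setIC.
  have clt : #|X :&: Y| < #|X|.
    rewrite ltn_neqAle subset_leq_card ?subsetIl // andbT; apply: contra neq => /eqP e.
    have /eqP XY : X :&: Y == X by rewrite eqEcard subsetIl e leqnn.
    by rewrite eq_sym eqEcard cY leqnn andbT; apply/setIidPl.
  have cU := cardsUI X Y; rewrite cY in cU.
  (* With two common vertices, the intersection would be a smaller set of minimum cut. With a single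
     one, the two differences play this role, unless [X] has two vertices and its cut is at least
     [2 (k - 1)]. *)
  have [c2|c1] := leqP 2 #|X :&: Y|.
    have nI : nontrivial (X :&: Y) by rewrite /nontrivial c2; clear - clt Xn; lia.
    have nU : nontrivial (X :|: Y).
      by rewrite /nontrivial; clear - cU c2 half X2 clt; lia.
    have := cut_submodular X Y; have := minc _ nU; have := mins _ nI.
    by rewrite dY; clear - clt; lia.
  have c1e : #|X :&: Y| = 1 by clear - c0 c1; lia.
  have cD := cardsID Y X; have cD' := cardsID X Y; rewrite setIC c1e in cD'; rewrite c1e in cD.
  have [X3|X3] := leqP 3 #|X|.
    have nD : nontrivial (X :\: Y) by rewrite /nontrivial; clear - X3 cD half; lia.
    have nD' : nontrivial (Y :\: X) by rewrite /nontrivial; clear - X3 cD' cY half; lia.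
    have := cut_posimodular X Y; have := minc _ nD'; have := mins _ nD.
    by rewrite dY; clear - cD X3; lia.
  have Xe : #|X| = 2 by clear - X3 X2; lia.
  have : \sum_(x in X) k.-1 <= cut X.
    apply: leq_sum => x xX; have := inner_outer X x.
    have : #|[set y in X | adj x y]| <= 1.
      have <- : #|X :\ x| = 1 by have := cardsD1 x X; rewrite xX Xe; clear; lia.
      apply/subset_leq_card/subsetP => y; rewrite !inE => /andP[-> /adj_neq].
      by rewrite eq_sym => ->.
    by clear; lia.
  by rewrite sum_nat_const Xe; clear - dX k4; lia.
have [x xX] : exists x, x \in X by apply/card_gt0P; apply: leq_trans X2.
pose j := #|outer X x|.
have outX y : y \in X -> #|outer X y| = j.
  move=> yX; have [s sA sxy] := aut_move x y.
  have sX : s @: X = X.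
    by apply: blockX => //; apply/set0Pn; exists y; rewrite inE yX andbT -sxy imset_f.
  by rewrite -sxy -{1}sX outer_aut.
have cutj : cut X = #|X| * j.
  by rewrite /cut (eq_bigr (fun=> j)) ?sum_nat_const //; apply: outX.
have j0 : 0 < j.
  rewrite lt0n; apply/negP => /eqP j0.
  have XT : X = setT.
    apply: (@closed_setT X x xX) => y z yX yz; apply/negPn/negP => zX.
    have : 0 < #|outer X y| by apply/card_gt0P; exists z; rewrite !inE zX.
    by rewrite outX // j0.
  by move: Xn; rewrite XT cardsT; clear; lia.
have cardX : k < #|X| + j.
  have := inner_outer X x; rewrite -/j; have := cardsD1 x X; rewrite xX.
  have : #|[set y in X | adj x y]| <= #|X :\ x|.
    apply/subset_leq_card/subsetP => y; rewrite !inE => /andP[-> /adj_neq].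
    by rewrite eq_sym => ->.
  by clear; lia.
have jk : j <= k by rewrite /j; have := inner_outer X x; clear; lia.
have j1 : j = 1.
  rewrite cutj in dX; apply/eqP; rewrite eqn_leq j0 andbT leqNgt; apply/negP => j2.
  have [jk'|jk'] := leqP k j; first by clear - dX X2 jk' k4; nia.
  (* For [2 <= j < k] this product is [j (k + 1 - j) - 2 (k - 1)]. As [|X| >= k + 1 - j], the cut
     would have at least [2 (k - 1) >= 3 k / 2] edges. *)
  have : (j - 2) * (k - 1 - j) >= 0 by [].
  clear - dX cardX j2 jk' k4; nia.
exists X; split=> //.
- by clear - cardX j1; lia.
- by move: dX; rewrite cutj j1 muln1.
- by move=> y /outX ->.
Qed.

End Cuts.

Local Open Scope ring_scope.

(** * The Ramanujan bound *)

Section Harmonic.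
Variables (R : realType) (G : sgraph) (k : nat).
Hypothesis regG : regular G k.
Hypothesis connG : connected G.

Definition adj_sum (g : G -> R) (x : G) : R := \sum_(y | adj x y) g y.

(** Maximum principle: a maximum of [g] spreads to the neighbours, and [G] is connected. *)
Lemma harmonic_constant (g : G -> R) : (forall x, adj_sum g x = k%:R * g x) ->
  forall x y, g x = g y.
Proof.
move=> harm; have [G0 _] := connG; have [x0 _] : exists x0 : G, x0 \in G by apply/card_gt0P.
pose m := [arg max_(x > x0) g x]%O.
have gm x : g x <= g m by rewrite /m; case: arg_maxP => // i _; apply.
have nbr x y : g x = g m -> adj x y -> g y = g m.
  move=> gx xy; have : \sum_(z | adj x z) (g m - g z) = 0.
    rewrite sumrB; have := harm x; rewrite /adj_sum => ->; rewrite sumr_const gx.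
    rewrite (_ : #|_| = k) ?mulr_natl ?subrr // -(regG x).
    by apply: eq_card => z; rewrite !inE.
  move/eqP; rewrite psumr_eq0 => [/allP /(_ y)|z _]; last by rewrite subr_ge0.
  by rewrite mem_index_enum xy /= subr_eq0 => /(_ isT) /eqP.
have all x : x \in [set x | g x == g m].
  rewrite (@closed_setT G connG [set x | g x == g m] m) ?inE // => y z.
  by rewrite !inE => /eqP gy yz; rewrite (nbr y).
by move=> x y; have := all x; have := all y; rewrite !inE => /eqP-> /eqP->.
Qed.

Lemma eigenvalue_adj (g : 'rV[R]_#|G|) (a : R) : g != 0 -> g *m adjmx R G = a *: g ->
  eigenvalue (adjmx R G) a.
Proof. by move=> g0 E; apply/eigenvalueP; exists g. Qed.

Lemma mul_adjmx (g : 'rV[R]_#|G|) x :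
  (g *m adjmx R G) 0 (enum_rank x) = adj_sum (fun y => g 0 (enum_rank y)) x.
Proof.
rewrite mxE /adj_sum (reindex enum_rank) /=; last by apply: onW_bij; apply: enum_rank_bij.
rewrite [RHS]big_mkcond /=; apply: eq_bigr => y _; rewrite mxE !enum_rankK adj_sym.
by case: adj; rewrite ?mulr1 ?mulr0.
Qed.

End Harmonic.

Section Quadratic.
Import complex.
Local Open Scope sesquilinear_scope.

Variables (R : realType) (G : sgraph) (k : nat).
Hypothesis ramG : ramanujan R G k.
Local Notation mu := (2 * Num.sqrt (k%:R - 1) : R).
Local Notation n := #|G|.
Local Notation toC := (real_complex R).

Let A : 'M[R[i]]_n := map_mx toC (adjmx R G).

Fact adjmxC_hermitian : A \is hermsymmx.
Proof.
apply: realsym_hermsym.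
  apply/is_hermitianmxP; rewrite expr0 scale1r map_mx_id //.
  by apply/matrixP => i j; rewrite !mxE adj_sym.
by apply/mxOverP => i j; rewrite !mxE; case: adj; rewrite ?rmorph1 ?rmorph0 ?real1 ?real0.
Qed.

Lemma complex_sum (I : finType) (F : I -> R[i]) :
  (\sum_i F i) = ((\sum_i complex.Re (F i)) +i* (\sum_i complex.Im (F i)))%C.
Proof.
elim/big_rec3: _ => // i a b c _ ->.
by case: (F i) => x y /=.
Qed.

Lemma spectral_row (i : 'I_n) : row i (spectralmx A) *m A =
  spectral_diag A 0 i *: row i (spectralmx A).
Proof.
have /orthomx_spectralP E := hermitian_normalmx adjmxC_hermitian.
rewrite {2}E -row_mul !mulmxA mulmxV ?spectral_unit // mul1mx row_mul.
by apply/rowP => j; rewrite !mxE; under eq_bigr => l _ do rewrite !mxE; rewrite (bigD1 i) //= big1 ?addr0 ?eqxx ?mulr1n // => l li; rewrite [i == l]eq_sym (negPf li) mulr0n mul0r.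
Qed.

(** Real and imaginary parts of a row are eigenvectors of the real matrix, constant for the
    eigenvalue [k]. The bound is one-sided, so the eigenvalue [-k] of bipartite graphs satisfies it
    trivially. *)
Lemma spectral_bound (i : 'I_n) : spectral_diag A 0 i <= toC mu \/
  exists c, forall j, spectralmx A i j = c.
Proof.
have [k3 connG regG bound] := ramG.
have /mxOverP /(_ 0 i) /RRe_real := hermitian_spectral_diag_real adjmxC_hermitian.
set a := complex.Re _ => ai; have := spectral_row i; rewrite -ai.
set r := row i (spectralmx A) => rA.
pose r1 : 'rV[R]_n := map_mx (@complex.Re R) r; pose r2 : 'rV[R]_n := map_mx (@complex.Im R) r.
have [E1 E2] : r1 *m adjmx R G = a *: r1 /\ r2 *m adjmx R G = a *: r2.
  rewrite /r1 /r2; move: r rA {r1 r2} => r rA.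
  split; apply/rowP => j; have := congr1 (fun z : 'rV_n => z 0 j) rA.
    move/(congr1 (@complex.Re R)); rewrite !mxE complex_sum /=.
    case: (r 0 j) => x y /=; rewrite mul0r subr0 => <-; apply: eq_bigr => l _.
    by rewrite !mxE; case: (r 0 l) => x' y' /=; rewrite mulr0 subr0.
  move/(congr1 (@complex.Im R)); rewrite !mxE complex_sum /=.
  case: (r 0 j) => x y /=; rewrite mul0r addr0 => <-; apply: eq_bigr => l _.
  by rewrite !mxE; case: (r 0 l) => x' y' /=; rewrite mulr0 add0r.
have [ak|ak] := eqVneq a k%:R.
  right; have const (g : 'rV[R]_n) : g *m adjmx R G = a *: g -> forall j l, g 0 j = g 0 l.
    move=> gA j l; have harm := @harmonic_constant R G k regG connG (fun y => g 0 (enum_rank y)).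
    have := harm _ (enum_val j) (enum_val l); rewrite !enum_valK; apply => x.
    by rewrite -mul_adjmx gA mxE ak.
  have [n0 _] := connG; exists (spectralmx A i (Ordinal n0)) => j.
  have := const _ E1 j (Ordinal n0); have := const _ E2 j (Ordinal n0).
  rewrite !mxE; case: (spectralmx A i j) => x y; case: (spectralmx A i _) => x' y' /=.
  by move=> -> ->.
left; have eigA : eigenvalue (adjmx R G) a.
  have [r10|/eigenvalue_adj h] := eqVneq r1 0; last exact: h.
  have [r20|/eigenvalue_adj h] := eqVneq r2 0; last exact: h.
  have : row_free (spectralmx A) by rewrite row_free_unit spectral_unit.
  move/row_freeP => [B /(congr1 (row i))]; rewrite row_mul -/r.
  have -> : r = 0.
    apply/rowP => j; have := congr1 (fun z : 'rV_n => z 0 j) r10.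
    have := congr1 (fun z : 'rV_n => z 0 j) r20; rewrite !mxE.
    by case: (spectralmx A i j) => x y /= -> ->.
  rewrite mul0mx => /rowP /(_ i); rewrite !mxE eqxx => /eqP.
  by rewrite eq_sym oner_eq0.
rewrite lecE /= eqxx /=; have [->|am] := eqVneq a (- k%:R).
  by apply: le_trans (_ : 0 <= _); rewrite ?oppr_le0 ?ler0n // mulr_ge0 ?sqrtr_ge0.
by apply: le_trans (ler_norm _) (bound a eigA ak am).
Qed.

(** Rayleigh's principle in the eigenbasis: eigenvectors beyond the bound are constant, hence
    orthogonal to [f]. *)
Lemma ramanujan_quadratic (f : G -> R) : \sum_x f x = 0 ->
  \sum_x f x * adj_sum f x <= mu * \sum_x f x ^+ 2.
Proof.
move=> sum0; pose u : 'rV[R]_n := \row_j f (enum_val j); pose uc : 'rV[R[i]]_n := map_mx toC u.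
have uE x : u 0 (enum_rank x) = f x by rewrite mxE enum_rankK.
have ucT : uc^t* = map_mx toC u^T.
  apply/matrixP => j l; rewrite !mxE; exact: conjc_real.
pose S := spectralmx A; pose d := spectral_diag A.
have US : S \is unitarymx by apply: spectral_unitarymx.
have invS : invmx S = S^t* by apply: invmx_unitary.
have SS : S^t* *m S = 1%:M by rewrite -invS mulVmx ?spectral_unit.
have AE : A = S^t* *m diag_mx d *m S.
  by rewrite -invS; apply/orthomx_spectralP/hermitian_normalmx/adjmxC_hermitian.
pose w := uc *m S^t*.
have wT : w^t* = S *m uc^t* by rewrite /w trmx_mul map_mxM trmxCK.
have quadA : uc *m A *m uc^t* = w *m diag_mx d *m w^t*.
  by rewrite wT /w {1}AE !mulmxA.
have norm1 : uc *m uc^t* = w *m w^t* by rewrite wT /w !mulmxA -(mulmxA _ _ S) SS mulmx1.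
have le_w : (w *m diag_mx d *m w^t*) 0 0 <= toC mu * (w *m w^t*) 0 0.
  rewrite mul_mx_diag !mxE mulr_sumr; apply: ler_sum => i _; rewrite !mxE.
  rewrite mulrAC mulrC; have [le_d|[c Sc]] := spectral_bound i.
    by rewrite ler_wpM2r // mul_conjC_ge0.
  suff -> : \sum_j uc 0 j * (S^t*) j i = 0 by rewrite !mul0r !mulr0.
  under eq_bigr => j _ do rewrite !mxE Sc.
  rewrite -mulr_suml.
  pose ev := @enum_val G G.
  have -> : \sum_j toC (f (ev j)) = toC (\sum_j f (ev j)) by rewrite rmorph_sum.
  rewrite (_ : \sum_j f (ev j) = 0) ?rmorph0 ?mul0r // -[RHS]sum0.
  rewrite [RHS](reindex ev) /=; last by apply: onW_bij; apply: enum_val_bij.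
  by [].
have sumE (h : 'I_n -> R) : \sum_i h i = \sum_(x : G) h (enum_rank x).
  by rewrite (reindex enum_rank) //; apply: onW_bij; apply: enum_rank_bij.
have lhs : (uc *m A *m uc^t*) 0 0 = toC (\sum_x f x * adj_sum f x).
  rewrite ucT -!map_mxM [LHS]mxE mxE sumE; congr toC; apply: eq_bigr => x _.
  rewrite mul_adjmx [X in _ * X]mxE uE mulrC; congr (_ * _).
  by apply: eq_bigr => y _; rewrite uE.
have rhs : (uc *m uc^t*) 0 0 = toC (\sum_x f x ^+ 2).
  rewrite ucT -!map_mxM [LHS]mxE mxE sumE; congr toC; apply: eq_bigr => x _.
  by rewrite [X in _ * X]mxE uE expr2.
have toCM a b : toC (a * b) = toC a * toC b by rewrite rmorphM.
by rewrite -lecR toCM -lhs -rhs quadA norm1.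
Qed.

End Quadratic.

Local Close Scope ring_scope.

(** * Gluing blocks *)

Section RegularOn.
Variable G : sgraph.
Implicit Types (X Y S B : {set G}) (x y v : G).

Lemma sum_outer B X (k : nat) : X \subset B ->
  (forall x, x \in B -> #|[set y in B | adj x y]| = k) ->
  2 * ecount (edges G) X + \sum_(x in X) #|[set y in B :\: X | adj x y]| = k * #|X|.
Proof.
move=> XB reg; rewrite -(handshake X (@edges_set G)) -big_split /= mulnC -sum_nat_const.
apply: eq_bigr => x xX; rewrite nbrs_edges -(reg x (subsetP XB x xX)).
rewrite -(cardsID X [set y in B | adj x y]); congr (_ + _); apply: eq_card => y.
  by rewrite !inE; have [yX|] := boolP (y \in X); rewrite ?andbT ?andbF // (subsetP XB).
by rewrite !inE andbA.
Qed.

Lemma sum_outer_sym X Y : \sum_(x in X) #|[set y in Y | adj x y]| =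
  \sum_(y in Y) #|[set x in X | adj y x]|.
Proof.
transitivity (\sum_(x in X) \sum_(y in Y) adj x y).
  by apply: eq_bigr => x _; rewrite -big_mkcondr sum1dep_card.
rewrite exchange_big /=; apply: eq_bigr => y _.
by rewrite -big_mkcondr sum1dep_card; apply: eq_card => x; rewrite !inE adj_sym.
Qed.

(** Inside the [k]-regular [B] the cut condition becomes the density hypothesis of [dense_tight].
    Deleting [v] leaves [4 |E| = 2 k |S| - 2 k], above the required [2 k |S| - 4 k]. *)
Lemma regular_on_tight B (k : nat) v : v \in B -> 4 <= k ->
  (forall x, x \in B -> #|[set y in B | adj x y]| = k) ->
  (forall X, X \subset B -> 2 <= #|X| -> #|X| + 2 <= #|B| ->
     3 * k <= 2 * \sum_(x in X) #|[set y in B :\: X | adj x y]|) ->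
  exists F : {set {set G}}, [/\ F \subset within (edges G) (B :\ v), sparse F & tight F (B :\ v)].
Proof.
move=> vB k4 reg big; have cS := cardsD1 v B; rewrite vB in cS.
have degv : k <= #|B :\ v|.
  rewrite -(reg v vB); apply/subset_leq_card/subsetP => y; rewrite !inE => /andP[-> /adj_neq].
  by rewrite eq_sym => ->.
have eE X : X \subset B :\ v -> ecount (within (edges G) (B :\ v)) X = ecount (edges G) X.
  move=> XS; apply: eq_card => f; rewrite !inE -andbA; congr (_ && _).
  by apply: andb_idl => fX; apply: subset_trans XS.
apply: (@dense_tight _ _ _ k).
- by move=> f; rewrite inE => /andP[/edges_set].
- by move=> f; rewrite inE => /andP[].
- by clear - degv k4; lia.
- move=> X XpS X2; have XS := proper_sub XpS; rewrite eE //.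
  have XB : X \subset B by apply: subset_trans XS (subsetDl _ _).
  have := proper_card XpS => lt.
  have := big X XB X2; have := sum_outer XB reg.
  by move: lt; rewrite cS; clear; nia.
- have -> : #|within (edges G) (B :\ v)| = ecount (edges G) (B :\ v) by [].
  have := sum_outer (subsetDl B [set v]) reg.
  have -> : B :\: (B :\ v) = [set v].
    by apply/setP => x; rewrite !inE; case: eqP => [->|]; rewrite ?vB ?andbF ?andNb.
  rewrite sum_outer_sym big_set1.
  have : #|[set x in B :\ v | adj v x]| = k.
    rewrite -(reg v vB); apply: eq_card => y; rewrite !inE.
    by case: eqP => // ->; rewrite adj_irr /= andbF.
  by clear - k4; nia.
Qed.

Lemma tight_add_vertex S v a b : v \notin S -> a \in S -> b \in S -> a != b ->
  adj v a -> adj v b ->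
  (exists F : {set {set G}}, [/\ F \subset within (edges G) S, sparse F & tight F S]) ->
  exists F : {set {set G}}, [/\ F \subset within (edges G) (v |: S), sparse F & tight F (v |: S)].
Proof.
move=> vS aS bS ab va vb [F [FE spF tF]].
pose F' := [set [set v; a]; [set v; b]] :|: F.
have eF f : f \in F -> f \in edges G /\ f \subset S by move=> /(subsetP FE); rewrite inE => /andP[].
have F'E : F' \subset within (edges G) (v |: S).
  apply/subsetP => f; rewrite in_setU in_set2 => /orP[/orP[/eqP->|/eqP->]|/eF[fE fS]]; rewrite in_set.
  - by rewrite mem_edges va; apply/subsetP => z; rewrite !inE => /orP[->|/eqP->] //; rewrite aS orbT.
  - by rewrite mem_edges vb; apply/subsetP => z; rewrite !inE => /orP[->|/eqP->] //; rewrite bS orbT.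
  - by rewrite fE; apply: subset_trans fS (subsetUr _ _).
have eF' : edge_set F' by move=> f /(subsetP F'E); rewrite inE => /andP[/edges_set].
have F'F X : v \notin X -> ecount F' X = ecount F X.
  move=> vX; apply: eq_card => f; rewrite in_set [RHS]in_set; have [fX|] := boolP (f \subset X); rewrite ?andbF // !andbT.
  rewrite !inE; have nv c : (f == [set v; c]) = false.
    by apply/eqP => E; case/negP: vX; apply: (subsetP fX); rewrite E !inE eqxx.
  by rewrite !nv.
have nbF' X : #|nbrs F' X v| <= 2.
  have <- : #|[set a; b]| = 2 by rewrite cards2 ab.
  apply/subset_leq_card/subsetP => x; rewrite !inE => /and3P[_ xv /orP[/orP[]|]].
  - by move=> /eqP/setP /(_ x); rewrite !inE eqxx orbT (negPf xv) /= => /esym ->.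
  - by move=> /eqP/setP /(_ x); rewrite !inE eqxx orbT (negPf xv) /= => /esym ->; rewrite orbT.
  - by move=> /eF[_ /subsetP /(_ v)]; rewrite !inE eqxx (negPf vS) => /(_ isT).
have nbv : 2 <= #|nbrs F' (v |: S) v|.
  have {1}<- : #|[set a; b]| = 2 by rewrite cards2 ab.
  apply/subset_leq_card/subsetP => x xab; rewrite in_set.
  have [xS vx] : x \in S /\ [set v; x] \in F'.
    by move: xab; rewrite !inE => /orP[/eqP->|/eqP->]; rewrite ?aS ?bS !eqxx ?orbT.
  by rewrite vx in_setU1 xS orbT andbT /=; apply: contraNneq vS => <-.
have eF0 : edge_set F by move=> f /eF[/edges_set].
have spF' : sparse F'.
  move=> X X2; have [vX|vX] := boolP (v \in X); last by rewrite F'F //; apply: spF.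
  have cX := cardsD1 v X; rewrite vX in cX.
  rewrite (ecount_D1 eF' vX) F'F; last by rewrite !inE eqxx.
  have [X2'|X1] := leqP 2 #|X :\ v|.
    by have := spF _ X2'; have := nbF' X; clear - cX; lia.
  have : #|nbrs F' X v| <= #|X :\ v|.
    by apply/subset_leq_card/subsetP => x; rewrite !inE => /and3P[-> -> _].
  by rewrite (ecount_small eF0) //; clear - cX X1 X2; lia.
exists F'; split=> //; have /andP[S2 /eqP tS] := tF.
have cS : #|v |: S| = #|S|.+1 by rewrite cardsU1 vS.
have S2' : 2 <= #|v |: S| by rewrite cS leqW.
have := spF' _ S2'; rewrite /tight S2' (ecount_D1 eF' (setU11 v S)) setU1K // F'F //.
by move: nbv; clear - tS cS; lia.
Qed.

End RegularOn.

Lemma large_cuts_tight (G : sgraph) (k : nat) (v : G) : regular G k -> 4 <= k ->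
  large_cuts G k ->
  exists F : {set {set G}}, [/\ F \subset within (edges G) (~: [set v]), sparse F & tight F (~: [set v])].
Proof.
move=> regG k4 big; have <- : [set: G] :\ v = ~: [set v] by rewrite setTD.
apply: (regular_on_tight (k := k)) => //.
  by move=> x _; rewrite -(regG x); apply: eq_card => y; rewrite !in_set.
move=> X _ X2 Xn; rewrite cardsT in Xn; have nX : nontrivial X by rewrite /nontrivial X2.
have := big X nX; congr (_ <= 2 * _); apply: eq_bigr => x _.
by apply: eq_card => y; rewrite !inE andbT.
Qed.

Section Blocks.
Variable G : sgraph.
Implicit Types (X Y S B D : {set G}) (x y v : G) (P Q : {set {set G}}).

Record block_partition (m : nat) P (pi : G -> G) : Prop := BlockPartition {
  blocks_part : partition P [set: G];
  blocks_card : forall B, B \in P -> #|B| = m;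
  blocks_out : forall B x, B \in P -> x \in B -> outer B x = [set pi x] }.

Variables (k m : nat) (P : {set {set G}}) (pi : G -> G).
Hypothesis regG : regular G k.
Hypothesis sysP : block_partition m P pi.

Let partP := blocks_part sysP.
Let tP : trivIset P := partition_trivIset partP.

Lemma block_in x : pblock P x \in P.
Proof. by rewrite pblock_mem // (cover_partition partP) inE. Qed.

Lemma mem_block x : x \in pblock P x.
Proof. by rewrite mem_pblock (cover_partition partP) inE. Qed.

Lemma block_eq B x : B \in P -> x \in B -> pblock P x = B.
Proof. exact: def_pblock. Qed.

Lemma adj_pi x : adj x (pi x) /\ pblock P (pi x) != pblock P x.
Proof.
have : pi x \in outer (pblock P x) x by rewrite (blocks_out sysP (block_in x) (mem_block x)) set11.
rewrite !inE => /andP[nx ->]; split=> //.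
by apply: contraNneq nx => <-; apply: mem_block.
Qed.

Lemma pi_unique x y : adj x y -> pblock P y != pblock P x -> y = pi x.
Proof.
move=> xy ne; have : y \in outer (pblock P x) x.
  rewrite !inE xy andbT; apply: contra ne => yB.
  by rewrite (block_eq (block_in x) yB).
by rewrite (blocks_out sysP (block_in x) (mem_block x)) => /set1P.
Qed.

Lemma piK : involutive pi.
Proof.
by move=> x; have [xy ne] := adj_pi x; apply/esym/pi_unique; rewrite 1?adj_sym // eq_sym.
Qed.

Lemma pi_inj : injective pi. Proof. exact: inv_inj piK. Qed.

Lemma inner_degree B x : B \in P -> x \in B -> #|[set y in B | adj x y]| = k.-1.
Proof.
move=> BP xB; have := inner_outer regG B x; rewrite (blocks_out sysP BP xB) cards1.
by clear; lia.
Qed.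

(** A vertex of [X] has [k - 1] neighbours in [B], at most [|X| - 1] of them in [X]. *)
Lemma inner_cut B X : B \in P -> X \subset B ->
  #|X| * (k - #|X|) <= \sum_(x in X) #|[set y in B :\: X | adj x y]|.
Proof.
move=> BP XB; rewrite -sum_nat_const; apply: leq_sum => x xX.
have := inner_degree BP (subsetP XB x xX); have := cardsD1 x X; rewrite xX.
have : #|[set y in B | adj x y]| <= #|X :\ x| + #|[set y in B :\: X | adj x y]|.
  apply: leq_trans (leq_card_setU _ _); apply/subset_leq_card/subsetP => y.
  rewrite !inE => /andP[-> xy]; rewrite xy andbT.
  by case: (y \in X) => //=; rewrite ?orbF ?andbT eq_sym adj_neq.
by clear; lia.
Qed.

Hypothesis k56 : (k == 5) || (k == 6).
Hypothesis km : k <= m.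
Hypothesis mk : 2 * m < 3 * k.

(** Apply [inner_cut] to [X] or to its complement in [B]. As [m <= 7] for [k = 5] and [m <= 8] for
    [k = 6], one of them has 2 or 3 vertices, or 4 when [k = 6]: this gives 6, respectively 8, edges
    against the required [3 (k - 1) / 2]. *)
Lemma inner_cut_large B X : B \in P -> X \subset B -> 2 <= #|X| -> #|X| + 2 <= #|B| ->
  3 * k.-1 <= 2 * \sum_(x in X) #|[set y in B :\: X | adj x y]|.
Proof.
move=> BP XB X2; rewrite (blocks_card sysP BP) => Xm.
have cD : #|B :\: X| + #|X| = m.
  by rewrite -(blocks_card sysP BP) -(cardsID X B) (setIidPr XB) addnC.
have cut1 := inner_cut BP XB; have cut2 := inner_cut BP (subsetDl B X).
rewrite setDDr setDv set0U (setIidPr XB) sum_outer_sym in cut2.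
move: cut1 cut2; move: (\sum_(x in X) _) => c.
move: #|X| #|B :\: X| cD X2 Xm => a b e a2 am c1 c2.
have [k5|k6] := orP k56.
  move/eqP: k5 km mk c1 c2 => -> km' mk'.
  have : (a == 2) || (a == 3) || (b == 2) || (b == 3) by clear - e a2 am km' mk'; lia.
  by case/orP => [/orP[/orP[]|]|] /eqP ->; clear; lia.
move/eqP: k6 km mk c1 c2 => -> km' mk'.
have : (a == 2) || (a == 3) || (a == 4) || (b == 2) || (b == 3) by clear - e a2 am km' mk'; lia.
by case/orP => [/orP[/orP[/orP[]|]|]|] /eqP ->; clear; lia.
Qed.

Lemma block_tight B D : B \in P -> #|D| <= 1 ->
  exists F : {set {set G}}, [/\ F \subset within (edges G) (B :\: D), sparse F & tight F (B :\: D)].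
Proof.
move=> BP D1; have k4 : 4 <= k.-1 by case/orP: k56 => /eqP ->.
have sub w : w \in B -> exists F : {set {set G}},
    [/\ F \subset within (edges G) (B :\ w), sparse F & tight F (B :\ w)].
  move=> wB; apply: (regular_on_tight (k := k.-1)) => //.
    by move=> x; apply: inner_degree.
  by move=> X; apply: inner_cut_large.
have [/pred0P dis|/pred0Pn[v /andP[vB vD]]] := boolP [disjoint B & D]; last first.
  have {}vD : v \in D by [].
  suff -> : D = [set v] by apply: sub.
  by apply/eqP; rewrite eq_sym eqEcard sub1set vD cards1.
have -> : B :\: D = B by apply/setDidPl/pred0P.
have [w wB] : exists w, w \in B.
  by apply/card_gt0P; rewrite (blocks_card sysP BP); clear - km k4; lia.
have dw : 1 < #|[set y in B | adj w y]| by rewrite (inner_degree BP wB); clear - k4; lia.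
have /card_gt1P[a [b []]] := dw; rewrite !inE => /andP[aB wa] /andP[bB wb] ab.
rewrite -(setD1K wB); apply: (@tight_add_vertex _ _ w a b) => //; last exact: sub.
- by rewrite !inE eqxx.
- by rewrite !inE aB eq_sym adj_neq.
- by rewrite !inE bB eq_sym adj_neq.
Qed.

Hypothesis blocks_meet : forall A B, A \in P -> B \in P -> A != B ->
  exists2 x, x \in A & pi x \in B.

(* [c] assigns to each block the part containing it. *)
Lemma part_bound Q (c : {set G} -> {set G}) X : 2 <= #|Q| -> X \in Q ->
  (forall Y, Y \in Q -> exists2 B, B \in P & c B = Y) ->
  let a := #|[set B in P | c B == X]| in
  let d := #|[set x | (c (pblock P x) == X) && (c (pblock P (pi x)) != X)]| in
  (#|P| <= 6 -> 6 <= d + a) /\ (5 <= #|P| -> 6 <= m -> 6 <= d).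
Proof.
move=> Q2 XQ onto a d.
have a1 : 1 <= a.
  by have [B BP cB] := onto X XQ; apply/card_gt0P; exists B; rewrite inE BP cB eqxx.
have aP : a + #|[set B in P | c B != X]| = #|P|.
  rewrite -(cardsID [set B | c B == X] P); congr (_ + _); apply: eq_card => B; rewrite !inE //.
  by rewrite andbC.
set b := #|[set B in P | c B != X]| in aP.
have b1 : 1 <= b.
  have /card_gt1P[Y [Z [YQ ZQ YZ]]] := Q2.
  have [W WQ WX] : exists2 W, W \in Q & W != X.
    have [YX|YX] := eqVneq Y X; last by exists Y.
    by exists Z => //; rewrite -YX eq_sym.
  by have [B BP cB] := onto W WQ; apply/card_gt0P; exists B; rewrite inE BP cB.
have dsum : d = \sum_(B in P | c B == X) #|[set x in B | c (pblock P (pi x)) != X]|.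
  rewrite /d -sum1_card (partition_big (pblock P) (mem [set B in P | c B == X])) /=.
    rewrite (eq_bigl (fun B => (B \in P) && (c B == X))); last by move=> B; rewrite inE.
    apply: eq_bigr => B /andP[BP cB]; rewrite sum1dep_card; apply: eq_card => x.
    rewrite !inE; apply/andP/andP => [[/andP[_ h] /eqP xB]|[xB h]].
      by rewrite h -xB mem_block.
    by rewrite (block_eq BP xB) eqxx cB.
  by move=> x; rewrite !inE block_in => /andP[->].
(* Each of the [a] blocks inside [X] is linked to each of the [b] blocks outside. *)
have dab : a * b <= d.
  rewrite dsum (eq_bigl (fun B => B \in [set B in P | c B == X])); last by move=> B; rewrite inE.
  rewrite -sum_nat_const; apply: leq_sum => A; rewrite inE => /andP[AP cA].
  apply: leq_trans (_ : #|[set pblock P (pi x) | x in [set x in A | c (pblock P (pi x)) != X]]| <= _);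
    last exact: leq_imset_card.
  apply/subset_leq_card/subsetP => B; rewrite inE => /andP[BP cB].
  have AB : A != B by apply: contraNneq cB => <-.
  have [x xA xB] := blocks_meet AP BP AB.
  have eB : pblock P (pi x) = B by apply: block_eq.
  by apply/imsetP; exists x; rewrite ?inE ?xA ?eB.
(* A block that is alone on its side has all its [m] links across. *)
have d_one : a = 1 -> m <= d.
  move=> a1e; have /cards1P[A EA] : a == 1 by rewrite a1e.
  have : A \in [set B in P | c B == X] by rewrite EA set11.
  rewrite inE => /andP[AP cA].
  rewrite -(blocks_card sysP AP); apply/subset_leq_card/subsetP => x xA.
  rewrite inE (block_eq AP xA) cA /=; apply/negP => h.
  have : pblock P (pi x) \in [set B in P | c B == X] by rewrite inE block_in h.
  by rewrite EA inE -(block_eq AP xA); have [_ /negPf ->] := adj_pi x.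
have d_last : b = 1 -> m <= d.
  move=> b1e; have /cards1P[B EB] : b == 1 by rewrite b1e.
  have : B \in [set B in P | c B != X] by rewrite EB set11.
  rewrite inE => /andP[BP cB].
  rewrite -(blocks_card sysP BP) -(card_imset B pi_inj); apply/subset_leq_card/subsetP => _ /imsetP[x xB ->].
  rewrite inE piK (block_eq BP xB) cB andbT; apply/negPn/negP => h.
  have : pblock P (pi x) \in [set B in P | c B != X] by rewrite inE block_in h.
  by rewrite EB inE -(block_eq BP xB); have [_ /negPf ->] := adj_pi x.
have m5 : 5 <= m by move: km; case/orP: k56 => /eqP ->; clear; lia.
clearbody a b d; split=> [t6|t5 m6].
  have [a1e|a2] := eqVneq a 1; first by have := d_one a1e; clear - m5 a1e; lia.
  have [b1e|b2] := eqVneq b 1; first by have := d_last b1e; clear - m5 a1; lia.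
  by clear - a1 a2 b1 b2 dab; nia.
have [a1e|a2] := eqVneq a 1; first by have := d_one a1e; clear - m6; lia.
have [b1e|b2] := eqVneq b 1; first by have := d_last b1e; clear - m6; lia.
by clear - a1 a2 b1 b2 dab aP t5; nia.
Qed.

(** [D] holds the deleted vertex, if any. All but [2 |D|] of the vertices whose partner lies in
    another part are ends of crossing edges. Summing [part_bound] over the parts gives
    [6 |Q| <= 2 |crossing| + 2 |D| + |P|], and for [m >= 6] with at least five blocks the same
    without [|P|]; both imply the condition of [glue_tight]. *)
Lemma glue_blocks D : 0 < #|P| -> #|D| <= 1 -> (#|P| + 2 * #|D| <= 6) || (6 <= m) ->
  exists F : {set {set G}}, [/\ F \subset within (edges G) (~: D), sparse F & tight F (~: D)].
Proof.
move=> P0 D1 small; have m5 : 5 <= m by move: km; case/orP: k56 => /eqP ->; clear; lia.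
have BD B : B \in P -> 2 <= #|B :\: D|.
  move=> BP; have := cardsID D B; rewrite (blocks_card sysP BP).
  by have := subset_leq_card (subsetIr B D); clear - m5 D1; lia.
have [B0 B0P] : exists B, B \in P by apply/card_gt0P.
have [x0 /setDP[x0B x0D]] : exists x, x \in B0 :\: D.
  by apply/card_gt0P; apply: ltnW; apply: BD.
pose P' := [set B :\: D | B in P].
apply: (@glue_tight _ _ _ P').
- by move=> f; rewrite inE => /andP[/edges_set].
- by move=> f; rewrite inE => /andP[].
- by apply/set0Pn; exists x0; rewrite inE.
- apply/and3P; split.
  + apply/eqP/setP => x; rewrite inE; apply/bigcupP/idP => [[_ /imsetP[B BP ->]]|xD].
      by case/setDP.
    exists (pblock P x :\: D); first by apply: imset_f; apply: block_in.
    by rewrite inE xD mem_block.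
  + apply/trivIsetP => _ _ /imsetP[A AP ->] /imsetP[B BP ->] AB.
    rewrite -setI_eq0; apply/set0Pn => -[x]; rewrite !inE => /andP[/andP[_ xA] /andP[_ xB]].
    by case/eqP: AB; rewrite -(block_eq AP xA) -(block_eq BP xB).
  + by apply/imsetP => -[B BP E]; have := BD B BP; rewrite -E cards0.
- by move=> _ /imsetP[B BP ->]; apply: BD.
- move=> _ /imsetP[B BP ->]; have [F [FE spF tF]] := block_tight BP D1.
  exists F; split=> //; apply: subset_trans FE _; apply/subsetP => f.
  rewrite !inE => /andP[-> fB]; apply: subset_trans fB _.
  by apply/subsetP => x; rewrite !inE => /andP[].
- have out B x y : B \in P -> x \in B :\: D -> y \notin B :\: D ->
      [set x; y] \in within (edges G) (~: D) -> y = pi x.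
    move=> BP /setDP[xB _] yB; rewrite inE mem_edges => /andP[xy /subsetP xyD].
    apply: pi_unique => //; rewrite (block_eq BP xB); apply: contra yB => /eqP <-.
    by have := xyD y; rewrite !inE eqxx orbT => /(_ isT) ->; rewrite mem_block.
  by move=> _ x y z /imsetP[B BP ->] xB yB zB xy xz; rewrite (out B x y) // (out B x z).
move=> Q partQ coarse Q2; have tQ := partition_trivIset partQ.
have /boolp.choice[c Hc] : forall B, exists X, B \in P -> X \in Q /\ B :\: D \subset X.
  move=> B; have [BP|_] := boolP (B \in P); last by exists set0.
  by have [X XQ BX] := coarse _ (imset_f _ BP); exists X.
pose cl x := c (pblock P x).
have clQ x : cl x \in Q by have [] := Hc _ (block_in x).
have clE x X : x \notin D -> X \in Q -> x \in X -> cl x = X.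
  move=> xD XQ xX; have [cQ /subsetP sub] := Hc _ (block_in x).
  have xc : x \in cl x by apply: sub; rewrite inE xD mem_block.
  by rewrite -(def_pblock tQ XQ xX) (def_pblock tQ cQ xc).
have onto X : X \in Q -> exists2 B, B \in P & c B = X.
  move=> XQ; have /and3P[/eqP covQ _ nQ] := partQ.
  have /set0Pn[x xX] : X != set0 by apply: contraNneq nQ => <-.
  have xD : x \notin D.
    by have : x \in cover Q by [apply/bigcupP; exists X]; rewrite covQ inE.
  by exists (pblock P x); [apply: block_in|apply: clE].
pose N := [set x | cl (pi x) != cl x].
have sumN : #|N| = \sum_(X in Q) #|[set x | (cl x == X) && (cl (pi x) != X)]|.
  rewrite -sum1_card (partition_big cl (mem Q)) //=; apply: eq_bigr => X XQ.
  rewrite sum1dep_card; apply: eq_card => x; rewrite !inE andbC.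
  by have [->|] := eqVneq (cl x) X.
have sumP : #|P| = \sum_(X in Q) #|[set B in P | c B == X]|.
  rewrite -sum1_card (partition_big c (mem Q)) /=; last by move=> B /Hc[].
  by apply: eq_bigr => X XQ; rewrite sum1dep_card.
pose E' := crossing (within (edges G) (~: D)) Q.
have N_le : #|N| <= 2 * #|E'| + 2 * #|D|.
  have eE' f : f \in E' -> #|f| = 2.
    by rewrite !inE -andbA => /andP[/existsP[x /existsP[y /andP[xy /eqP->]]] _]; rewrite cards2 adj_neq.
  have covE : #|cover E'| <= 2 * #|E'|.
    apply: leq_trans (leq_card_cover _) _; rewrite mulnC -sum_nat_const.
    by apply: leq_sum => f /eE' ->.
  have sub : N \subset cover E' :|: (D :|: pi @: D).
    apply/subsetP => x; rewrite inE => xN; rewrite in_setU.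
    have [xD|xD] := boolP (x \in D); first by rewrite !inE xD orbT.
    have [pxD|pxD] := boolP (pi x \in D).
      by apply/orP; right; rewrite inE; apply/orP; right; rewrite -[x]piK imset_f.
    apply/orP; left; apply/bigcupP; exists [set x; pi x]; last by rewrite !inE eqxx.
    rewrite inE; apply/andP; split.
      rewrite inE mem_edges (proj1 (adj_pi x)) /=; apply/subsetP => y.
      by rewrite !inE => /orP[/eqP->|/eqP->].
    apply/forallP => X; apply/implyP => XQ; apply: contra xN => /subsetP sX.
    by rewrite (clE x X) ?(clE (pi x) X) //; apply: sX; rewrite !inE eqxx ?orbT.
  apply: leq_trans (subset_leq_card sub) _; apply: leq_trans (leq_card_setU _ _) _.
  rewrite leq_add //; apply: leq_trans (leq_card_setU _ _) _.
  by rewrite card_imset ?mul2n ?addnn //; apply: pi_inj.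
have arith p e n d t : n <= 2 * e + 2 * d -> t + 2 * d <= 6 -> p * 6 <= n + t -> 3 * p <= e + 3.
  by lia.
have arith' p e n d : n <= 2 * e + 2 * d -> d <= 1 -> p * 6 <= n -> 3 * p <= e + 3 by lia.
have [t6|] := boolP (#|P| + 2 * #|D| <= 6).
  have tP6 : #|P| <= 6 by apply: leq_trans t6; apply: leq_addr.
  apply: (arith _ _ _ _ _ N_le t6); rewrite sumN sumP -sum_nat_const -big_split.
  by apply: leq_sum => X XQ; have [h _] := part_bound Q2 XQ onto; apply: h.
rewrite -ltnNge => t7; have m6 : 6 <= m by case/orP: small => //; rewrite leqNgt t7.
have t5 : 5 <= #|P| by clear - t7 D1; lia.
apply: (arith' _ _ _ _ N_le D1); rewrite sumN -sum_nat_const.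
by apply: leq_sum => X XQ; have [_ h] := part_bound Q2 XQ onto; apply: h.
Qed.

End Blocks.

(** * Ramanujan graphs with blocks *)

(** The blocks are the images of [B0] under automorphisms, equal or disjoint by [block_aut]. *)
Lemma is_block_partition (G : sgraph) (k : nat) (B0 : {set G}) : connected G ->
  vertex_transitive G -> (0 < k)%N -> is_block k B0 ->
  exists (P : {set {set G}}) (pi : G -> G), block_partition #|B0| P pi.
Proof.
move=> connG transG k0 [kB _ out0 aut0].
have [b bB] : exists b, b \in B0 by apply/card_gt0P; apply: leq_trans kB.
pose P : {set {set G}} := [set (s : {perm G}) @: B0 | s in graph_aut G].
pose pi x := odflt x [pick y in outer (pblock P x) x].
exists P, pi.
have eqB (s t : {perm G}) x : s \in graph_aut G -> t \in graph_aut G ->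
    x \in s @: B0 -> x \in t @: B0 -> s @: B0 = t @: B0.
  move=> sA tA /imsetP[y yB ->] /imsetP[z zB E].
  have stA : (s * t^-1)%g \in graph_aut G by rewrite groupM ?groupV.
  have stB : (s * t^-1)%g @: B0 = B0.
    apply: aut0 => //; apply/set0Pn; exists z; rewrite inE zB andbT.
    by apply/imsetP; exists y; rewrite // permM E permK.
  rewrite -[in RHS]stB -imset_comp; apply: eq_imset => w /=.
  by rewrite permM permKV.
have tP : trivIset P.
  apply/trivIsetP => _ _ /imsetP[s sA ->] /imsetP[t tA ->] ne.
  rewrite -setI_eq0; apply: contraNT ne => /set0Pn[x]; rewrite inE => /andP[xs xt].
  by apply/eqP; apply: (eqB s t x).
have outP B x : B \in P -> x \in B -> #|outer B x| = 1.
  by move=> /imsetP[s sA ->] /imsetP[y yB ->]; rewrite outer_aut // out0.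
split.
- apply/and3P; split=> //.
    apply/eqP/setP => x; rewrite inE; apply/bigcupP.
    have [s sA sx] := aut_move transG b x.
    by exists (s @: B0); [apply: imset_f|rewrite -sx imset_f].
  apply/imsetP => -[s sA /esym/eqP]; rewrite imset_eq0 => /eqP B00.
  by rewrite B00 inE in bB.
- by move=> _ /imsetP[s sA ->]; rewrite card_aut.
- move=> B x BP xB; have /cards1P[y Ey] : #|outer B x| == 1 by rewrite outP.
  rewrite /pi (def_pblock tP BP xB); case: pickP => [z|/(_ y)]; last by rewrite Ey set11.
  by rewrite Ey => /set1P ->.
Qed.

Local Open Scope ring_scope.

Section BlockForm.
Variables (R : realType) (G : sgraph) (k m : nat) (P : {set {set G}}) (pi : G -> G).
Hypothesis regG : regular G k.
Hypothesis k0 : (0 < k)%N.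
Hypothesis sysP : block_partition m P pi.
Implicit Types (f g : G -> R) (x y : G) (A B : {set G}).

Let block := pblock P.

Definition block_constant f : Prop := forall x y, block x = block y -> f x = f y.

Lemma sum_pi f : \sum_x f (pi x) = \sum_x f x.
Proof. by rewrite [RHS](reindex_inj (pi_inj sysP)). Qed.

Lemma sum_adj_split f x : adj_sum f x = \sum_(y in block x | adj x y) f y + f (pi x).
Proof.
rewrite /adj_sum (bigID (mem (block x))) /=; congr (_ + _).
  by apply: eq_bigl => y; rewrite andbC.
rewrite (big_pred1 (pi x)) // => y.
have /setP/(_ y) := blocks_out sysP (block_in sysP x) (mem_block sysP x).
by rewrite !inE andbC.
Qed.

Lemma adj_sum_block f x : block_constant f -> adj_sum f x = k.-1%:R * f x + f (pi x).
Proof.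
move=> cf; rewrite sum_adj_split; congr (_ + _).
rewrite (eq_bigr (fun=> f x)) => [|y /andP[yB _]]; last first.
  by apply: cf; apply: (block_eq sysP (block_in sysP x) yB).
rewrite sumr_const mulr_natl; congr (_ *+ _).
rewrite -(inner_degree regG sysP (block_in sysP x) (mem_block sysP x)).
by apply: eq_card => y; rewrite !inE.
Qed.

Lemma block_quadratic f : ramanujan R G k -> block_constant f -> \sum_x f x = 0 ->
  k.-1%:R * (\sum_x f x ^+ 2) + \sum_x f x * f (pi x) <=
  2 * Num.sqrt (k%:R - 1) * \sum_x f x ^+ 2.
Proof.
move=> ram cf f0; apply: le_trans (ramanujan_quadratic ram f0).
rewrite mulr_sumr -big_split /=; apply: ler_sum => x _.
by rewrite adj_sum_block // mulrDr expr2 mulrCA.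
Qed.

(** The limiting case of [block_quadratic], met for [k = 5]. Here [f] attains the bound, while
    [adj_sum f] has, besides [(k - 1) f], the component [f o pi] orthogonal to [f]. Moving from [f]
    to [f + s (f o pi)] raises the form by [2 s a] at first order, so the bound would fail for small
    [s > 0]. *)
Lemma block_quadratic_eq f : ramanujan R G k -> block_constant f -> \sum_x f x = 0 ->
  k.-1%:R = 2 * Num.sqrt (k%:R - 1) :> R -> \sum_x f x * f (pi x) = 0 ->
  \sum_x f x ^+ 2 = 0.
Proof.
move=> ram cf f0 ek fpi0.
set a := \sum_x f x ^+ 2; pose g x := f (pi x).
have a0 : 0 <= a by apply: sumr_ge0 => x _; apply: sqr_ge0.
pose c := \sum_x g x * adj_sum g x.
have fpi x : pi (pi x) = x by apply: (piK sysP).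
have g2 : \sum_x g x ^+ 2 = a by rewrite /g (sum_pi (fun x => f x ^+ 2)).
have q s : 0 <= k.-1%:R * (s ^+ 2 * a) - 2 * s * a - s ^+ 2 * c.
  have h0 : \sum_x (f x + s * g x) = 0.
    by rewrite big_split /= -mulr_sumr sum_pi f0 mulr0 addr0.
  have := ramanujan_quadratic ram h0; rewrite -ek.
  have -> : \sum_x (f x + s * g x) ^+ 2 = a + s ^+ 2 * a.
    transitivity (\sum_x (f x ^+ 2 + 2 * s * (f x * g x) + s ^+ 2 * g x ^+ 2)).
      by apply: eq_bigr => x _; ring.
    by rewrite !big_split /= -!mulr_sumr fpi0 g2 -/a; ring.
  have adjD h1 h2 x : adj_sum (fun y => h1 y + s * h2 y) x = adj_sum h1 x + s * adj_sum h2 x.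
    by rewrite /adj_sum big_split /= -mulr_sumr.
  have -> : \sum_x (f x + s * g x) * adj_sum (fun y => f y + s * g y) x =
      k.-1%:R * a + 2 * s * a + s ^+ 2 * c.
    have sym : \sum_x f x * adj_sum g x = \sum_x g x * adj_sum f x.
      rewrite /adj_sum; under eq_bigr => x _ do rewrite mulr_sumr big_mkcond.
      rewrite exchange_big /=; apply: eq_bigr => y _.
      rewrite mulr_sumr [RHS]big_mkcond /=; apply: eq_bigr => x _.
      by rewrite adj_sym mulrC.
    have fAf : \sum_x f x * adj_sum f x = k.-1%:R * a.
      transitivity (\sum_x (k.-1%:R * f x ^+ 2 + f x * f (pi x))).
        by apply: eq_bigr => x _; rewrite adj_sum_block //; ring.
      by rewrite big_split /= -mulr_sumr fpi0 addr0.
    have gAf : \sum_x g x * adj_sum f x = a.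
      transitivity (\sum_x (k.-1%:R * (f x * f (pi x)) + g x ^+ 2)).
        by apply: eq_bigr => x _; rewrite adj_sum_block // /g; ring.
      by rewrite big_split /= -mulr_sumr fpi0 mulr0 add0r.
    transitivity (\sum_x (f x * adj_sum f x + s * (f x * adj_sum g x) +
        s * (g x * adj_sum f x) + s ^+ 2 * (g x * adj_sum g x))).
      by apply: eq_bigr => x _; rewrite adjD; ring.
    by rewrite !big_split /= -!mulr_sumr fAf sym gAf -/a -/c; ring.
  by rewrite mulrDr; lra.
apply/eqP; apply/negPn/negP => an0; have ap : 0 < a by rewrite lt_def an0.
pose d := k.-1%:R * a - c.
have qd s : 0 <= s * (s * d - 2 * a).
  have -> : s * (s * d - 2 * a) = k.-1%:R * (s ^+ 2 * a) - 2 * s * a - s ^+ 2 * c.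
    by rewrite /d; ring.
  exact: q.
have [d0|d0] := lerP d 0; first by have := qd 1; lra.
have := qd (a / d); rewrite divfK ?gt_eqF // leNgt => /negP[].
rewrite (_ : a - 2 * a = - a); last by ring.
by rewrite mulrN oppr_lt0 mulr_gt0 ?divr_gt0.
Qed.
End BlockForm.

Lemma sum_mem (R : pzSemiRingType) (T : finType) (A : {set T}) : \sum_x (x \in A)%:R = #|A|%:R :> R.
Proof. by rewrite -natr_sum -sum1_card [in RHS]big_mkcond. Qed.

Section TwoBlocks.
Variables (R : realType) (G : sgraph) (k m : nat) (P : {set {set G}}) (pi : G -> G).
Hypothesis regG : regular G k.
Hypothesis sysP : block_partition m P pi.
Hypothesis ram : ramanujan R G k.
Implicit Types (A B : {set G}).

Definition links A B : nat := #|[set x in A | pi x \in B]|.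

Lemma links_sym A B : links A B = links B A.
Proof.
rewrite /links -(card_imset _ (pi_inj sysP)); apply: eq_card => x; rewrite inE.
apply/imsetP/andP => [[y]|[xB xA]].
  by rewrite inE => /andP[yA yB] ->; rewrite (piK sysP).
by exists (pi x); rewrite ?inE ?(piK sysP) ?xA.
Qed.

Definition indicator_diff A B (x : G) : R := (x \in A)%:R - (x \in B)%:R.

Lemma indicator_diff_forms A B : A \in P -> B \in P -> A != B ->
  [/\ block_constant P (indicator_diff A B), \sum_x indicator_diff A B x = 0,
      \sum_x indicator_diff A B x ^+ 2 = (2 * m)%:R &
      \sum_x indicator_diff A B x * indicator_diff A B (pi x) = - (2 * links A B)%:R].
Proof.
move=> AP BP AB.
have blk C x : C \in P -> (x \in C) = (pblock P x == C).
  move=> CP; apply/idP/eqP => [/(block_eq sysP CP)//|<-]; exact: mem_block sysP x.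
split.
- by move=> x y e; rewrite /indicator_diff !blk // e.
- by rewrite sumrB !sum_mem !(blocks_card sysP) // subrr.
- rewrite mul2n -addnn natrD -{1}(blocks_card sysP AP) -(blocks_card sysP BP) -!sum_mem.
  rewrite -big_split; apply: eq_bigr => x _; rewrite /indicator_diff !blk //=.
  have [->|_] := eqVneq (pblock P x) A; last by rewrite sub0r sqrrN expr2 add0r; case: (_ == _); rewrite ?mulr1 ?mulr0.
  by rewrite (negPf AB) subr0 expr1n addr0.
- rewrite mul2n -addnn natrD {2}links_sym /links -!sum_mem opprD -!sumrN -big_split.
  apply: eq_bigr => x _; rewrite /indicator_diff !inE !blk //=.
  have [_ /eqP ne] := adj_pi sysP x.
  have [ex|nx] := eqVneq (pblock P x) A; have [ey|ny] := eqVneq (pblock P x) B;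
    have [ez|nz] := eqVneq (pblock P (pi x)) A; have [ew|nw] := eqVneq (pblock P (pi x)) B => /=;
    try (by case: ne; congruence); try (by case/eqP: AB; congruence); ring.
Qed.

Lemma pair_bound A B : A \in P -> B \in P -> A != B ->
  (k.-1%:R - 2 * Num.sqrt (k%:R - 1)) * m%:R <= (links A B)%:R :> R.
Proof.
move=> AP BP AB; have [cf f0 f2 fpi] := indicator_diff_forms AP BP AB.
by have := block_quadratic regG sysP ram cf f0; rewrite f2 fpi !natrM; lra.
Qed.

End TwoBlocks.

Section SmallBlocks.
Variables (R : realType) (G : sgraph) (k m : nat) (P : {set {set G}}) (pi : G -> G).
Hypothesis regG : regular G k.
Hypothesis sysP : block_partition m P pi.
Hypothesis ram : ramanujan R G k.
Hypothesis km : (k <= m)%N.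
Hypothesis k5 : (5 <= k)%N.
Implicit Types (A B : {set G}).

Let m0 : (0 < m)%N. Proof. by apply: leq_trans km; apply: leq_trans k5. Qed.

Lemma two_blocks : exists A B, [/\ A \in P, B \in P & A != B].
Proof.
have [_ [G0 _] _ _] := ram; have /card_gt0P[x _] := G0.
exists (pblock P x), (pblock P (pi x)); split; try exact: block_in sysP _.
by have [_] := adj_pi sysP x; rewrite eq_sym.
Qed.

Lemma links_le A B : A \in P -> (links pi A B <= m)%N.
Proof.
by move=> AP; rewrite -(blocks_card sysP AP) subset_leq_card //; apply/subsetP => x; rewrite inE => /andP[].
Qed.

Lemma sqrt_natr (j : nat) : Num.sqrt (j%:R : R) ^+ 2 = j%:R.
Proof. by rewrite sqr_sqrtr ?ler0n. Qed.

(** Two blocks have at most [m] links, so [(k - 1) - 2 sqrt (k - 1) <= 1], that is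
    [k - 1 <= (1 + sqrt 2) ^ 2 < 6]. *)
Lemma degree_le6 : (k <= 6)%N.
Proof.
rewrite leqNgt; apply/negP => k7; have [A [B [AP BP AB]]] := two_blocks.
have := pair_bound regG sysP ram AP BP AB.
have : (links pi A B)%:R <= m%:R :> R by rewrite ler_nat links_le.
have : 0 < m%:R :> R by rewrite ltr0n.
have -> : k%:R - 1 = k.-1%:R :> R by rewrite -[in LHS](ltn_predK k7) -addn1 natrD addrK.
have := sqrt_natr k.-1; have := sqrtr_ge0 (k.-1%:R : R).
have : 6 <= k.-1%:R :> R by rewrite ler_nat; clear - k7; lia.
move: (k.-1%:R) (m%:R) (Num.sqrt _) => y M s y6 s0 ss M0 lM ge.
have : (y - 2 * s) * M <= M by lra.
have -> : y = s ^+ 2 by rewrite ss.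
have s2 : 6 <= s ^+ 2 by rewrite ss.
have sgt : 5 / 2 < s + 1 / 8 by nra.
move=> h; have : (s ^+ 2 - 2 * s - 1) * M <= 0 by lra.
rewrite pmulr_lle0 //; nra.
Qed.

(** The factor in [pair_bound] is positive for [k = 6]; it vanishes for [k = 5], where
    [block_quadratic_eq] takes over. *)
Lemma blocks_linked A B : A \in P -> B \in P -> A != B -> exists2 x, x \in A & pi x \in B.
Proof.
move=> AP BP AB; suff : (0 < links pi A B)%N.
  by case/card_gt0P => x; rewrite inE => /andP[xA xB]; exists x.
rewrite lt0n; apply/negP => /eqP l0.
have := degree_le6; rewrite leq_eqVlt => /predU1P[k6|]; last rewrite ltnS => k5'.
  have := pair_bound regG sysP ram AP BP AB; rewrite l0 k6 /=.
  have : 0 < m%:R :> R by rewrite ltr0n.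
  have -> : 6 - 1 = 5 :> R by ring.
  have := sqrt_natr 5; have := sqrtr_ge0 (5 : R).
  move: (m%:R) (Num.sqrt _) => M s s0 ss M0 h.
  have : s < 9 / 4 by nra.
  by nra.
have ke : k = 5 by apply/eqP; rewrite eqn_leq k5'.
have [cf f0 f2 fpi] := indicator_diff_forms R sysP AP BP AB.
have := @block_quadratic_eq R G k m P pi regG sysP _ ram cf f0.
rewrite fpi l0 muln0 oppr0 f2 => h; have : (2 * m)%:R = 0 :> R.
  apply: h => //; rewrite ke /=; have -> : 5 - 1 = 2 ^+ 2 :> R by ring.
  by rewrite sqrtr_sqr ger0_norm ?ler0n //; ring.
by move/eqP; rewrite pnatr_eq0 muln_eq0 /= eqn0Ngt m0.
Qed.

Lemma blocks_le : (#|P| <= m.+1)%N.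
Proof.
have [A [_ [AP _ _]]] := two_blocks; rewrite (cardsD1 A) AP add1n ltnS.
rewrite -(blocks_card sysP AP); apply: leq_trans (leq_imset_card (fun x => pblock P (pi x)) _).
apply/subset_leq_card/subsetP => B /setD1P[BA BP].
have [|x xA xB] := blocks_linked AP BP; first by rewrite eq_sym.
by apply/imsetP; exists x => //; rewrite (block_eq sysP BP xB).
Qed.

End SmallBlocks.

Local Close Scope ring_scope.

(** * Six blocks of five vertices *)

Section SixBlocks.
Variables (G : sgraph) (P : {set {set G}}) (pi : G -> G).
Hypothesis regG : regular G 5.
Hypothesis sysP : block_partition 5 P pi.
Hypothesis P6 : #|P| = 6.
Hypothesis linked : forall A B, A \in P -> B \in P -> A != B -> exists2 x, x \in A & pi x \in B.

Let blk := pblock P.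

Lemma block_clique A x y : A \in P -> x \in A -> y \in A -> x != y -> adj x y.
Proof.
move=> AP xA yA xy; have deg := inner_degree regG sysP AP xA.
have : [set z in A | adj x z] = A :\ x.
  apply/eqP; rewrite eqEcard deg; apply/andP; split.
    apply/subsetP => z; rewrite !inE => /andP[-> /adj_neq].
    by rewrite eq_sym => ->.
  by have := cardsD1 x A; rewrite xA (blocks_card sysP AP) add1n => -[<-].
by move/setP/(_ y); rewrite !inE yA eq_sym xy.
Qed.

Lemma partner_image A : A \in P -> [set blk (pi x) | x in A] = P :\ A.
Proof.
move=> AP; apply/eqP; rewrite eqEsubset; apply/andP; split.
  apply/subsetP => _ /imsetP[x xA ->]; rewrite !inE (block_in sysP) andbT.
  by have [_] := adj_pi sysP x; rewrite (block_eq sysP AP xA).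
apply/subsetP => B /setD1P[BA BP]; have [|x xA xB] := linked AP BP; first by rewrite eq_sym.
by apply/imsetP; exists x => //; rewrite /blk (block_eq sysP BP xB).
Qed.

Lemma partner_inj A : A \in P -> {in A &, injective (fun x => blk (pi x))}.
Proof.
move=> AP; apply/imset_injP; rewrite partner_image // (blocks_card sysP AP).
by have := cardsD1 A P; rewrite AP P6 add1n => -[<-].
Qed.

Lemma block_pair_inj x y : blk x = blk y -> blk (pi x) = blk (pi y) -> x = y.
Proof.
move=> e; apply: (partner_inj (block_in sysP x)); first exact: mem_block sysP x.
by rewrite -/blk e; apply: mem_block sysP y.
Qed.

Lemma six_blocks_card : #|G| = 30.
Proof.
have := card_uniform_partition (blocks_card sysP) (blocks_part sysP).
by rewrite cardsT P6.
Qed.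

Definition block_index (A : {set G}) : 'I_6 := inord (index A (enum P)).

Lemma block_index_inj : {in P &, injective block_index}.
Proof.
have bound A : A \in P -> index A (enum P) < 6.
  by move=> AP; rewrite -P6 cardE index_mem mem_enum.
move=> A B AP BP /(congr1 (@nat_of_ord _)); rewrite /block_index !inordK ?bound // => e.
by rewrite -(nth_index A (_ : A \in enum P)) ?mem_enum // e nth_index ?mem_enum.
Qed.

Lemma block_index_blk x y : (block_index (blk x) == block_index (blk y)) = (blk x == blk y).
Proof.
apply/eqP/eqP => [|-> //].
by apply: block_index_inj; apply: (block_in sysP).
Qed.

Lemma card_G0 : #|G0| = 30.
Proof.
rewrite card_sig; have := cardC [pred ij : 'I_6 * 'I_6 | ij.1 != ij.2].
rewrite card_prod card_ord.
have -> : #|predC [pred ij : 'I_6 * 'I_6 | ij.1 != ij.2]| = 6.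
  rewrite -[RHS](card_ord 6) -(card_imset (f := fun i : 'I_6 => (i, i)) 'I_6) => [|i j [] //].
  apply: eq_card => -[i j]; rewrite !inE /= negbK; apply/eqP/imsetP => [->|[l _ [-> ->]] //].
  by exists j.
by move=> h; apply/eqP; rewrite -(eqn_add2r 6) h.
Qed.

(** Two blocks have exactly one link, so a vertex is determined by its block and that of its
    partner; these are its coordinates in [G0]. *)
Lemma six_blocks_iso : graph_iso G G0.
Proof.
have ne x : (block_index (blk x), block_index (blk (pi x))).1 !=
    (block_index (blk x), block_index (blk (pi x))).2.
  by rewrite /= block_index_blk eq_sym; have [] := adj_pi sysP x.
pose f (x : G) : G0 := exist (fun ij : 'I_6 * 'I_6 => ij.1 != ij.2) _ (ne x).
have f_inj : injective f.
  move=> x y /(congr1 val) [] /eqP; rewrite block_index_blk => /eqP e1 /eqP.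
  by rewrite block_index_blk => /eqP; apply: block_pair_inj.
exists f; split; first by apply: inj_card_bij => //; rewrite six_blocks_card card_G0.
move=> x y; rewrite /= /G0_adj /= !block_index_blk.
have [e|ne'] := eqVneq (blk y) (blk x) => /=.
  have [e2|ne2] := eqVneq (blk (pi y)) (blk (pi x)).
    rewrite (block_pair_inj e e2) adj_irr /=; apply/negbTE/negP => /andP[/eqP e3 _].
    by have [_ /eqP []] := adj_pi sysP x.
  rewrite /=; apply/esym/(block_clique (block_in sysP x)).
  - exact: mem_block sysP x.
  - by rewrite -/blk -e; apply: mem_block sysP y.
  - by apply: contraNneq ne2 => ->.
apply/andP/idP => [[/eqP e1 /eqP e2]|xy].
  have -> : y = pi x by apply: block_pair_inj; rewrite // (piK sysP).
  by have [] := adj_pi sysP x.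
have -> : y = pi x by apply: (pi_unique sysP xy).
by rewrite (piK sysP).
Qed.

Local Open Scope ring_scope.

(** Since blocks are cliques, the equation at [x] involves only [f x], [f (pi x)] and a block sum.
    Combining it with the one at [pi x] and summing over a block, then over all blocks, gives scalar
    equations: [lam] is 5 or -2 if the total [T] is nonzero, 4 or -1 if [T = 0] but some block sum
    is nonzero, and 0 or -2 otherwise. *)
Lemma six_blocks_eigenvalue (R : realType) (lam : R) (f : G -> R) :
  (exists x, f x != 0) -> (forall x, adj_sum f x = lam * f x) -> lam != 5 -> `|lam| <= 4.
Proof.
move=> [x0 fx0] eig lam5.
pose F (A : {set G}) := \sum_(x in A) f x; pose T := \sum_(A in P) F A.
have eq1 x : (lam + 1) * f x = F (blk x) + f (pi x).
  rewrite mulrDl mul1r -eig (sum_adj_split sysP) /F [in RHS](bigD1 x) /=; last exact: mem_block sysP x.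
  rewrite -/blk (eq_bigl (fun y => (y \in blk x) && (y != x))); first by ring.
  move=> y; apply: andb_id2l => yB; rewrite eq_sym; apply/idP/idP => [/adj_neq //|].
  by apply: block_clique (block_in sysP x) (mem_block sysP x) yB.
have eq2 x : (lam ^+ 2 + 2 * lam) * f x = (lam + 1) * F (blk x) + F (blk (pi x)).
  have := eq1 x; have := eq1 (pi x); rewrite (piK sysP) => h1 h2.
  have -> : (lam ^+ 2 + 2 * lam) * f x = (lam + 1) * ((lam + 1) * f x) - f x by ring.
  by rewrite h2 mulrDr h1; ring.
have eq3 A : A \in P -> (lam - 4) * (lam + 1) * F A = T.
  move=> AP; have sum1 : (lam ^+ 2 + 2 * lam) * F A = 5 * (lam + 1) * F A + (T - F A).
    rewrite {1}/F mulr_sumr (eq_bigr _ (fun x _ => eq2 x)) big_split /=; congr (_ + _).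
      rewrite (eq_bigr (fun=> (lam + 1) * F A)) => [|x xA]; last by rewrite /blk (block_eq sysP AP xA).
      by rewrite sumr_const (blocks_card sysP AP); ring.
    rewrite -(big_imset F (partner_inj AP)) partner_image // /T [in RHS](bigD1 A) //= addrAC subrr add0r.
    by apply: eq_bigl => B; rewrite !inE andbC.
  have : (lam - 4) * (lam + 1) * F A = (lam ^+ 2 + 2 * lam) * F A - 5 * (lam + 1) * F A + F A by ring.
  by rewrite sum1 => ->; ring.
have eq4 : (lam - 4) * (lam + 1) * T = 6 * T.
  by rewrite {1}/T mulr_sumr (eq_bigr (fun=> T)) ?sumr_const ?P6 ?mulr_natl.
have bound : lam = 4 \/ lam = -1 \/ lam = -2 \/ lam = 0 -> `|lam| <= 4.
  by case=> [->|[->|[->|->]]]; rewrite ler_norml; apply/andP; split; lra.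
apply: bound; have [T0|Tn0] := eqVneq T 0; last first.
  have : (lam - 5) * (lam + 2) = 0.
    apply: (mulIf Tn0); rewrite mul0r -[RHS](subrr (6 * T)) -{1}eq4; ring.
  move/eqP; rewrite mulf_eq0 subr_eq0 (negPf lam5) /= addr_eq0 => /eqP ->.
  by right; right; left.
have [[A [AP FA]]|allF] := pselect (exists A, A \in P /\ F A != 0).
  have := eq3 A AP; rewrite T0 => /eqP; rewrite !mulf_eq0 (negPf FA) orbF subr_eq0 addr_eq0.
  by case/orP => /eqP ->; [left|right; left].
have F0 A : A \in P -> F A = 0.
  by move=> AP; apply/eqP/negPn/negP => FA; apply: allF; exists A.
have := eq2 x0; rewrite !F0 ?(block_in sysP) // mulr0 addr0 => /eqP.
rewrite mulf_eq0 (negPf fx0) orbF expr2 -mulrDl mulf_eq0 addr_eq0.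
by case/orP => /eqP ->; right; right; [left|right].
Qed.

End SixBlocks.

Local Close Scope ring_scope.

(** * Structure of G0 *)

Section G0.
Implicit Types (u v : G0) (i j : 'I_6).

Definition home u : 'I_6 := (val u).1.
Definition target u : 'I_6 := (val u).2.

Lemma home_target u : home u != target u. Proof. exact: valP u. Qed.

Definition mkG0 i j (ij : i != j) : G0 :=
  exist (fun ij : 'I_6 * 'I_6 => ij.1 != ij.2) (i, j) ij.

Lemma G0_ext u v : home u = home v -> target u = target v -> u = v.
Proof.
move=> h t; apply: val_inj; rewrite /home /target in h t.
by case: (val u) (val v) h t => [? ?] [? ?] /= -> ->.
Qed.

Lemma adjG0 u v : adj u v = (home v == home u) && (target v != target u) ||
  (home v == target u) && (target v == home u).
Proof. by rewrite /home /target; case: u v => [[i j] ?] [[i' j'] ?]. Qed.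

Definition swap u : G0 := @mkG0 (target u) (home u) (ltac:(rewrite eq_sym; exact: home_target u)).

Lemma home_swap u : home (swap u) = target u. Proof. by []. Qed.
Lemma target_swap u : target (swap u) = home u. Proof. by []. Qed.

Definition cliqueG0 i : {set G0} := [set u | home u == i].
Definition cliquesG0 : {set {set G0}} := [set cliqueG0 i | i : 'I_6].

Lemma card_cliqueG0 i : #|cliqueG0 i| = 5.
Proof.
rewrite -(card_in_imset (f := target)) => [|u v].
  suff -> : [set target u | u in cliqueG0 i] = [set~ i].
    by have := cardsC1 i; rewrite card_ord => ->.
  apply/setP => j; rewrite !inE; apply/imsetP/idP => [[u]|ij].
    by rewrite inE => /eqP <- ->; rewrite eq_sym home_target.
  rewrite eq_sym in ij; exists (mkG0 ij) => //; rewrite inE; exact: eqxx.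
by rewrite !inE => /eqP hu /eqP hv; apply: G0_ext; rewrite hu hv.
Qed.

Lemma outerG0 u : outer (cliqueG0 (home u)) u = [set swap u].
Proof.
apply/setP => v; rewrite !inE adjG0; case: eqP => [e|_] /=.
  apply/esym/negbTE; apply: contraNneq (home_target u) => ev.
  by rewrite -e ev home_swap.
apply/andP/eqP => [[/eqP h /eqP t]|->]; last by rewrite home_swap target_swap !eqxx.
exact: G0_ext.
Qed.

Lemma regularG0 : regular G0 5.
Proof.
move=> u; rewrite -(cardsID (cliqueG0 (home u))) -/(outer _ u) outerG0 cards1.
suff -> : [set v | adj u v] :&: cliqueG0 (home u) = cliqueG0 (home u) :\ u.
  by have := cardsD1 u (cliqueG0 (home u)); rewrite card_cliqueG0 inE eqxx add1n => -[<-].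
apply/setP => v; rewrite !inE adjG0 andbC; case: eqP => [e|_]; last by rewrite andbF.
rewrite andbT /= [X in _ || X](_ : _ = false) ?orbF; last first.
  by apply/negbTE/negP => /andP[/eqP h _]; have := home_target u; rewrite -h e eqxx.
by apply/idP/idP; apply: contra => /eqP h; apply/eqP; [rewrite h|apply: G0_ext].
Qed.

Lemma partitionG0 : block_partition 5 cliquesG0 swap.
Proof.
split.
- apply/and3P; split.
  + apply/eqP/setP => u; rewrite !inE; apply/bigcupP.
    by exists (cliqueG0 (home u)); rewrite ?inE // imset_f.
  + apply/trivIsetP => _ _ /imsetP[i _ ->] /imsetP[j _ ->] ij.
    rewrite -setI_eq0; apply/set0Pn => -[u]; rewrite !inE => /andP[/eqP hi /eqP hj].
    by rewrite -hi hj eqxx in ij.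
  + by apply/imsetP => -[i _ e]; have := card_cliqueG0 i; rewrite -e cards0.
- by move=> _ /imsetP[i _ ->]; apply: card_cliqueG0.
- by move=> _ u /imsetP[i _ ->]; rewrite inE => /eqP <-; apply: outerG0.
Qed.

Lemma linkedG0 (A B : {set G0}) : A \in cliquesG0 -> B \in cliquesG0 -> A != B ->
  exists2 u, u \in A & swap u \in B.
Proof.
move=> /imsetP[i _ ->] /imsetP[j _ ->] ne.
have ij : i != j by apply: contraNneq ne => ->.
by exists (mkG0 ij); rewrite inE ?home_swap.
Qed.

Lemma card_cliquesG0 : #|cliquesG0| = 6.
Proof.
rewrite card_imset ?card_ord // => i j /setP e.
have [u] : exists u, u \in cliqueG0 i by apply/card_gt0P; rewrite card_cliqueG0.
by move=> ui; have := ui; rewrite e; move: ui; rewrite !inE => /eqP -> /eqP.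
Qed.

Lemma connectedG0 : connected G0.
Proof.
have [i [j ij]] : exists i, exists j : 'I_6, i != j by exists ord0, ord_max.
split; first by apply/card_gt0P; exists (mkG0 ij).
have inside u v : home u = home v -> connect (@adj G0) u v.
  move=> h; have [->|ne] := eqVneq u v; first exact: connect0.
  apply: connect1; rewrite adjG0 h eqxx /=; apply/orP; left.
  by apply: contraNneq ne => t; apply/eqP; apply: G0_ext.
move=> u v; have [h|h] := eqVneq (home u) (home v); first exact: inside.
apply: connect_trans (inside u (mkG0 h) erefl) _.
apply: connect_trans (connect1 _) (inside (swap (mkG0 h)) v erefl).
by rewrite adjG0 home_swap target_swap !eqxx orbT.
Qed.

Lemma transitiveG0 : vertex_transitive G0.
Proof.
pose act (s : {perm 'I_6}) u : G0 :=
  @mkG0 (s (home u)) (s (target u)) (ltac:(rewrite (inj_eq perm_inj); exact: home_target u)).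
have act_inj s : injective (act s).
  by move=> u v /(congr1 val) [] /perm_inj h /perm_inj t; apply: G0_ext.
have act_aut s : perm (@act_inj s) \in graph_aut G0.
  apply/graph_autP => u v; rewrite !permE !adjG0 /act /home /target /=.
  by rewrite !(inj_eq perm_inj).
have [i [j ij]] : exists i, exists j : 'I_6, i != j by exists ord0, ord_max.
apply/imsetP; exists (mkG0 ij); first by rewrite inE.
apply/esym/setP => u; rewrite [RHS]inE; apply/imsetP.
(* One transposition sends [i] to [home u]; a second one, fixing [home u], corrects the image of
   [j]. *)
pose s1 := tperm i (home u); pose j1 := s1 j.
have s1i : s1 i = home u by apply: tpermL.
have j1h : home u != j1 by rewrite -s1i (inj_eq perm_inj).
pose s := (s1 * tperm j1 (target u))%g.
exists (perm (@act_inj s)); first exact: act_aut.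
apply: G0_ext; rewrite /= /aperm permE /act /home /target /= /s !permM.
  by rewrite s1i tpermD // eq_sym // home_target.
by rewrite tpermL.
Qed.

End G0.

Local Open Scope ring_scope.

Lemma ramanujanG0 (R : realType) : ramanujan R G0 5.
Proof.
split=> //; [exact: connectedG0|exact: regularG0|].
move=> lam /eigenvalueP[v E v0] lam5 _.
have -> : 2 * Num.sqrt (5 - 1) = 4 :> R.
  have -> : 5 - 1 = 2 ^+ 2 :> R by ring.
  by rewrite sqrtr_sqr ger0_norm ?ler0n //; ring.
apply: (six_blocks_eigenvalue regularG0 partitionG0 card_cliquesG0 linkedG0
  (f := fun x => v 0 (enum_rank x))) lam5.
- apply: contrapT => h; case/eqP: v0; apply/rowP => i; rewrite mxE.
  by apply/eqP/negPn/negP => vi; apply: h; exists (enum_val i); rewrite enum_valK.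
- by move=> x; rewrite -mul_adjmx E mxE.
Qed.

(** * Blocks in degree four *)

Section FourBlocks.
Variables (R : realType) (G : sgraph) (P : {set {set G}}) (pi : G -> G).
Hypothesis regG : regular G 4.
Hypothesis sysP : block_partition 4 P pi.
Hypothesis ram : ramanujan R G 4.
Implicit Types (f g : G -> R) (x y v w c : G).

Let blk := pblock P.
Let s : R := Num.sqrt 3.

Let s_sqr : s ^+ 2 = 3. Proof. by rewrite sqr_sqrtr ?ler0n. Qed.
Let s_gt : 173 / 100 < s.
Proof. by have := sqrtr_ge0 (3 : R); have := s_sqr; rewrite -/s; nra. Qed.

Definition same_block v w : nat := (blk v == blk w).
Local Notation e v w := ((same_block v w)%:R : R).

Definition block_sum f v : R := \sum_w e v w * f w.

Lemma same_block_sym v w : same_block v w = same_block w v.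
Proof. by rewrite /same_block eq_sym. Qed.

Lemma sum_same_block v : \sum_w e v w = 4.
Proof.
rewrite -natr_sum -(blocks_card sysP (block_in sysP v)) -sum1_card [in RHS]big_mkcond /=.
congr (_%:R); apply: eq_bigr => w _; rewrite /same_block /blk.
rewrite (_ : (w \in pblock P v) = (pblock P v == pblock P w)); first by case: eqP.
apply/idP/eqP => [/(block_eq sysP (block_in sysP v)) -> //|->]; exact: mem_block sysP w.
Qed.

Lemma block_sum_constant f v : block_constant P f -> block_sum f v = 4 * f v.
Proof.
move=> cf; rewrite -(sum_same_block v) mulr_suml; apply: eq_bigr => w _.
by rewrite /same_block; case: eqP => [/cf ->|]; rewrite ?mul0r.
Qed.

Lemma block_sum_adjoint f g : \sum_v block_sum f v * g v = \sum_v f v * block_sum g v.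
Proof.
rewrite /block_sum; under eq_bigr => v _ do rewrite mulr_suml.
rewrite exchange_big; apply: eq_bigr => w _; rewrite mulr_sumr; apply: eq_bigr => v _.
by rewrite same_block_sym; ring.
Qed.

Lemma block_sum_is_constant f : block_constant P (block_sum f).
Proof. by move=> v w vw; apply: eq_bigr => x _; rewrite /same_block /blk vw. Qed.

Lemma four_clique x y : blk x = blk y -> x != y -> adj x y.
Proof.
move=> exy xy; have deg := inner_degree regG sysP (block_in sysP x) (mem_block sysP x).
have : [set z in pblock P x | adj x z] = pblock P x :\ x.
  apply/eqP; rewrite eqEcard deg; apply/andP; split.
    apply/subsetP => z; rewrite !inE => /andP[-> /adj_neq].
    by rewrite eq_sym => ->.
  have := cardsD1 x (pblock P x).
  by rewrite (mem_block sysP) (blocks_card sysP (block_in sysP x)) add1n => -[<-].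
move/setP/(_ y); rewrite !inE -/blk exy (mem_block sysP) eq_sym xy.
by [].
Qed.

Lemma adj_sum_four f v : adj_sum f v = block_sum f v - f v + f (pi v).
Proof.
have -> : block_sum f v = \sum_(w in blk v) f w.
  rewrite [RHS]big_mkcond; apply: eq_bigr => w _.
  have -> : (w \in blk v) = (blk v == blk w).
    apply/idP/eqP => [/(block_eq sysP (block_in sysP v)) bw|->]; first by rewrite /blk bw.
    exact: mem_block sysP w.
  by rewrite /same_block; case: eqP; rewrite ?mul1r ?mul0r.
rewrite (sum_adj_split sysP) [in RHS](bigD1 v) /=; last exact: mem_block sysP v.
congr (_ + _); rewrite addrAC subrr add0r.
apply: eq_bigl => w; apply: andb_id2l => wv; rewrite eq_sym.
apply/idP/idP => [/adj_neq //|]; apply: four_clique.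
by rewrite /blk (block_eq sysP (block_in sysP v) wv).
Qed.

(* The block graph [H] satisfies [lambda_2 <= 8 - 4 sqrt 3]: [G] is the line graph of
   the subdivision of [H], so with its incidence matrix [N] one has
   [A + 2 = N^T N <= kappa]; apply [|N u - kappa y|^2 >= 0] to [u = N^T y], where [y]
   is [f] on blocks and [beta (f v + f (pi v))] on the remaining edges. *)
Lemma block_graph_eigenvalue f : block_constant P f -> \sum_v f v = 0 ->
  \sum_v f v * f (pi v) <= (2 - s) * \sum_v f v ^+ 2.
Proof.
(* [kappa] is the Ramanujan bound [2 sqrt 3] plus 2. [beta] equals [1 / (kappa - 2)], for which
   [N N^T y = kappa y] holds at the subdividing vertices. *)
move=> cf f0; pose beta : R := s / 6; pose kappa : R := 2 + 2 * s.
pose t v := f v + f (pi v); pose u v := f v + beta * t v.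
have piI := piK sysP.
set a := \sum_v f v ^+ 2; set b := \sum_v _.
have t0 : \sum_v t v = 0 by rewrite big_split /= (sum_pi sysP f) f0 addr0.
have u0 : \sum_v u v = 0 by rewrite big_split /= -mulr_sumr t0 f0 mulr0 addr0.
have := ramanujan_quadratic ram u0; have -> : 4 - 1 = 3 :> R by ring.
rewrite -/s; set uu := \sum_v u v ^+ 2; set uAu := \sum_v _ => hq.
have swap (g h : G -> R) : \sum_v g (pi v) * h (pi v) = \sum_v g v * h v.
  exact: (sum_pi sysP (fun v => g v * h v)).
have swap2 (g : G -> R) : \sum_v g (pi v) ^+ 2 = \sum_v g v ^+ 2.
  exact: (sum_pi sysP (fun v => g v ^+ 2)).
have tt : \sum_v t v ^+ 2 = 2 * (a + b).
  transitivity (\sum_v (f v ^+ 2 + 2 * (f v * f (pi v)) + f (pi v) ^+ 2)).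
    by apply: eq_bigr => v _; rewrite /t; ring.
  by rewrite !big_split /= -mulr_sumr swap2 -/a -/b; ring.
have ft : \sum_v f v * t v = a + b.
  transitivity (\sum_v (f v ^+ 2 + f v * f (pi v))); last by rewrite big_split.
  by apply: eq_bigr => v _; rewrite /t; ring.
have uuE : uu = a + 2 * beta * (a + b) + beta ^+ 2 * (2 * (a + b)).
  rewrite -tt -ft; transitivity (\sum_v (f v ^+ 2 + 2 * beta * (f v * t v) + beta ^+ 2 * t v ^+ 2)).
    by apply: eq_bigr => v _; rewrite /u; ring.
  by rewrite !big_split /= -!mulr_sumr -/a.
pose up := \sum_v u v * u (pi v); pose uU := \sum_v u v * block_sum u v.
have uAuE : uAu = uU - uu + up.
  rewrite /uAu /uU /uu /up -sumrB -big_split /=; apply: eq_bigr => v _.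
  by rewrite adj_sum_four; ring.
pose uf := \sum_v u v * f v; pose ut := \sum_v u v * t v.
have uuE2 : uu = uf + beta * ut.
  rewrite /uu /uf /ut mulr_sumr -big_split /=; apply: eq_bigr => v _.
  by rewrite /u; ring.
have UU : \sum_v block_sum u v ^+ 2 = 4 * uU.
  rewrite /uU mulr_sumr; transitivity (\sum_v block_sum u v * block_sum u v) => //.
  rewrite block_sum_adjoint; apply: eq_bigr => v _.
  by rewrite (block_sum_constant _ (@block_sum_is_constant u)); ring.
have Uf : \sum_v block_sum u v * f v = 4 * uf.
  rewrite block_sum_adjoint /uf mulr_sumr; apply: eq_bigr => v _.
  by rewrite block_sum_constant //; ring.
have sq1 : 0 <= 4 * uU - 2 * kappa * (4 * uf) + kappa ^+ 2 * a.
  rewrite -UU -Uf /a !mulr_sumr -sumrB -big_split /=; apply: sumr_ge0 => v _.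
  by rewrite (_ : _ + _ = (block_sum u v - kappa * f v) ^+ 2) ?sqr_ge0 //; ring.
have upi : \sum_v u (pi v) ^+ 2 = uu by apply: swap2.
have tpi v : t (pi v) = t v by rewrite /t piI addrC.
have sq2 : 0 <= 2 * uu + 2 * up - 4 * kappa * beta * ut + kappa ^+ 2 * beta ^+ 2 * (2 * (a + b)).
  have : 0 <= \sum_v (u v + u (pi v) - kappa * beta * t v) ^+ 2.
    by apply: sumr_ge0 => v _; apply: sqr_ge0.
  have -> : \sum_v (u v + u (pi v) - kappa * beta * t v) ^+ 2 =
      \sum_v (u v ^+ 2 + u (pi v) ^+ 2 + 2 * (u v * u (pi v)) - 2 * kappa * beta * (u v * t v)
       - 2 * kappa * beta * (u (pi v) * t (pi v)) + kappa ^+ 2 * beta ^+ 2 * t v ^+ 2).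
    by apply: eq_bigr => v _; rewrite tpi; ring.
  rewrite !big_split /= !sumrN -!mulr_sumr upi swap tt -/uu -/up -/ut => h.
  by apply: le_trans h _; rewrite le_eqVlt; apply/orP; left; apply/eqP; ring.
(* [a / 4 + beta ^+ 2 * (a + b)] is [|y| ^ 2]: sums over [G] count each block four times and each
   edge between blocks twice. *)
have main : uu <= kappa * (a / 4 + beta ^+ 2 * (a + b)).
  have k0 : 0 < kappa by rewrite /kappa; have := s_gt; lra.
  have hk : uAu + 2 * uu <= kappa * uu by rewrite /kappa mulrDl; lra.
  rewrite -(ler_pM2l k0).
  have : 0 <= uAu + 2 * uu - 2 * kappa * uu + kappa * (kappa * (a / 4 + beta ^+ 2 * (a + b))).
    rewrite uAuE {3}uuE2.
    have -> : uU - uu + up + 2 * uu - 2 * kappa * (uf + beta * ut) +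
        kappa * (kappa * (a / 4 + beta ^+ 2 * (a + b))) =
      (4 * uU - 2 * kappa * (4 * uf) + kappa ^+ 2 * a) / 4 +
      (2 * uu + 2 * up - 4 * kappa * beta * ut + kappa ^+ 2 * beta ^+ 2 * (2 * (a + b))) / 2.
      by field.
    by apply: addr_ge0; apply: divr_ge0 => //; rewrite ler0n.
  by move: hk; lra.
have s0 : 0 < s by have := s_gt; lra.
have beta2 : beta ^+ 2 = 1 / 12 by rewrite /beta exprMn s_sqr; field.
move: main; rewrite uuE beta2 /kappa /beta => main.
have : 0 <= s * (2 * (s * a) - s * b - 3 * a) by apply: mulr_ge0; lra.
have -> : s * (2 * (s * a) - s * b - 3 * a) = s ^+ 2 * (2 * a - b) - 3 * (s * a) by ring.
by rewrite s_sqr mulrBl; lra.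
Qed.

(** The entries of the block graph [H], indexed by vertices instead of blocks so that all sums run
    over [G]. *)
Definition link_count v c : nat := \sum_w same_block v w * same_block (pi w) c.
Local Notation lc v c := ((link_count v c)%:R : R).

Lemma link_countE v c : lc v c = block_sum (fun w => e (pi w) c) v.
Proof. by rewrite /link_count natr_sum; apply: eq_bigr => w _; rewrite natrM. Qed.

Lemma link_count_block v c : (link_count v c * same_block v c = 0)%N.
Proof.
rewrite /link_count big_distrl big1 // => w _ /=; rewrite /same_block.
have [_ /eqP ne] := adj_pi sysP w.
by case: eqP => [vw|//]; case: eqP => [pc|//]; case: eqP => [vc|//]; case: ne; rewrite -/blk; congruence.
Qed.

Lemma link_count_le_sqr v c : (link_count v c <= link_count v c ^ 2)%N.
Proof. by rewrite expnS expn1; case: (link_count v c) => // l; rewrite leq_pmulr. Qed.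

Lemma sum_same_block_r c : \sum_v e v c = 4.
Proof. by rewrite -(sum_same_block c); apply: eq_bigr => v _; rewrite same_block_sym. Qed.

Lemma sum_link_count c : \sum_v lc v c = 16.
Proof.
have one : \sum_v block_sum (fun w => e (pi w) c) v * 1 = \sum_v e (pi v) c * block_sum (fun=> 1) v.
  exact: block_sum_adjoint.
transitivity (\sum_v block_sum (fun w => e (pi w) c) v * 1).
  by apply: eq_bigr => v _; rewrite link_countE mulr1.
rewrite one (eq_bigr (fun v => 4 * e (pi v) c)) => [|v _]; last first.
  by rewrite block_sum_constant // mulr1 mulrC.
by rewrite -mulr_sumr (sum_pi sysP (fun v => e v c)) sum_same_block_r; ring.
Qed.

Lemma link_count_constant c : block_constant P (fun v => lc v c).
Proof. by move=> v w vw; rewrite !link_countE; apply: block_sum_is_constant. Qed.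

Lemma same_block_constant c : block_constant P (fun v => e v c).
Proof. by move=> v w vw; rewrite /same_block /blk vw. Qed.

Lemma sum_link_count_sqr c : \sum_v lc v c ^+ 2 = 4 * \sum_v lc v c * e (pi v) c.
Proof.
transitivity (\sum_v block_sum (fun w => e (pi w) c) v * lc v c).
  by apply: eq_bigr => v _; rewrite -link_countE expr2.
rewrite block_sum_adjoint mulr_sumr; apply: eq_bigr => v _.
by rewrite (block_sum_constant _ (link_count_constant c)); ring.
Qed.

(* Sum [block_graph_eigenvalue] over the columns of [H + 5/2]. *)
Lemma four_blocks_bound : (#|G| < 56)%N.
Proof.
rewrite ltnNge; apply/negP => n56; set n : R := #|G|%:R.
have n56' : 56 <= n by rewrite ler_nat.
(* [g c] is the column of [H + 5/2] at the block of [c]. The shift [5 / 2] brings the bound below 14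
   blocks, which the shifts 2 and 3 do not. *)
pose g c v := lc v c + 5 / 2 * e v c.
have sum_g c : \sum_v g c v = 26.
  by rewrite big_split /= -mulr_sumr sum_link_count sum_same_block_r; field.
pose q c := \sum_v g c v ^+ 2; pose r c := \sum_v g c v * g c (pi v).
have n0 : n != 0 by apply: lt0r_neq0; lra.
have sum_const (z : R) : \sum_(v : G) z = n * z by rewrite sumr_const mulr_natl.
(* Subtracting the mean [26 / n] makes the column orthogonal to constants; [676 = 26 ^ 2]. *)
have ineq c : r c <= (2 - s) * q c + (s - 1) * (676 / n).
  pose f v := g c v - 26 / n.
  have f0 : \sum_v f v = 0 by rewrite sumrB sum_g sum_const; field.
  have cf : block_constant P f.
    move=> v w vw; rewrite /f /g (link_count_constant c vw).
    by rewrite (same_block_constant c vw).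
  have := block_graph_eigenvalue cf f0.
  have -> : \sum_v f v * f (pi v) = r c - 676 / n.
    transitivity (\sum_v (g c v * g c (pi v) - 26 / n * g c v - 26 / n * g c (pi v) + (26 / n) ^+ 2)).
      by apply: eq_bigr => v _; rewrite /f; ring.
    rewrite !big_split /= !sumrN -!mulr_sumr (sum_pi sysP (g c)) sum_g sum_const -/(r c).
    by field.
  have -> : \sum_v f v ^+ 2 = q c - 676 / n.
    transitivity (\sum_v (g c v ^+ 2 - 2 * (26 / n) * g c v + (26 / n) ^+ 2)).
      by apply: eq_bigr => v _; rewrite /f; ring.
    rewrite !big_split /= !sumrN -!mulr_sumr sum_g sum_const -/(q c).
    by field.
  by rewrite mulrBr; lra.
pose s2 := \sum_c \sum_v lc v c ^+ 2.
have sum_q : \sum_c q c = s2 + 25 * n.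
  rewrite -[25 * n]mulrC -sum_const /s2 -big_split /=; apply: eq_bigr => c _.
  transitivity (\sum_v (lc v c ^+ 2 + 25 / 4 * e v c)).
    apply: eq_bigr => v _; rewrite /g.
    have cross : lc v c * e v c = 0 by rewrite -natrM link_count_block.
    have ee : e v c * e v c = e v c by rewrite /same_block; case: eqP => _; rewrite ?mulr1 ?mulr0.
    have -> : (lc v c + 5 / 2 * e v c) ^+ 2 = lc v c ^+ 2 + 5 * (lc v c * e v c) + 25 / 4 * (e v c * e v c).
      by field.
    by rewrite cross ee mulr0 addr0.
  by rewrite big_split /= -mulr_sumr sum_same_block_r; field.
(* In the trace of [(H + 5/2)^2 H] only the term quadratic in [H] is kept; the others are
   nonnegative. *)
have sum_r : 5 / 4 * s2 <= \sum_c r c.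
  rewrite /s2 mulr_sumr; apply: ler_sum => c _.
  have swap : \sum_v e v c * lc (pi v) c = \sum_v lc v c * e (pi v) c.
    rewrite -(sum_pi sysP); apply: eq_bigr => v _; rewrite (piK sysP); exact: mulrC.
  apply: le_trans (_ : \sum_v (5 / 2 * (lc v c * e (pi v) c) + 5 / 2 * (e v c * lc (pi v) c)) <= _).
    rewrite big_split /= -!mulr_sumr swap sum_link_count_sqr.
    by rewrite le_eqVlt; apply/orP; left; apply/eqP; field.
  apply: ler_sum => v _; rewrite /g.
  have h1 : 0 <= lc v c * lc (pi v) c by rewrite mulr_ge0 ?ler0n.
  have h2 : 0 <= e v c * e (pi v) c by rewrite mulr_ge0 ?ler0n.
  by nra.
(* Link counts are natural numbers, so each is at most its square. *)
have s2_ge : 16 * n <= s2.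
  rewrite mulrC -sum_const /s2; apply: ler_sum => c _; rewrite -(sum_link_count c).
  by apply: ler_sum => v _; rewrite -natrX ler_nat link_count_le_sqr.
have total : \sum_c r c <= (2 - s) * (s2 + 25 * n) + (s - 1) * 676.
  have -> : (s - 1) * 676 = \sum_(c : G) (s - 1) * (676 / n) by rewrite sum_const; field.
  by rewrite -sum_q mulr_sumr -big_split; apply: ler_sum => c _; apply: ineq.
have sg := s_gt; have s2' : s <= 2 by have := s_sqr; nra.
have h1 : (s - 3 / 4) * (16 * n) <= (s - 3 / 4) * s2 by rewrite ler_pM2l //; lra.
have h2 : (s - 3 / 4) * s2 <= (2 - s) * (25 * n) + (s - 1) * 676.
  by move: total sum_r; rewrite mulrDr; lra.
have h3 : (s - 3 / 4) * (16 * n) - (2 - s) * (25 * n) = (41 * s - 62) * n by field.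
have h4 : (41 * s - 62) * 56 <= (41 * s - 62) * n by rewrite ler_pM2l //; lra.
by lra.
Qed.

(** The number of vertices is a multiple of 4, so below 56 it is at most 52. *)
Lemma four_blocks_small : (#|G| < 53)%N.
Proof.
have := four_blocks_bound.
have := card_uniform_partition (blocks_card sysP) (blocks_part sysP).
by rewrite cardsT; lia.
Qed.

End FourBlocks.

(** * Partial isomorphisms of subrings of the reals *)

Section PartialIso.
Variable R : realType.
Implicit Types (S : R * R -> Prop) (A : R -> Prop) (z : R).

Definition proj1R (t : R * R) : R := t.1.
Definition proj2R (t : R * R) : R := t.2.

Fact proj1R_zmod : zmod_morphism proj1R. Proof. by []. Qed.
Fact proj1R_monoid : monoid_morphism proj1R. Proof. by []. Qed.
HB.instance Definition _ := GRing.isZmodMorphism.Build (R * R)%type R proj1R proj1R_zmod.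
HB.instance Definition _ := GRing.isMonoidMorphism.Build (R * R)%type R proj1R proj1R_monoid.
Fact proj2R_zmod : zmod_morphism proj2R. Proof. by []. Qed.
Fact proj2R_monoid : monoid_morphism proj2R. Proof. by []. Qed.
HB.instance Definition _ := GRing.isZmodMorphism.Build (R * R)%type R proj2R proj2R_zmod.
HB.instance Definition _ := GRing.isMonoidMorphism.Build (R * R)%type R proj2R proj2R_monoid.

(* The graph of an isomorphism between two subrings of R. *)
Definition partial_iso S : Prop :=
  is_subring S /\ forall t, S t -> (t.1 = 0 <-> t.2 = 0).

Definition domain S z : Prop := exists z', S (z, z').
Definition diagonal A (t : R * R) : Prop := A t.1 /\ t.2 = t.1.

Lemma partial_iso_ker1 S : partial_iso S -> forall t, S t -> proj1R t = 0 -> t = 0.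
Proof. by case=> _ h [a b] /h /= ab; rewrite /proj1R /= => a0; rewrite (proj1 ab a0) a0. Qed.

Lemma partial_iso_ker2 S : partial_iso S -> forall t, S t -> proj2R t = 0 -> t = 0.
Proof. by case=> _ h [a b] /h /= ab; rewrite /proj2R /= => b0; rewrite (proj2 ab b0) b0. Qed.

Lemma partial_iso_intro S : is_subring S -> (forall t, S t -> proj1R t = 0 -> t = 0) ->
  (forall t, S t -> proj2R t = 0 -> t = 0) -> partial_iso S.
Proof.
move=> ringS h1 h2; split=> // t St; split=> t0.
  by rewrite (h1 t St t0).
by rewrite (h2 t St t0).
Qed.

Lemma partial_iso_regular S : partial_iso S -> forall c t, S c -> c != 0 -> c * t = 0 -> t = 0.
Proof.
move=> isoS c t Sc c0 E.
have c1 : c.1 != 0 by apply: contra c0 => /eqP /(partial_iso_ker1 isoS Sc) ->.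
have c2 : c.2 != 0 by apply: contra c0 => /eqP /(partial_iso_ker2 isoS Sc) ->.
have := congr1 fst E; have := congr1 snd E; case: t {E} => a b /= /eqP + /eqP.
by rewrite !mulf_eq0 (negPf c1) (negPf c2) /= => /eqP -> /eqP ->.
Qed.

Lemma diagonal_iso A : is_subring A -> partial_iso (diagonal A).
Proof.
move=> ringA; split; first split.
- by split=> //; apply: subring1.
- by move=> a b [Aa ea] [Ab eb]; split; rewrite /= ?ea ?eb //; apply: subringB.
- by move=> a b [Aa ea] [Ab eb]; split; rewrite /= ?ea ?eb //; apply: subringM.
- by move=> t [_ ->].
Qed.

Lemma domain_adjoin S z z' : is_subring S -> forall a,
  domain (adjoin S (z, z')) a <-> adjoin (domain S) z a.
Proof.
move=> ringS a; split=> [[b [P SP E]]|[P SP ->]].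
  exists (map_poly proj1R P); last by rewrite -[z]/(proj1R (z, z')) horner_map -E.
  by move=> i; rewrite coef_map; exists (proj2R P`_i); rewrite -surjective_pairing; apply: SP.
have /choice[b Hb] := SP.
pose Q : {poly R * R} := \poly_(i < size P) (P`_i, b i).
exists (map_poly proj2R Q).[z']; exists Q.
  by move=> i; rewrite coef_poly; case: ifP => _; [apply: Hb|apply: subring0].
have -> : P = map_poly proj1R Q.
  apply/polyP => i; rewrite coef_map coef_poly; case: ltnP => // le.
  by rewrite nth_default.
by rewrite -[z in LHS]/(proj1R (z, z')) -[z' in LHS]/(proj2R (z, z')) !horner_map -surjective_pairing.
Qed.

(** On the other side [z'] has its own minimal polynomial [q], with [c p = q s]. If [q] did not
    vanish at [z], then [s] would; having smaller degree than [p], it would be 0. So [q] vanishes at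
    [(z, z')], and both projections are injective on the extension. *)
Lemma iso_extend S z z' p : partial_iso S -> minimal_at proj1R S z p ->
  (map_poly proj2R p).[z'] = 0 -> partial_iso (adjoin S (z, z')).
Proof.
move=> isoS minp pz'; have [ringS _] := isoS.
have ker1 := partial_iso_ker1 isoS; have ker2 := partial_iso_ker2 isoS.
have reg := partial_iso_regular isoS.
have nz1 c : proj1R c != 0 -> c != 0 by apply: contraNneq => ->.
have nz2 c : proj2R c != 0 -> c != 0 by apply: contraNneq => ->.
have [Sp p0 pz min1] := minp.
have val0 (q : {poly R * R}) : (map_poly proj1R q).[z] = 0 -> (map_poly proj2R q).[z'] = 0 ->
    q.[(z, z')] = 0.
  move=> q1 q2; have h1 : proj1R q.[(z, z')] = 0 by rewrite -horner_map.
  have h2 : proj2R q.[(z, z')] = 0 by rewrite -horner_map.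
  by case: (q.[_]) h1 h2 => a b; rewrite /proj1R /proj2R /= => -> ->.
apply: partial_iso_intro; first exact: adjoin_subring.
  apply: (@kernel_algebraic _ _ proj1R _ ringS ker1 z p) => //; last exact: val0.
  by move=> c t Sc /nz1; apply: reg.
have [|q minq] := @minimal_exists _ _ proj2R S z'; first by exists p.
have [Sq q0 qz' min2] := minq.
apply: (@kernel_algebraic _ _ proj2R _ ringS ker2 z' q) => //.
  by move=> c t Sc /nz2; apply: reg.
apply: val0 => //.
have [c [s [Sc c0 Ss E]]] := minimal_dvd ringS ker2 minq Sp pz'.
have E1 := congr1 (map_poly proj1R) E; rewrite !rmorphM /= map_polyC /= in E1.
have := congr1 (horner^~ z) E1; rewrite !hornerM pz mulr0 => /esym/eqP.
rewrite mulf_eq0 => /orP[/eqP //|/eqP sz]; exfalso.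
have c1 : proj1R c != 0.
  by apply: contra c0 => /eqP /(ker1 c Sc) ->.
have sizeE : (size p + 1 = size q + size s)%N.
  have p1 : map_poly proj1R p != 0 by apply: contra p0 => /eqP /(map_poly_inj0 ker1 Sp) ->.
  have q1 : map_poly proj1R q != 0 by apply: contra q0 => /eqP /(map_poly_inj0 ker1 Sq) ->.
  have s1 : map_poly proj1R s != 0.
    apply: contraNneq p1 => s1; have /eqP := E1.
    by rewrite s1 mulr0 mulf_eq0 polyC_eq0 (negPf c1).
  have := congr1 (fun P : {poly R} => size P) E1.
  rewrite size_Cmul // size_mul // !(size_map_coefs ker1) // => ->.
  rewrite addn1 prednK //; apply: ltn_addr; by rewrite size_poly_gt0.
have q2 : (1 < size q)%N.
  rewrite ltnNge; apply/negP => /size1_polyC qC.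
  move: q0 qz'; rewrite qC map_polyC hornerC polyC_eq0 => q0 /(ker2 _ (Sq 0%N)) e.
  by rewrite e eqxx in q0.
have s0 : s = 0 by apply: min1 => //; move: sizeE q2; clear; lia.
move: sizeE; rewrite s0 size_poly0 addn0 => sizeE.
have : (size p < size q)%N by rewrite -sizeE addn1.
move=> lt; case/negP: p0; apply/eqP; exact: min2.
Qed.

Lemma lift_poly S (p : {poly R}) : is_subring S -> coefs_in (domain S) p ->
  exists P : {poly R * R}, [/\ coefs_in S P, map_poly proj1R P = p & size P = size p].
Proof.
move=> ringS /choice[b Hb]; exists (\poly_(i < size p) (p`_i, b i)); split.
- by move=> i; rewrite coef_poly; case: ifP => _; [apply: Hb|apply: subring0].
- by apply/polyP => i; rewrite coef_map coef_poly; case: ltnP => // le; rewrite nth_default.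
- have [->|p0] := eqVneq p 0; first by rewrite size_poly0 poly_def big_ord0 size_poly0.
  rewrite size_poly_eq //; apply: contra p0 => /eqP /(congr1 fst) /= /eqP.
  by rewrite -lead_coefE lead_coef_eq0.
Qed.

Lemma domain_diagonal A z : domain (diagonal A) z <-> A z.
Proof. by split=> [[z' []]|Az]; [|exists z]. Qed.

(** Minimality depends only on the domain, so a polynomial found over the identity of [A] serves
    every isomorphism defined on [A]. *)
Lemma minimal_lift A S z p : is_subring A -> partial_iso S -> (forall a, domain S a <-> A a) ->
  minimal_at proj1R (diagonal A) z p ->
  exists P, minimal_at proj1R S z P /\ map_poly proj1R P = map_poly proj1R p.
Proof.
move=> ringA isoS domS [Ap p0 pz minp]; have [ringS _] := isoS.
have isoA := diagonal_iso ringA.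
have kerA := partial_iso_ker1 isoA; have kerS := partial_iso_ker1 isoS.
have [|P [SP PE sP]] := @lift_poly S (map_poly proj1R p) ringS.
  by move=> i; rewrite coef_map; apply/domS; have [] := Ap i.
have sPp : size P = size p by rewrite sP (size_map_coefs kerA).
exists P; split=> //; split=> //; rewrite ?PE //.
  by rewrite -size_poly_eq0 sPp size_poly_eq0.
move=> Q SQ Qz lt; have [||Q' [AQ' QE sQ]] := @lift_poly (diagonal A) (map_poly proj1R Q).
- by case: isoA.
- by move=> i; rewrite coef_map; apply/domain_diagonal/domS; exists (proj2R Q`_i); rewrite -surjective_pairing.
have Q'0 : Q' = 0 by apply: minp; rewrite ?QE // sQ (size_map_coefs kerS) // -sPp.
by apply: (map_poly_inj0 kerS SQ); rewrite -QE Q'0 rmorph0.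
Qed.

(** For odd degree, that is even [size], the transported polynomial has a real root whatever the
    isomorphism. For even degree, dividing by [X - z] leaves odd degree and hence a root, different
    from [z] by separability. *)
Lemma algebraic_odd_or_even A z : is_subring A -> algebraic_over proj1R (diagonal A) z ->
  (forall S, partial_iso S -> (forall a, domain S a <-> A a) ->
     exists z', partial_iso (adjoin S (z, z'))) \/
  exists2 z', z' != z & partial_iso (adjoin (diagonal A) (z, z')).
Proof.
move=> ringA alg; have isoA := diagonal_iso ringA; have [ringD _] := isoA.
have kerA := partial_iso_ker1 isoA.
have [p minp] := minimal_exists alg; have [Ap p0 pz min] := minp.
have p12 : map_poly proj2R p = map_poly proj1R p.
  by apply/polyP => i; rewrite !coef_map; have [_] := Ap i.
set p1 := map_poly proj1R p in pz p12.
have sp1 : size p1 = size p := size_map_coefs kerA Ap.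
have [odd_size|even_size] := boolP (odd (size p)); last first.
  left=> S isoS domS; have [P [minP PE]] := minimal_lift ringA isoS domS minp.
  have [SP _ _ _] := minP.
  have sP2 : size (map_poly proj2R P) = size p.
    by rewrite (size_map_coefs (partial_iso_ker2 isoS)) // -(size_map_coefs (partial_iso_ker1 isoS) SP) PE.
  have [|z' /rootP z'P] := @odd_poly_root R (map_poly proj2R P); first by rewrite sP2.
  by exists z'; apply: (iso_extend isoS minP).
right; have /factor_theorem[g gE] : root p1 z by apply/rootP.
have p1n0 : p1 != 0 by rewrite -size_poly_eq0 sp1 size_poly_eq0.
have g0 : g != 0 by apply: contraNneq p1n0 => g0; rewrite gE g0 mul0r.
have sg : (size g).+1 = size p by rewrite -sp1 gE size_Mmonic ?monicXsubC // size_XsubC addn2.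
have [|z' /rootP gz'] := @odd_poly_root R g; first by move: odd_size; rewrite -sg.
exists z'; last by apply: (iso_extend isoA minp); rewrite p12 gE hornerM gz' mul0r.
apply/negP => /eqP zz'; rewrite zz' in gz'.
have /negP[] := minimal_separable ringD kerA minp; apply/eqP.
by rewrite -/p1 gE derivM derivXsubC mulr1 !hornerE gz' subrr mulr0 addr0.
Qed.

Lemma transcendental_opp A z : is_subring A -> ~ algebraic_over proj1R (diagonal A) z ->
  partial_iso (adjoin (diagonal A) (z, - z)).
Proof.
move=> ringA trz; have isoA := diagonal_iso ringA; have [ringD _] := isoA.
apply: partial_iso_intro; first exact: adjoin_subring.
  by apply: (@kernel_transcendental _ _ proj1R _ z).
apply: (@kernel_transcendental _ _ proj2R _ (- z)) => // -[P [AP P0 Pz]].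
(* Substituting [- X] turns a relation satisfied by [- z] into one satisfied by [z]. *)
apply: trz; exists (\poly_(i < size P) ((-1) ^+ i * P`_i)); split.
- move=> i; rewrite coef_poly; case: ifP => _; last exact: subring0.
  apply: subringM => //; elim: i => [|i IH]; first by rewrite expr0; apply: subring1.
  by rewrite exprS; apply: subringM => //; apply: subringN => //; apply: subring1.
- apply: contraNneq P0 => E; apply/eqP/polyP => i; rewrite coef0.
  have := congr1 (fun Q : {poly R * R} => Q`_i) E; rewrite coef_poly coef0.
  case: ltnP => [_ /(congr1 (fun t => (-1) ^+ i * t))|le _]; last by rewrite nth_default.
  by rewrite mulr0 mulrA -exprMn mulrNN mulr1 expr1n mul1r.
- have -> : map_poly proj1R (\poly_(i < size P) ((-1) ^+ i * P`_i)) =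
      \poly_(i < size P) proj1R ((-1) ^+ i * P`_i).
    by apply/polyP => i; rewrite coef_map !coef_poly; case: ifP => // _; rewrite rmorph0.
  rewrite horner_poly -[RHS]Pz horner_coef (size_map_coefs (partial_iso_ker2 isoA)) //.
  apply: eq_bigr => i _; rewrite coef_map rmorphM rmorphXn rmorphN1 [(- z) ^+ i]exprNn /=.
  have [_ E] := AP i; rewrite [proj2R _]E /proj1R /=. ring.
Qed.

(** The rest of the list is treated first, over [A[z]]. If every isomorphism on [A[z]] extends, it
    remains to see whether [z] can be moved; the first alternative quantifies over all [S] so that
    it also covers isomorphisms moving [z]. *)
Lemma iso_chain (zs : seq R) A : is_subring A ->
  (forall S, partial_iso S -> (forall a, domain S a <-> A a) ->
     exists S', [/\ partial_iso S', forall t, S t -> S' t & forall z, z \in zs -> domain S' z]) \/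
  exists S', [/\ partial_iso S', forall a, A a -> S' (a, a), forall z, z \in zs -> domain S' z &
     exists z z', [/\ z \in zs, z' != z & S' (z, z')]].
Proof.
elim: zs A => [|z zs IH] A ringA.
  by left=> S isoS _; exists S; split.
have isoA := diagonal_iso ringA; have [ringD _] := isoA.
have ringAz : is_subring (adjoin A z) by apply: adjoin_subring.
have Az a : A a -> adjoin A z a by apply: adjoin_base.
have domS S z' : partial_iso S -> (forall a, domain S a <-> A a) ->
    forall a, domain (adjoin S (z, z')) a <-> adjoin A z a.
  move=> [ringS _] dS a; rewrite (domain_adjoin z z' ringS).
  by split=> -[P SP ->]; exists P => // i; apply/dS.
have [ext|[S' [isoS' dS' zsS' [w [w' [wzs ww' S'w]]]]]] := IH _ ringAz; last first.
  right; exists S'; split=> //.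
  - by move=> a /Az; apply: dS'.
  - move=> y; rewrite inE => /predU1P[->|]; last exact: zsS'.
    by exists z; apply: dS'; apply: adjoin_gen.
  - by exists w, w'; rewrite inE wzs orbT.
have step S z' : partial_iso S -> (forall a, domain S a <-> A a) ->
    partial_iso (adjoin S (z, z')) ->
    exists S', [/\ partial_iso S', forall t, S t -> S' t, S' (z, z') &
      forall y, y \in z :: zs -> domain S' y].
  move=> isoS dS isoS1; have [ringS _] := isoS.
  have [S' [isoS' sub dS']] := ext _ isoS1 (domS S z' isoS dS).
  have S'z : S' (z, z') by apply: sub; apply: adjoin_gen.
  exists S'; split=> //; first by move=> t St; apply: sub; apply: adjoin_base.
  by move=> y; rewrite inE => /predU1P[->|]; [exists z'|apply: dS'].
have right_case z' : z' != z -> partial_iso (adjoin (diagonal A) (z, z')) ->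
    exists S', [/\ partial_iso S', forall a, A a -> S' (a, a),
      forall y, y \in z :: zs -> domain S' y &
      exists y y', [/\ y \in z :: zs, y' != y & S' (y, y')]].
  move=> zz' iso1; have [S' [isoS' sub S'z dS']] := step _ z' isoA (domain_diagonal A) iso1.
  exists S'; split=> //; first by move=> a Aa; apply: sub.
  by exists z, z'; rewrite inE eqxx.
have [alg|tr] := pselect (algebraic_over proj1R (diagonal A) z); last first.
  right; apply: (right_case (- z)); last exact: transcendental_opp.
  apply/negP => /eqP e; apply: tr; exists 'X; split.
  - exact: coefs_inX.
  - by rewrite polyX_eq0.
  - by rewrite map_polyX hornerX; lra.
have [odd_case|[z' zz' iso1]] := algebraic_odd_or_even ringA alg; last by right; apply: (right_case z').
left=> S isoS dS; have [z' iso1] := odd_case S isoS dS.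
by have [S' [isoS' sub S'z dS']] := step S z' isoS dS iso1; exists S'.
Qed.

End PartialIso.

(** * Equivalent frameworks that are not congruent *)

Section NotGloballyRigid.
Variables (R : realType) (V : finType).
Implicit Types (p q u : V -> R * R) (E : rel V).

Definition dist2 p x y : R := dot (p x - p y) (p x - p y).

(** The ring generated by the squared edge lengths, as an intersection, so that a property stable
    under the ring operations passes to it directly. *)
Definition length_ring E p (z : R) : Prop := forall S : R -> Prop, is_subring S ->
  (forall x y, E x y -> S (dist2 p x y)) -> S z.

Lemma length_ringP E p : is_subring (length_ring E p).
Proof.
split.
- by move=> S ringS _; apply: subring1.
- by move=> z w Az Aw S ringS SE; apply: subringB => //; [apply: Az|apply: Aw].
- by move=> z w Az Aw S ringS SE; apply: subringM => //; [apply: Az|apply: Aw].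
Qed.

Lemma length_ring_dist2 E p x y : E x y -> length_ring E p (dist2 p x y).
Proof. by move=> Exy S _; apply. Qed.

Lemma derivation_horner (D : R -> R) (P : {poly R}) z : derivation D ->
  (forall i, D P`_i = 0) -> D P.[z] = P^`().[z] * D z.
Proof.
move=> derD; have [DA DM] := derD; elim/poly_ind: P => [|P c IH] DP.
  by rewrite deriv0 !horner0 mul0r derivation0.
have Dc : D c = 0 by have := DP 0%N; rewrite coefD coefMX coefC /= add0r.
have := IH _; rewrite derivD derivM derivX derivC addr0 mulr1 !hornerE DA DM Dc => ->.
  by ring.
by move=> i; have := DP i.+1; rewrite coefD coefMX coefC /= addr0.
Qed.

(** The derivation along [u] kills the length ring. Applied to a minimal relation [P(l) = 0], it
    would give [P'(l) D l = 0] with both factors nonzero. *)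
Lemma flex_transcendental E p u x0 y0 : diff_generic p ->
  (forall x y, E x y -> dot (p x - p y) (u x - u y) = 0) ->
  dot (p x0 - p y0) (u x0 - u y0) != 0 ->
  ~ algebraic_over (@proj1R R) (diagonal (length_ring E p)) (dist2 p x0 y0).
Proof.
move=> gp flu u0 /minimal_exists[P minP]; have [D derD HD] := gp u.
have [SP _ Pz _] := minP.
have Dd x y : D (dist2 p x y) = 2 * dot (p x - p y) (u x - u y).
  by rewrite /dist2 (derivation_dot _ _ derD) (derivationB _ _ derD) !HD /dot; ring.
have [DA DM] := derD.
have Dring z : length_ring E p z -> D z = 0.
  move/(_ (fun w => D w = 0)); apply; last by move=> x y /flu h; rewrite Dd h mulr0.
  split; first exact: derivation1.
  - move=> a b Da Db; apply: (addIr (D b)); rewrite -DA subrK Da Db addr0 //.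
  - by move=> a b Da Db; rewrite DM Da Db !mulr0 addr0.
have isoA := diagonal_iso (length_ringP E p); have [ringA _] := isoA.
have /negP[] := minimal_separable ringA (partial_iso_ker1 isoA) minP; apply/eqP.
have : D (map_poly (@proj1R R) P).[dist2 p x0 y0] = 0 by rewrite Pz derivation0.
rewrite derivation_horner //; last by move=> i; rewrite coef_map; apply: Dring; case: (SP i).
by rewrite Dd => /eqP; rewrite !mulf_eq0 pnatr_eq0 (negPf u0) !orbF => /eqP.
Qed.

Lemma partial_iso_fun (S : R * R -> Prop) z w w' : partial_iso S -> S (z, w) -> S (z, w') -> w = w'.
Proof.
move=> [ringS h] Sw Sw'; have := subringB ringS Sw Sw'.
by move=> /h [/= h0 _]; apply/eqP; rewrite -subr_eq0; apply/eqP/h0/subrr.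
Qed.

Lemma not_globally_rigid E p u x0 y0 a b c : diff_generic p ->
  a != b -> b != c -> a != c -> E a b -> E b c -> E a c ->
  (forall x y, E x y -> dot (p x - p y) (u x - u y) = 0) ->
  dot (p x0 - p y0) (u x0 - u y0) != 0 ->
  exists q, [/\ forall x y, E x y -> same_dist p q x y, same_dist p q x0 y0 &
    ~ forall x y, same_dist p q x y].
Proof.
move=> gp ab bc ac Eab Ebc Eac flu u0.
(* [al] and [ga] are scaled coordinates in the frame of the triangle [a b c], so that moving one of
   them cannot result from a congruence. By Heron's formula [4 k ^ 2] lies in the length ring, but
   [k] need not; hence the factor [k] in [ga]. *)
pose e := p b - p a; pose f := p c - p a; pose U := dot e e; pose k := cross e f.
pose al v := dot (p v - p a) e; pose ga v := k * cross e (p v - p a).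
pose A0 := length_ring E p; pose l := dist2 p x0 y0.
have ringA0 : is_subring A0 := length_ringP E p.
have U0 : 0 < U.
  rewrite lt_neqAle eq_sym diff_generic_inj // 1?eq_sym // /U /dot.
  by rewrite addr_ge0 // -expr2 sqr_ge0.
have k0 : k != 0.
  have := diff_generic_cross gp ab bc ac; apply: contra => /eqP h; apply/eqP.
  by rewrite -[RHS]h /k /cross /e /f /=; ring.
have K0 : 0 < k ^+ 2 by rewrite lt_neqAle eq_sym sqrf_eq0 k0 sqr_ge0.
have distE x y : U * k ^+ 2 * dist2 p x y = k ^+ 2 * (al x - al y) ^+ 2 + (ga x - ga y) ^+ 2.
  by rewrite /dist2 /al /ga /U /dot /cross /=; ring.
have Adist x y : E x y -> A0 (dist2 p x y) by apply: length_ring_dist2.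
have AU : A0 U by rewrite /U /e dotBB; apply: Adist.
have Aac : A0 (2 * al c).
  rewrite (_ : 2 * al c = dist2 p a c + U - dist2 p b c); last first.
    by rewrite /al /dist2 /U /e /dot /=; ring.
  by apply: (subringB ringA0); [apply: (subringD ringA0)|] => //; apply: Adist.
have A4 : A0 4.
  by rewrite -[4]/((1 + 1 + 1 + 1)%:R) !natrD; do !apply: (subringD ringA0); apply: (subring1 ringA0).
have AK : A0 (4 * k ^+ 2).
  rewrite (_ : 4 * k ^+ 2 = 4 * (U * dist2 p a c) - (2 * al c) * (2 * al c)); last first.
    by rewrite /al /dist2 /U /k /f /e /dot /cross /=; ring.
  by apply: (subringB ringA0); apply: (subringM ringA0) => //; apply: (subringM ringA0) => //; apply: Adist.
have u0' := flex_transcendental gp flu u0.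
pose A := adjoin A0 l; have ringA : is_subring A by apply: adjoin_subring.
pose zs := map al (enum V) ++ map ga (enum V).
have zal v : al v \in zs by rewrite mem_cat map_f // mem_enum.
have zga v : ga v \in zs by rewrite mem_cat [_ \in map ga _]map_f ?orbT // mem_enum.
(* Both cases transport the expression of the distances in terms of [al] and [ga]. *)
have transport S al' ga' : partial_iso S -> (forall z, A0 z -> S (z, z)) ->
    (forall v, S (al v, al' v)) -> (forall v, S (ga v, ga' v)) ->
    forall x y d, S (dist2 p x y, d) ->
    U * k ^+ 2 * d = k ^+ 2 * (al' x - al' y) ^+ 2 + (ga' x - ga' y) ^+ 2.
  move=> isoS Sd Sal Sga x y d Sxy; have [ringS _] := isoS.
  have S1 := subringM ringS (subringM ringS (Sd _ AU) (Sd _ AK)) Sxy.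
  have Sa := subringB ringS (Sal x) (Sal y); have Sg := subringB ringS (Sga x) (Sga y).
  have S2 := subringD ringS (subringM ringS (Sd _ AK) (subringM ringS Sa Sa))
    (subringM ringS (Sd _ A4) (subringM ringS Sg Sg)).
  have eq1 : U * (4 * k ^+ 2) * dist2 p x y = 4 * k ^+ 2 * ((al x - al y) * (al x - al y)) +
      4 * ((ga x - ga y) * (ga x - ga y)).
    by have := distE x y; clear; move: (dist2 p x y) (al x) (al y) (ga x) (ga y) => *; lra.
  have : U * (4 * k ^+ 2) * d = 4 * k ^+ 2 * ((al' x - al' y) * (al' x - al' y)) +
      4 * ((ga' x - ga' y) * (ga' x - ga' y)).
    apply: (partial_iso_fun isoS S1); rewrite -/(dist2 p x y) in S1 *.
    by rewrite [X in S (X, _)]eq1.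
  by clear; move: (al' x) (al' y) (ga' x) (ga' y) => *; lra.
have [ext|[S [isoS dS zS [z [z' [zzs zz' Sz]]]]]] := iso_chain zs ringA.
  exfalso; pose S0 := adjoin (diagonal A0) (l, - l).
  have isoS0 : partial_iso S0 by apply: transcendental_opp.
  have [|S [isoS sub dS]] := ext S0 isoS0.
    move=> w; have [ringD _] := diagonal_iso ringA0; rewrite (domain_adjoin l (- l) ringD).
    by split=> -[P SP ->]; exists P => // i; apply/domain_diagonal.
  have [ringD _] := diagonal_iso ringA0.
  have /choice[al' Hal] : forall v, exists z', S (al v, z') by move=> v; apply: dS.
  have /choice[ga' Hga] : forall v, exists z', S (ga v, z') by move=> v; apply: dS.
  have Sd w : A0 w -> S (w, w) by move=> Aw; apply: sub; apply: adjoin_base.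
  have Sl : S (dist2 p x0 y0, - l) by apply: sub; apply: adjoin_gen.
  have := transport S al' ga' isoS Sd Hal Hga x0 y0 _ Sl.
  have l0 : 0 < l.
    rewrite lt_neqAle /l /dist2 /dot addr_ge0 -?expr2 ?sqr_ge0 // andbT eq_sym.
    apply: contra u0 => /eqP h; have := dot_eq0 (p x0 - p y0).
    by rewrite {1}/dot -!expr2 h eqxx => /esym/eqP ->; rewrite /dot /= !mul0r addr0.
  move/eqP; rewrite lt_eqF //; apply: (@lt_le_trans _ _ 0).
    by rewrite mulrN oppr_lt0; apply: mulr_gt0 => //; apply: mulr_gt0.
  by apply: addr_ge0; rewrite ?sqr_ge0 //; apply: mulr_ge0; apply: sqr_ge0.
have Sd w : A0 w -> S (w, w) by move=> Aw; apply: dS; apply: adjoin_base.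
have Sl : S (l, l) by apply: dS; apply: adjoin_gen.
have /choice[al' Hal] : forall v, exists z', S (al v, z') by move=> v; apply: zS.
have /choice[ga' Hga] : forall v, exists z', S (ga v, z') by move=> v; apply: zS.
have tr := transport S al' ga' isoS Sd Hal Hga.
pose q v := scale (al' v / U) e + scale (ga' v / (k * U)) (turn e).
have Un0 : U != 0 by rewrite gt_eqF.
have qE x y : U * k ^+ 2 * dot (q x - q y) (q x - q y) =
    k ^+ 2 * (al' x - al' y) ^+ 2 + (ga' x - ga' y) ^+ 2.
  have -> : dot (q x - q y) (q x - q y) =
      (((al' x - al' y) / U) ^+ 2 + ((ga' x - ga' y) / (k * U)) ^+ 2) * U.
    by rewrite /q /U /dot /=; ring.
  by field; rewrite ?k0 ?Un0.
have UK0 : U * k ^+ 2 != 0 by rewrite mulf_neq0 // gt_eqF.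
have qd x y : S (dist2 p x y, dist2 p x y) -> same_dist p q x y.
  by move=> /tr h; apply: (mulfI UK0); rewrite qE -h.
exists q; split; [by move=> x y /Adist /Sd; apply: qd|exact: qd|].
move=> cong.
have all x y : k ^+ 2 * (al' x - al' y) ^+ 2 + (ga' x - ga' y) ^+ 2 =
    k ^+ 2 * (al x - al y) ^+ 2 + (ga x - ga y) ^+ 2.
  by rewrite -qE -distE; congr (_ * _); apply: cong.
have [ringS _] := isoS.
(* The coordinates of [a], [b], [c] lie in the length ring up to the factors 2 and 4, so they are
   fixed. If [q] were congruent to [p], the distances to these three points would fix every [al] and
   [ga]. *)
have fixed w w' : S (w, w') -> A0 w -> w' = w.
  by move=> Sw Aw; apply: (partial_iso_fun isoS Sw); apply: Sd.
have A00 : A0 0 by apply: subring0.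
have ala : al a = 0 by rewrite /al /dot subrr /= !mul0r addr0.
have gaa : ga a = 0 by rewrite /ga /cross subrr /= !mulr0 subrr mulr0.
have gab : ga b = 0 by rewrite /ga -/e /cross mulrC [e.1 * _]mulrC subrr mul0r.
have gac : ga c = k ^+ 2 by [].
have ala' : al' a = 0 by have := fixed _ _ (Hal a); rewrite ala => ->.
have gaa' : ga' a = 0 by have := fixed _ _ (Hga a); rewrite gaa => ->.
have gab' : ga' b = 0 by have := fixed _ _ (Hga b); rewrite gab => ->.
have alb' : al' b = U by apply: fixed (Hal b) _.
have A2 : A0 2 by rewrite -[2]/((1 + 1)%:R) natrD; apply: (subringD ringA0); apply: (subring1 ringA0).
have alc' : al' c = al c.
  have : 2 * al' c = 2 * al c := fixed _ _ (subringM ringS (Sd _ A2) (Hal c)) Aac.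
  by clear; move: (al' c) (al c) => *; lra.
have gac' : ga' c = k ^+ 2.
  have : 4 * ga' c = 4 * k ^+ 2 := fixed _ _ (subringM ringS (Sd _ A4) (Hga c)) AK.
  by clear; move: (ga' c) => *; lra.
have same v : al' v = al v /\ ga' v = ga v.
  have := all v a; rewrite ala gaa ala' gaa' !subr0 => ha.
  have := all v b; rewrite gab alb' gab' -[al b]/U !subr0 => hb.
  have := all v c; rewrite gac gac' alc' => hc.
  have alv : al' v = al v.
    apply: (mulfI UK0); move: ha hb; clear.
    by move: (al' v) (al v) (ga' v) (ga v) (k ^+ 2) => *; nra.
  split=> //; apply: (mulfI (lt0r_neq0 K0)); move: ha hc; rewrite alv; clear.
  by move: (al v) (ga' v) (ga v) (k ^+ 2) => *; nra.
move/eqP: zz'; apply; move: Sz zzs; rewrite mem_cat => Sz /orP[] /mapP[v _ ez]; rewrite ez in Sz *.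
  by rewrite -[RHS](proj1 (same v)); apply: (partial_iso_fun isoS Sz).
by rewrite -[RHS](proj2 (same v)); apply: (partial_iso_fun isoS Sz).
Qed.

End NotGloballyRigid.

(** * Rigidity of frameworks *)

Section Rigid.
Variable R : realType.

(** A row [v] with [v (1 + X) = 0] satisfies [|v| <= r / (r + 1) |v|] in the sum norm. *)
Lemma unit_near_1 r (X : 'M[R]_r) : (forall i j, `|X i j| * r.+1%:R < 1) -> 1%:M + X \in unitmx.
Proof.
move=> small; rewrite -row_free_unit -kermx_eq0; apply/eqP/row_matrixP => i0.
rewrite row0; set v := row i0 _.
have vX : v = - (v *m X).
  have : v *m (1%:M + X) = 0 by apply/sub_kermxP; apply: row_sub.
  by rewrite mulmxDr mulmx1 => /eqP; rewrite addr_eq0 => /eqP.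
have sumv : \sum_i `|v 0 i| <= (\sum_i `|v 0 i|) * (r%:R / r.+1%:R).
  have le i : `|v 0 i| <= \sum_j `|v 0 j| / r.+1%:R.
    rewrite {1}vX mxE normrN mxE; apply: le_trans (ler_norm_sum _ _ _) _.
    apply: ler_sum => j _; rewrite normrM ler_wpM2l //.
    by rewrite -[leRHS]mul1r ler_pdivlMr ?ltr0Sn // ltW.
  apply: le_trans (ler_sum _ (fun i _ => le i)) _.
  by rewrite sumr_const card_ord -mulr_suml -[leLHS]mulr_natr -mulrA [_^-1 * _]mulrC.
have s0 : \sum_i `|v 0 i| = 0.
  apply/eqP; rewrite eq_le sumr_ge0 // andbT; move: sumv.
  set s := \sum_i _; have : 0 < (r.+1%:R)^-1 :> R by rewrite invr_gt0 ltr0Sn.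
  have -> : r%:R / r.+1%:R = 1 - (r.+1%:R)^-1 :> R.
    by rewrite -[r.+1%:R]natr1; field; rewrite natr1 pnatr_eq0.
  by clear; move: (r.+1%:R^-1) s => t s *; nra.
apply/rowP => i; rewrite mxE [RHS]mxE; apply/eqP; rewrite -normr_eq0.
have := psumr_eq0P (fun i _ => normr_ge0 (v 0 i)) s0 => /(_ i isT).
by rewrite /v !mxE => ->.
Qed.

(* If [L A R = 1] then [L B R] is invertible for [B] near [A]. *)
Lemma rank_lower_semicontinuous m n (A : 'M[R]_(m, n)) : exists2 eps : R, 0 < eps &
  forall B : 'M[R]_(m, n), (forall i j, `|B i j - A i j| < eps) -> (\rank A <= \rank B)%N.
Proof.
have [L [Rr LAR]] : exists L : 'M[R]_(\rank A, m), exists Rr : 'M[R]_(n, \rank A),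
    L *m A *m Rr = 1%:M.
  exists (pid_mx (\rank A) *m invmx (col_ebase A)), (invmx (row_ebase A) *m pid_mx (\rank A)).
  set L := pid_mx _ *m _; set Rr := _ *m pid_mx _.
  have -> : L *m A *m Rr = L *m (col_ebase A *m pid_mx (\rank A) *m row_ebase A) *m Rr.
    by rewrite mulmx_ebase.
  rewrite !mulmxA mulmxKV ?col_ebase_unit // mulmxK ?row_ebase_unit //.
  by rewrite !pid_mx_id ?rank_leq_row ?rank_leq_col // pid_mx_1.
set r := \rank A in L Rr LAR *.
pose c i j := \sum_l \sum_k `|L i k| * `|Rr l j|.
pose C := \sum_i \sum_j c i j.
have c0 i j : 0 <= c i j by do 2!apply: sumr_ge0 => ? _; rewrite mulr_ge0.
have cC i j : c i j <= C.
  rewrite /C (bigD1 i) //= (bigD1 j) //= -addrA lerDl addr_ge0 ?sumr_ge0 // => ? _.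
  exact: sumr_ge0.
have C1 : 0 < C + 1 by rewrite ltr_wpDl // sumr_ge0 // => ? _; apply: sumr_ge0.
have r1 : 0 < r.+1%:R :> R by rewrite ltr0Sn.
exists ((C + 1) * r.+1%:R)^-1 => [|B AB]; first by rewrite invr_gt0 mulr_gt0.
set eps := _^-1 in AB.
have unitLBR : L *m B *m Rr \in unitmx.
  rewrite (_ : L *m B *m Rr = 1%:M + L *m (B - A) *m Rr); last first.
    by rewrite mulmxBr mulmxBl LAR addrC subrK.
  apply: unit_near_1 => i j; apply: (@le_lt_trans _ _ (eps * c i j * r.+1%:R)).
    rewrite ler_wpM2r ?(ltW r1) // mxE mulr_sumr; apply: le_trans (ler_norm_sum _ _ _) _.
    apply: ler_sum => l _; rewrite mxE mulr_suml mulr_sumr.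
    apply: le_trans (ler_norm_sum _ _ _) _; apply: ler_sum => k' _.
    rewrite !normrM mulrAC mulrC ler_wpM2r ?mulr_ge0 // !mxE ltW //.
  rewrite (_ : eps * _ * _ = c i j / (C + 1)); last first.
    rewrite /eps; move: (lt0r_neq0 C1) (lt0r_neq0 r1); clear.
    by move: (C + 1) (r.+1%:R : R) (c i j) => a b d a0 b0; field; rewrite ?a0 ?b0.
  rewrite ltr_pdivrMr // mul1r; apply: le_lt_trans (cC i j) _; rewrite ltrDl //.
rewrite -(mxrank_unit unitLBR); apply: leq_trans (mxrankM_maxl _ _) (mxrankM_maxr _ _).
Qed.

End Rigid.

Section FrameworkRigid.
Variables (R : realType) (V : finType).
Implicit Types (p q : V -> R * R) (E : rel V).

(** If [q] has the edge lengths of [p], then [p - q] is a flex of the midpoint framework [m]. For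
    [q] near [p], [m] is near [p] and its rigidity matrix has at least the same rank, so [p - q] is
    a motion of [m]; read backwards, all distances agree. *)
Lemma inf_rigid_rigid p E : diff_generic p -> inf_rigid [set: V] E p ->
  exists2 eps : R, 0 < eps & forall q, (forall x y, E x y -> same_dist p q x y) ->
    (forall v, `|(p v - q v).1| < eps /\ `|(p v - q v).2| < eps) ->
    forall x y, same_dist p q x y.
Proof.
move=> gp rig; have [le1|gt1] := leqP #|V| 1.
  by exists 1 => // q _ _ x y; rewrite (fintype_le1P le1 x y); apply: same_dist_refl.
pose es := enum [pred xy : V * V | E xy.1 xy.2].
pose e (i : 'I_(size es)) := tnth (in_tuple es) i.
have eE i : E (e i).1 (e i).2.
  by have := mem_tnth i (in_tuple es); rewrite mem_enum.
have Ee x y : E x y -> exists i, e i = (x, y).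
  move=> Exy; have : (x, y) \in in_tuple es by rewrite mem_enum.
  by move=> /tnthP[i ->]; exists i.
have ker3 : (\rank (kermx (rigidity_mx p e)) <= 3)%N.
  apply: leq_trans (mxrankS (rigid_kernel gp rig Ee)) _; exact: rank_leq_row.
have [eps0 eps0_gt0 near] := rank_lower_semicontinuous (rigidity_mx p e).
(* Differences of points of [m] and of [p] then differ by less than [eps0 / 4] in each coordinate,
   so an entry of the matrix changes by at most [eps0 / 2]. *)
exists (eps0 / 4) => [|q eqv small]; first by rewrite divr_gt0.
pose m v := scale 2^-1 (p v + q v).
have rk : (\rank (rigidity_mx p e) <= \rank (rigidity_mx m e))%N.
  apply: near => i j.
  have entry (w : V -> R * R) : rigidity_mx w e i j = dot (w (e j).1 - w (e j).2)
      (unvec (delta_mx 0 i) (e j).1 - unvec (delta_mx 0 i) (e j).2) by rewrite !mxE.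
  rewrite !entry; move: (e j) => [x y] /=.
  have le1 k l : `|(delta_mx 0 i : 'rV[R]__) 0 k - (delta_mx 0 i : 'rV[R]__) 0 l| <= 1.
    by rewrite !mxE; do 2!case: (_ && _); rewrite ?subrr ?subr0 ?sub0r ?normrN ?normr0 ?normr1 ?ler01.
  have := le1 (lshift #|V| (enum_rank x)) (lshift #|V| (enum_rank y)).
  have := le1 (rshift #|V| (enum_rank x)) (rshift #|V| (enum_rank y)).
  rewrite /dot /m /=; move: (_ - _) (_ - _) => s t.
  have [] := small x; have [] := small y.
  case: (p x) (q x) (p y) (q y) => [p1 p2] [q1 q2] [p3 p4] [q3 q4] /=.
  rewrite !ltr_norml !ler_norml => /andP[? ?] /andP[? ?] /andP[? ?] /andP[? ?] /andP[? ?] /andP[? ?].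
  have bound (h a b : R) : - h <= a -> a <= h -> -1 <= b -> b <= 1 -> - h <= a * b <= h.
    by clear => *; apply/andP; split; nra.
  set A := 2^-1 * (p1 + q1); set B := 2^-1 * (p3 + q3).
  set C := 2^-1 * (p2 + q2); set D := 2^-1 * (p4 + q4).
  have /andP[? ?] : - (eps0 / 4) <= (A - B - (p1 - p3)) * s <= eps0 / 4.
    by apply: bound => //; rewrite /A /B; lra.
  have /andP[? ?] : - (eps0 / 4) <= (C - D - (p2 - p4)) * t <= eps0 / 4.
    by apply: bound => //; rewrite /C /D; lra.
  by apply/andP; split; lra.
have kerm : (\rank (kermx (rigidity_mx m e)) <= 3)%N.
  by apply: leq_trans ker3; rewrite !mxrank_ker leq_sub2l.
(* A constant [m] would have zero rigidity matrix, with a kernel of dimension [2 |V| >= 4]. *)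
have [x0 [y0 m0]] : exists x0 y0, m x0 != m y0.
  apply: contrapT => const.
  have m_eq x y : m x = m y.
    by apply/eqP; apply: contrapT => /negP ne; apply: const; exists x, y.
  have : rigidity_mx m e = 0.
    by apply/matrixP => i j; rewrite !mxE (m_eq (e j).1 (e j).2) subrr /dot /= !mul0r addr0.
  by move=> e0; move: kerm; rewrite mxrank_ker e0 mxrank0 subn0; move: gt1; clear; lia.
have [i|a [k ak]] := @small_kernel R V m _ e x0 y0 (fun v => p v - q v) kerm m0.
  have := eqv _ _ (eE i); rewrite /same_dist /m /dot /= => h.
  apply: (mulfI (_ : 2 != 0 :> R)); first by rewrite pnatr_eq0.
  rewrite mulr0; apply: (etrans _ (etrans (congr1 (fun z => z - dot (q (e i).1 - q (e i).2) (q (e i).1 - q (e i).2)) (esym h)) _)); last by rewrite /dot subrr.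
  by rewrite /dot /=; field.
move=> x y; rewrite /same_dist; apply/eqP; rewrite -subr_eq0; apply/eqP.
apply: etrans (_ : - (2 * dot (m x - m y) ((p x - q x) - (p y - q y))) = 0).
  by rewrite /m /dot /=; field.
by rewrite !ak motion_flex mulr0 oppr0.
Qed.

End FrameworkRigid.

Section Placements.
Variables (R : realType) (G : sgraph).
Implicit Types p q : placement R 2 G.

Definition point p (v : G) : R * R := (p v 0 0, p v 0 1).
Definition row2 (a : R * R) : 'rV[R]_2 := \row_i (if i == 0 then a.1 else a.2).
Definition placement_of (f : G -> R * R) : placement R 2 G := row2 \o f.

Lemma placement_ofK f : point (placement_of f) =1 f.
Proof. by move=> v; apply: pair_ext; rewrite /= mxE. Qed.

Lemma enorm_dot (v : 'rV[R]_2) : enorm v = Num.sqrt (dot (v 0 0, v 0 1) (v 0 0, v 0 1)).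
Proof. by rewrite /enorm !big_ord_recl big_ord0 addr0 /dot /= !expr2 (_ : lift ord0 ord0 = 1) //; apply: val_inj. Qed.

Lemma dot_ge0 (a : R * R) : 0 <= dot a a.
Proof. by rewrite /dot addr_ge0 // -expr2 sqr_ge0. Qed.

Lemma enorm_same_dist p q x y :
  enorm (p x - p y) = enorm (q x - q y) <-> same_dist (point p) (point q) x y.
Proof.
rewrite !enorm_dot /same_dist; set a := (_, _); set b := (_, _).
have -> : point p x - point p y = a by apply: pair_ext; rewrite /a /= !mxE.
have -> : point q x - point q y = b by apply: pair_ext; rewrite /b /= !mxE.
split=> [/eqP|->//]; rewrite eqr_sqrt ?dot_ge0 // => /eqP //.
Qed.

Lemma coord_le_enorm (v : 'rV[R]_2) i : `|v 0 i| <= enorm v.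
Proof.
rewrite /enorm -sqrtr_sqr ler_sqrt; last by apply: sumr_ge0 => j _; rewrite sqr_ge0.
by rewrite (bigD1 i) //= lerDl sumr_ge0 // => j _; rewrite sqr_ge0.
Qed.

Lemma generic_diff p : generic p -> diff_generic (point p).
Proof.
move=> /generic_derivation gp delta.
have [D derD HD] := gp (fun vi => if vi.2 == 0 then (delta vi.1).1 else (delta vi.1).2).
exists D => // v; apply: pair_ext => /=; first exact: (HD (v, 0)).
exact: (HD (v, 1)).
Qed.

Lemma generic_exists : exists p : placement R 2 G, generic p.
Proof.
have [x gx] := @alg_independent_exists R (G * 'I_2)%type.
exists (fun v => \row_i x (v, i)); rewrite /generic.
by rewrite (_ : (fun vi => _) = x) //; apply: funext => -[v i]; rewrite mxE.
Qed.

Lemma glob_rigid_framework p : glob_rigid [set: G] (@adj G) (point p) ->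
  framework_globally_rigid p.
Proof.
move=> rig q eqv x y; apply/enorm_same_dist; apply: rig; rewrite ?inE // => u v _ _ /eqv.
by move/enorm_same_dist.
Qed.

Lemma inf_rigid_framework p : diff_generic (point p) ->
  inf_rigid [set: G] (@adj G) (point p) -> framework_rigid p.
Proof.
move=> gp rig; have [eps eps0 H] := inf_rigid_rigid gp rig.
exists eps => // q eqv near x y; apply/enorm_same_dist; apply: H => [u v /eqv /enorm_same_dist //|v].
have lt i : `|p v 0 i - q v 0 i| < eps.
  by have := le_lt_trans (coord_le_enorm (p v - q v) i) (near v); rewrite !mxE.
by split; apply: lt.
Qed.

Lemma not_framework_globally_rigid p (f : G -> R * R) :
  (forall x y, adj x y -> same_dist (point p) f x y) ->
  ~ (forall x y, same_dist (point p) f x y) -> ~ framework_globally_rigid p.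
Proof.
move=> eqv ncong rig; apply: ncong => x y.
have same u v : same_dist (point p) (point (placement_of f)) u v <-> same_dist (point p) f u v.
  by rewrite /same_dist !placement_ofK.
apply/same/enorm_same_dist; apply: rig => u v uv; apply/enorm_same_dist/same; exact: eqv.
Qed.

End Placements.

Local Close Scope ring_scope.

(** * Flexes of G0 *)

Lemma set2_eq (V : finType) (a b x y : V) : [set a; b] = [set x; y] -> a != b ->
  (a = x /\ b = y) \/ (a = y /\ b = x).
Proof.
move=> /setP E ab; have := E a; have := E b; rewrite !inE !eqxx ?orbT /=.
move=> /esym/orP[]/eqP eb /esym/orP[]/eqP ea; move: ab; rewrite ea eb ?eqxx //.
  by right.
by left.
Qed.

Section TightFlex.
Local Open Scope ring_scope.
Variables (R : realType) (V : finType).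
Implicit Types (p u : V -> R * R) (F : {set {set V}}).

Lemma dot_swap p u x y : dot (p x - p y) (u x - u y) = dot (p y - p x) (u y - u x).
Proof. by rewrite /dot /=; ring. Qed.

(* [F] has [2 n - 3] edges and a 3-dimensional space of flexes, so its rigidity matrix
   has full column rank. *)
Lemma tight_flex p F x0 y0 : diff_generic p -> edge_set F -> sparse F -> tight F [set: V] ->
  [set x0; y0] \in F -> exists u, dot (p x0 - p y0) (u x0 - u y0) = 1 /\
    forall x y, [set x; y] \in F -> [set x; y] != [set x0; y0] ->
      dot (p x - p y) (u x - u y) = 0.
Proof.
move=> gp eF spF tF F0.
have [N [NF [e [f [fe eE]]]]] : exists N, N = #|F| /\ exists (e : 'I_N -> V * V) (f : 'I_N -> {set V}),
    injective f /\ forall x y, [set x; y] \in F ->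
      exists2 i, [set x; y] = f i & e i = (x, y) \/ e i = (y, x).
  exists #|F|; split=> //.
  have /choice[e He] : forall i : 'I_#|F|, exists xy : V * V, enum_val i = [set xy.1; xy.2].
    by move=> i; have /eqP/cards2P[a [b [_ ->]]] := eF _ (enum_valP i); exists (a, b).
  exists e, enum_val; split=> [|x y fF]; first exact: enum_val_inj.
  exists (enum_rank_in fF [set x; y]); first by rewrite enum_rankK_in.
  have := He (enum_rank_in fF [set x; y]); rewrite enum_rankK_in //.
  have xy : x != y by move: (eF _ fF); rewrite cards2; case: (x != y).
  by case: (e _) => a b /set2_eq /(_ xy) /= [[-> ->]|[-> ->]]; [left|right].
have rig : inf_rigid [set: V] [rel x y | [exists i, e i == (x, y)]] p.
  move=> u fl; apply: (laman_inf_rigid gp eF spF tF) => x y _ _ /eE[i _ [ei|ei]].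
    by apply: fl; rewrite ?inE //=; apply/existsP; exists i; rewrite ei.
  by rewrite dot_swap; apply: fl; rewrite ?inE //=; apply/existsP; exists i; rewrite ei.
have ker3 : (\rank (kermx (rigidity_mx p e)) <= 3)%N.
  apply: leq_trans (mxrankS (rigid_kernel gp rig _)) (rank_leq_row _).
  by move=> x y /existsP[i /eqP]; exists i.
rewrite mxrank_ker in ker3.
have full : row_full (rigidity_mx p e).
  rewrite /row_full eqn_leq rank_leq_col /=; move/andP: tF => [_ /eqP].
  have -> : ecount F [set: V] = #|F| by apply: eq_card => g; rewrite inE subsetT andbT.
  by rewrite cardsT -NF; move: ker3; clear; move: #|V| (\rank _) => *; lia.
have [i0 i0E ei0] := eE _ _ F0.
have /submxP[z zE] : ((delta_mx 0 i0 : 'rV[R]_N) <= rigidity_mx p e)%MS by apply: submx_full.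
have zi i : dot (p (e i).1 - p (e i).2) (unvec z (e i).1 - unvec z (e i).2) = (i == i0)%:R.
  have := congr1 (fun w : 'rV_N => w 0 i) zE; rewrite mul_rigidity_mx !mxE eqxx /= => ->.
  by [].
exists (unvec z); split.
  by have := zi i0; rewrite eqxx; case: ei0 => -> //=; rewrite dot_swap.
move=> x y /eE[i iE ei] ne.
have ii0 : i != i0 by apply: contraNneq ne => e0; rewrite iE i0E e0.
by have := zi i; rewrite (negPf ii0); case: ei => -> //=; rewrite dot_swap.
Qed.

End TightFlex.

Lemma leq_sum_eq (I : finType) (Q : pred I) (a b : I -> nat) : (forall i, Q i -> a i <= b i) ->
  \sum_(i | Q i) b i <= \sum_(i | Q i) a i -> forall i, Q i -> a i = b i.
Proof.
move=> ab le i Qi; have := leqif_sum (fun i Qi => leqif_eq (ab i Qi)).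
move=> [le' eq]; have : \sum_(i | Q i) a i == \sum_(i | Q i) b i by rewrite eqn_leq le' le.
by rewrite eq => /forall_inP/(_ i Qi)/eqP.
Qed.

Lemma nbrs_setC (V : finType) (F : {set {set V}}) (X : {set V}) v :
  #|nbrs F [set: V] v| = #|nbrs F X v| + #|nbrs F (~: X) v|.
Proof.
rewrite -(cardsID X (nbrs F [set: V] v)); congr (_ + _); apply: eq_card => y; rewrite !inE.
  by rewrite andbC.
by case: (y \in X).
Qed.

Lemma card_nbrs_outer1 (G : sgraph) (F : {set {set G}}) (X : {set G}) v w :
  F \subset edges G -> v \in X -> outer X v = [set w] ->
  #|nbrs F [set: G] v| = #|nbrs F X v| + ([set v; w] \in F).
Proof.
move=> FE vX outv; rewrite (nbrs_setC _ X).
have wX : w \notin X by have := set11 w; rewrite -outv inE => /andP[].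
have -> : nbrs F (~: X) v = if [set v; w] \in F then [set w] else set0.
  apply/setP => y; rewrite in_set in_setC; have [->|yw] := eqVneq y w.
    rewrite wX /= (_ : w != v) /=; first by case: ifP; rewrite !inE ?eqxx.
    by apply: contraNneq wX => ->.
  rewrite [RHS](_ : _ = false); last by case: ifP; rewrite !inE // (negPf yw).
  apply/negP => /and3P[yX _ /(subsetP FE)]; rewrite mem_edges => vy.
  have : y \in outer X v by rewrite in_setD yX inE.
  by rewrite outv inE (negPf yw).
by case: ifP; rewrite ?cards1 ?cards0.
Qed.

Section G0Flex.

Lemma card_home i : \sum_(v : G0 | home v == i) 1 = 5.
Proof.
by apply: etrans (card_cliqueG0 i); rewrite -sum1_card; apply: eq_bigl => v; rewrite inE.
Qed.

Lemma sum_nbrs_home (F : {set {set G0}}) :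
  \sum_(v in [set: G0]) #|nbrs F [set: G0] v| =
  \sum_i \sum_(v | home v == i) #|nbrs F [set: G0] v|.
Proof.
rewrite (partition_big home predT) //=; apply: eq_bigr => i _.
by apply: eq_bigl => v; rewrite in_setT.
Qed.

Section Counting.
Variable F : {set {set G0}}.
Hypotheses (FE : F \subset edges G0) (spF : sparse F) (tF : tight F [set: G0]).

Let eF : edge_set F. Proof. by move=> f /(subsetP FE); apply: edges_set. Qed.

Lemma card_nbrs_G0 v :
  #|nbrs F [set: G0] v| = #|nbrs F (cliqueG0 (home v)) v| + ([set v; swap v] \in F).
Proof. by apply: (card_nbrs_outer1 FE); [rewrite inE|apply: outerG0]. Qed.

Lemma sum_nbrs_clique i : \sum_(v | home v == i) #|nbrs F [set: G0] v| =
  2 * ecount F (cliqueG0 i) + \sum_(v | home v == i) ([set v; swap v] \in F).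
Proof.
rewrite -(handshake (cliqueG0 i) eF) (eq_bigl _ _ (fun v => in_set _ v)) /=.
by rewrite -big_split; apply: eq_bigr => v /eqP <-; exact: card_nbrs_G0.
Qed.

Lemma cross_edges_le i : \sum_(v | home v == i) ([set v; swap v] \in F) <= 5.
Proof.
by apply: leq_trans (eq_leq (card_home i)); apply: leq_sum => v _; exact: leq_b1.
Qed.

Lemma ecount_clique_le i : ecount F (cliqueG0 i) <= 7.
Proof. by have := @spF (cliqueG0 i); rewrite card_cliqueG0 => /(_ isT); clear; lia. Qed.

Lemma ecount_G0 : ecount F [set: G0] = 57.
Proof. by have /andP[_ /eqP] := tF; rewrite cardsT card_G0; clear; lia. Qed.

(** The degrees in [F] add up to [2 * 57 = 6 * 19], and each clique accounts for at most
    [2 * 7 + 5 = 19]. *)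
Lemma clique_count i :
  2 * ecount F (cliqueG0 i) + \sum_(v | home v == i) ([set v; swap v] \in F) = 19.
Proof.
have hs := handshake [set: G0] eF.
rewrite sum_nbrs_home (eq_bigr _ (fun i _ => sum_nbrs_clique i)) ecount_G0 in hs.
apply: (@leq_sum_eq _ predT (fun i => 2 * ecount F (cliqueG0 i) +
  \sum_(v | home v == i) ([set v; swap v] \in F)) (fun _ => 19)) => // [j _|].
  by have := ecount_clique_le j; have := cross_edges_le j; clear; lia.
by rewrite hs sum_nat_const card_ord.
Qed.

Let arith a b : 2 * a + b = 19 -> a <= 7 -> b <= 5 -> a + 3 = 2 * 5 /\ 5 <= b.
Proof. by lia. Qed.

Lemma tight_clique i : tight F (cliqueG0 i).
Proof.
rewrite /tight card_cliqueG0 /=; apply/eqP.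
exact: proj1 (arith (clique_count i) (ecount_clique_le i) (cross_edges_le i)).
Qed.

Lemma cross_edge_in v : [set v; swap v] \in F.
Proof.
have le w : home w == home v -> ([set w; swap w] \in F : nat) <= 1 by move=> _; exact: leq_b1.
have ge : \sum_(w | home w == home v) 1 <= \sum_(w | home w == home v) ([set w; swap w] \in F).
  apply: leq_trans (eq_leq (card_home _)) _.
  exact: proj2 (arith (clique_count _) (ecount_clique_le _) (cross_edges_le _)).
have := @leq_sum_eq _ (fun w => home w == home v) (fun w => [set w; swap w] \in F : nat)
  (fun _ => 1) le ge v (eqxx _).
by case: (_ \in F).
Qed.

End Counting.

Lemma tight_G0 : exists F : {set {set G0}}, [/\ F \subset edges G0, sparse F & tight F [set: G0]].
Proof.
have [|||F [FE spF tF]] := @glue_blocks G0 5 5 cliquesG0 swap regularG0 partitionG0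
    isT isT isT linkedG0 set0; rewrite ?card_cliquesG0 ?cards0 //.
exists F; rewrite setC0 in tF; split=> //.
by apply: subset_trans FE _; apply/subsetP => f; rewrite inE => /andP[].
Qed.

Section Flex.
Variables (R : realType) (p : G0 -> R * R).
Hypothesis gp : diff_generic p.

Lemma inf_rigid_G0 : inf_rigid [set: G0] (@adj G0) p.
Proof.
have [F [FE spF tF]] := tight_G0.
have eF : edge_set F by move=> f /(subsetP FE); apply: edges_set.
apply: inf_rigid_mono (laman_inf_rigid gp eF spF tF) => x y _ _ xy.
by rewrite -mem_edges (subsetP FE).
Qed.

(** The Laman graph [F] contains all edges between cliques and is tight on each clique. So a flex of
    [F] without one of these edges moves every clique rigidly and is a flex of all the other edges
    of [G0]. *)
Lemma flex_G0 v : exists u, (dot (p v - p (swap v)) (u v - u (swap v)) = 1)%R /\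
  forall x y, adj x y -> [set x; y] != [set v; swap v] ->
    (dot (p x - p y) (u x - u y) = 0)%R.
Proof.
have [F [FE spF tF]] := tight_G0.
have eF : edge_set F by move=> f /(subsetP FE); apply: edges_set.
have [u [u1 u0]] := tight_flex gp eF spF tF (cross_edge_in FE spF tF v); exists u; split=> // x y xy ne.
have [h|h] := eqVneq (home y) (home x); last first.
  suff yE : y = swap x by rewrite yE in ne *; apply: u0 => //; apply: cross_edge_in.
  by move: (outerG0 x) => /setP/(_ y); rewrite !inE h xy => /esym/eqP.
apply: (laman_inf_rigid gp eF spF (tight_clique FE spF tF (home x))); rewrite ?inE ?h // => a b.
rewrite !inE => /eqP ha /eqP hb abF; apply: u0 => //.
apply: contraNneq (home_target v) => E; have ab : a != b by have := eF _ abF; rewrite cards2; case: eqP.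
have [[ea eb]|[ea eb]] := set2_eq E ab; move: ha hb; rewrite ea eb home_swap => -> ->//.
Qed.

(** Apply [not_globally_rigid] to [G0] without the edge from [a] to [swap a], with a triangle inside
    a clique. The framework obtained also keeps the length of the removed edge. *)
Lemma not_globally_rigid_G0 : exists q, (forall x y : G0, adj x y -> same_dist p q x y) /\
  ~ forall x y, same_dist p q x y.
Proof.
have /card_gt2P[a [b [c [[aC bC cC] [ab bc ca]]]]] : 2 < #|cliqueG0 ord0| by rewrite card_cliqueG0.
have [u [u1 u0]] := flex_G0 a.
pose E := [rel x y : G0 | adj x y && ([set x; y] != [set a; swap a])].
have inE x y : x \in cliqueG0 ord0 -> y \in cliqueG0 ord0 -> x != y -> E x y.
  rewrite !inE => /eqP hx /eqP hy xy /=; apply/andP; split.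
    rewrite -[G0_adj x y]/(@adj G0 x y) adjG0 hx hy eqxx /=; apply/orP; left; apply: contraNneq xy => t.
    by apply/eqP/G0_ext; rewrite ?hx ?hy.
  apply: contraNneq (home_target a) => /set2_eq /(_ xy).
  by move=> [[ex ey]|[ex ey]]; move: hx hy; rewrite ex ey home_swap => -> ->.
have [||||x y /andP[]||q [qE qa ncong]] := @not_globally_rigid R G0 E p u a (swap a) a b c gp ab bc.
- by rewrite eq_sym.
- exact: inE.
- exact: inE.
- by apply: inE; rewrite // eq_sym.
- exact: u0.
- by rewrite u1 oner_eq0.
exists q; split=> // x y xy; have [e|ne] := eqVneq [set x; y] [set a; swap a]; last by apply: qE; apply/andP.
have [[-> ->]|[-> ->]] := set2_eq e (adj_neq xy); first exact: qa.
exact: same_dist_sym.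
Qed.

End Flex.
End G0Flex.

(** * Redundancy in Ramanujan graphs *)

Lemma redundant_globally_rigid_in (R : realType) (G : sgraph) : 3 <= #|G| ->
  (forall v : G, exists F : {set {set G}},
     [/\ F \subset within (edges G) (~: [set v]), sparse F & tight F (~: [set v])]) ->
  globally_rigid_in R 2 G.
Proof.
move=> G3 red; have [p gp] := generic_exists R G; exists p => //.
have dp := generic_diff gp; apply: glob_rigid_framework.
apply: vertex_redundant_glob_rigid => //; rewrite ?cardsT //; first exact: adj_sym.
move=> v _; have [F [FE spF tF]] := red v; rewrite setTD.
have {}FE : F \subset edges G by apply: subset_trans FE _; apply/subsetP => f; rewrite inE => /andP[].
have eF : edge_set F by move=> f /(subsetP FE); apply: edges_set.
apply: inf_rigid_mono (laman_inf_rigid dp eF spF tF) => x y _ _ xy.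
by rewrite -mem_edges (subsetP FE).
Qed.

Lemma regular_large (G : sgraph) k : connected G -> regular G k -> k < #|G|.
Proof.
move=> [/card_gt0P[x _] _] regG; rewrite -(regG x).
apply: leq_ltn_trans (_ : #|[set: G] :\ x| < _).
  by apply/subset_leq_card/subsetP => y; rewrite !inE andbT eq_sym; apply: adj_neq.
by rewrite -cardsT [ltnRHS](cardsD1 x) inE.
Qed.

Lemma degree_parity (G : sgraph) k : regular G k -> ~~ odd (k * #|G|).
Proof.
move=> regG; have := ecount_cut regG [set: G]; rewrite -cutC setCT /cut big_set0 addn0 cardsT => <-.
by rewrite oddM.
Qed.

Lemma blocks_glob_rigid (R : realType) (G : sgraph) k m (Q : {set {set G}}) (pi : G -> G) :
  ramanujan R G k -> 5 <= k -> block_partition m Q pi -> k <= m -> 2 * m < 3 * k ->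
  ~ graph_iso G G0 -> globally_rigid_in R 2 G.
Proof.
move=> ram k5 sysP km mk notG0; have [_ connG regG _] := ram.
have k6 := degree_le6 regG sysP ram km k5.
have linked := blocks_linked regG sysP ram km k5.
have Q0 : 0 < #|Q|.
  by have [/card_gt0P[x _] _] := connG; apply/card_gt0P; exists (pblock Q x); apply: (block_in sysP).
have cG : #|G| = #|Q| * m.
  by rewrite -cardsT (card_uniform_partition (blocks_card sysP) (blocks_part sysP)).
(* For [m = 5] there are at most six blocks, not six since [G] is not [G0], and an even number of
   them because [25 |Q|] is even: at most four. *)
have few : (#|Q| + 2 * 1 <= 6) || (6 <= m).
  have [m6|m5] := leqP 6 m; first by rewrite orbT.
  have [kE mE] : k = 5 /\ m = 5 by clear - k5 km m5; lia.
  have := blocks_le regG sysP ram km k5; have := degree_parity regG; rewrite cG kE mE.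
  have : #|Q| != 6.
    by apply/eqP => Q6; apply: notG0; subst k m; apply: (six_blocks_iso regG sysP Q6 linked).
  by clear; move: #|Q| => q; rewrite !oddM /=; lia.
apply: redundant_globally_rigid_in => [|v].
  by apply: leq_trans (regular_large connG regG); clear - k5; lia.
apply: (glue_blocks regG sysP _ km mk linked) => //; rewrite ?cards1 //.
by clear - k5 k6; lia.
Qed.

Section DegreeFour.
Variables (R : realType) (G : sgraph).
Hypothesis ram : ramanujan R G 4.

Lemma bipartite_no_four_blocks (Q : {set {set G}}) (pi : G -> G) :
  block_partition 4 Q pi -> ~ bipartite G.
Proof.
move=> sysP [c col]; have [_ [/card_gt0P[x _] _] regG _] := ram.
have /card_gt2P[a [b [d [[aB bB dB] [ab bd da]]]]] : 2 < #|pblock Q x|.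
  by rewrite (blocks_card sysP) ?(block_in sysP).
have clique u v : u \in pblock Q x -> v \in pblock Q x -> u != v -> c u != c v.
  move=> uB vB uv; apply/col/(four_clique regG sysP) => //.
  by rewrite !(block_eq sysP (block_in sysP x)).
move: (clique a b aB bB ab) (clique b d bB dB bd) (clique d a dB aB da).
by case: (c a) (c b) (c d) => [] [] [].
Qed.

Lemma degree_four_glob_rigid : vertex_transitive G -> 53 <= #|G| \/ bipartite G ->
  globally_rigid_in R 2 G.
Proof.
move=> transG size; have [_ connG regG _] := ram.
have [big|[B blockB]] := cuts_or_block regG transG connG isT.
  apply: redundant_globally_rigid_in => [|v].
    by apply: leq_trans (regular_large connG regG).
  exact: large_cuts_tight regG _ big.
have [Q [pi sysP]] := is_block_partition connG transG (isT : 0 < 4) blockB.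
have [B4 B6 outB _] := blockB.
(* A block of five vertices would have [4 * 5 - 5] as twice its number of edges. *)
have := ecount_cut regG B; rewrite [cut B](eq_bigr (fun _ => 1) outB) sum1_card.
have [B5|B4'] := eqVneq #|B| 5; first by rewrite B5; clear; lia.
have BE : #|B| = 4 by clear - B4 B6 B4'; lia.
rewrite BE in sysP; case: size => [|/(bipartite_no_four_blocks sysP)//].
by rewrite leqNgt (four_blocks_small regG sysP ram).
Qed.

End DegreeFour.

Local Open Scope ring_scope.

Theorem theorem1p3 (R : realType) :
  [/\ forall (G : sgraph) (k : nat),
        ramanujan R G k -> vertex_transitive G -> (5 <= k)%N ->
        ~ graph_iso G G0 -> globally_rigid_in R 2 G,
      [/\ ramanujan R G0 5, vertex_transitive G0,
          rigid_in R 2 G0 & ~ globally_rigid_in R 2 G0] &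
      forall G : sgraph,
        ramanujan R G 4 -> vertex_transitive G ->
        (53 <= #|G|)%N \/ bipartite G -> globally_rigid_in R 2 G].
Proof.
split; last by move=> G ram; apply: degree_four_glob_rigid.
  move=> G k ram transG k5 notG0; have [_ connG regG _] := ram.
  have k4 : (4 <= k)%N by apply: ltnW.
  have [big|[B blockB]] := cuts_or_block regG transG connG k4.
    apply: redundant_globally_rigid_in => [|v].
      by apply: leq_trans (regular_large connG regG); apply: ltnW; apply: ltnW.
    exact: large_cuts_tight regG _ big.
  have [Q [pi sysP]] := is_block_partition connG transG (ltnW (ltnW (ltnW k4))) blockB.
  exact: (blocks_glob_rigid ram k5 sysP (block_ge blockB) (block_lt blockB) notG0).
split; [exact: ramanujanG0|exact: transitiveG0| |].
  have [p gp] := generic_exists R G0; exists p => //; have dp := generic_diff gp.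
  exact: inf_rigid_framework dp (inf_rigid_G0 dp).
move=> [p gp]; have [q [eqv ncong]] := not_globally_rigid_G0 (generic_diff gp).
exact: not_framework_globally_rigid eqv ncong.
Qed.
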